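(* Let $F$ be a field with $\mathrm{char}\,F=2$, let $Q$ be a Hurwitz algebra over $F$ of dimension $2$ or $4$, let $0\neq\alpha\in F$, and consider the Hurwitz superalgebra $C=\mathrm{CD}(Q,\alpha)$ (so $C_{\bar0}=Q$). Let $\Gamma:C=\bigoplus_{g\in G}C^g$ be a nontrivial grading on the superalgebra $C$, where $G$ is its universal grading group. Write $C_i^g=C^g\cap C_i$ for $i=\bar0,\bar1$. Then: $\bullet$ If $\dim Q=2$ ($\dim C=4$), then either $G=\mathbb{Z}_2$ and $\Gamma$ is the main grading, or $G=\mathbb{Z}$ and $\Gamma$ is the following grading: $Q$ is split and, for a canonical basis $\{e_1,e_2,u_1,v_1\}$ of $C$ consisting of homogeneous elements, $C_{\bar0}^0=Q=\mathrm{span}\{e_1,e_2\}$, $C_{\bar1}^1=\mathrm{span}\{u_1\}$, $C_{\bar1}^{-1}=\mathrm{span}\{v_1\}$. $\bullet$ If $\dim Q=4$ ($\dim C=8$), then up to equivalence one of the following holds. (i) $G=\mathbb{Z}_2^2$ and $\Gamma$ is the grading $$C_{\bar0}^{(\bar0,\bar0)}=K,\quad C_{\bar0}^{(\bar1,\bar0)}=Kv,\quad C_{\bar1}^{(\bar0,\bar1)}=Ku,\quad C_{\bar1}^{(\bar1,\bar1)}=K(vu),\qquad (\ast)$$ associated to a Cayley–Dickson doubling process as follows: $C=Q\oplus Qu$, $Q=K\oplus Kv$, $K=F1+Fw$ with $u,v,w$ nonisotropic orthogonal elements with zero trace. (Here $K$ is not necessarily split.) (ii) $G=\mathbb{Z}_2$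 and $\Gamma$ is either the main $\mathbb{Z}_2$-grading, or the coarsening of the grading $(\ast)$ given by $C^{\bar0}=K\oplus Ku$, $C^{\bar1}=Kv\oplus K(vu)$. (iii) $Q=C_{\bar0}$ is split, there is a canonical basis of $C$ consisting of homogeneous elements such that the main grading is $C_{\bar0}=\mathrm{span}\{e_1,e_2,u_3,v_3\}$, $C_{\bar1}=\mathrm{span}\{u_1,u_2,v_1,v_2\}$, and one of the following holds: (a) $G=\mathbb{Z}^2$ and $\Gamma$ is the Cartan grading: $C_{\bar0}^{(0,0)}=\mathrm{span}\{e_1,e_2\}$, $C_{\bar0}^{(1,1)}=\mathrm{span}\{v_3\}$, $C_{\bar0}^{(-1,-1)}=\mathrm{span}\{u_3\}$, $C_{\bar1}^{(1,0)}=\mathrm{span}\{u_1\}$, $C_{\bar1}^{(-1,0)}=\mathrm{span}\{v_1\}$, $C_{\bar1}^{(0,1)}=\mathrm{span}\{u_2\}$, $C_{\bar1}^{(0,-1)}=\mathrm{span}\{v_2\}$. (b) $G=\mathbb{Z}$ and $\Gamma$ is a 3-grading, where either $C_{\bar0}^0=Q=\mathrm{span}\{e_1,e_2,u_3,v_3\}$, $C_{\bar1}^1=\mathrm{span}\{u_1,v_2\}$, $C_{\bar1}^{-1}=\mathrm{span}\{u_2,v_1\}$; or $C^0=\mathrm{span}\{e_1,e_2,u_1,v_1\}$, $C^1=\mathrm{span}\{u_3,v_2\}$, $C^{-1}=\mathrm{span}\{u_2,v_3\}$. (c) $G=\mathbb{Z}$ and $\Gamma$ is a 5-grading, where either $C_{\bar0}^0=\mathrm{span}\{e_1,e_2\}$,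 $C_{\bar0}^2=\mathrm{span}\{v_3\}$, $C_{\bar0}^{-2}=\mathrm{span}\{u_3\}$, $C_{\bar1}^1=\mathrm{span}\{u_1,u_2\}$, $C_{\bar1}^{-1}=\mathrm{span}\{v_1,v_2\}$; or $C_{\bar0}^0=\mathrm{span}\{e_1,e_2\}$, $C_{\bar1}^2=\mathrm{span}\{v_1\}$, $C_{\bar1}^{-2}=\mathrm{span}\{u_1\}$, $C^1=\mathrm{span}\{u_2,u_3\}$, $C^{-1}=\mathrm{span}\{v_2,v_3\}$. (d) $G=\mathbb{Z}_3$, and $C_{\bar0}^{\bar0}=\mathrm{span}\{e_1,e_2\}$, $C^{\bar1}=\mathrm{span}\{u_1,u_2,u_3\}$, $C^{\bar2}=\mathrm{span}\{v_1,v_2,v_3\}$. (e) $G=\mathbb{Z}_4$, where either $C_{\bar0}^{\bar0}=\mathrm{span}\{e_1,e_2\}$, $C_{\bar1}^{\bar1}=\mathrm{span}\{u_1,u_2\}$, $C_{\bar0}^{\bar2}=\mathrm{span}\{u_3,v_3\}$, $C_{\bar1}^{\bar3}=\mathrm{span}\{v_1,v_2\}$; or $C_{\bar0}^{\bar0}=\mathrm{span}\{e_1,e_2\}$, $C^{\bar1}=\mathrm{span}\{u_2,u_3\}$, $C_{\bar1}^{\bar2}=\mathrm{span}\{u_1,v_1\}$, $C^{\bar3}=\mathrm{span}\{v_2,v_3\}$. (f) $G=\mathbb{Z}\times\mathbb{Z}_2$, where either $C_{\bar0}^{(0,\bar0)}=\mathrm{span}\{e_1,e_2\}$, $C_{\bar1}^{(1,\bar0)}=\mathrm{span}\{u_2\}$,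 $C_{\bar1}^{(-1,\bar0)}=\mathrm{span}\{v_2\}$, $C_{\bar1}^{(0,\bar1)}=\mathrm{span}\{u_1,v_1\}$, $C_{\bar0}^{(-1,\bar1)}=\mathrm{span}\{u_3\}$, $C_{\bar0}^{(1,\bar1)}=\mathrm{span}\{v_3\}$; or $C_{\bar0}^{(0,\bar0)}=\mathrm{span}\{e_1,e_2\}$, $C_{\bar1}^{(1,\bar0)}=\mathrm{span}\{u_2\}$, $C_{\bar1}^{(-1,\bar0)}=\mathrm{span}\{v_2\}$, $C_{\bar0}^{(0,\bar1)}=\mathrm{span}\{u_3,v_3\}$, $C_{\bar1}^{(-1,\bar1)}=\mathrm{span}\{u_1\}$, $C_{\bar1}^{(1,\bar1)}=\mathrm{span}\{v_1\}$.
   Context: Gradings. A grading by a group $G$ on an algebra $\mathcal A$ is a decomposition $\Gamma:\mathcal A=\bigoplus_{g\in G}\mathcal A^g$ into subspaces with $\mathcal A^g\mathcal A^h\subseteq\mathcal A^{gh}$; its support is $\{g:\mathcal A^g\neq0\}$. Its universal grading group is the group generated by the support subject to the relations $g_1g_2=g_3$ whenever $0\neq\mathcal A^{g_1}\mathcal A^{g_2}\subseteq\mathcal A^{g_3}$. A superalgebra is a $\mathbb{Z}_2$-graded algebra $\mathcal A=\mathcal A_{\bar0}\oplus\mathcal A_{\bar1}$; this is called the main grading. A grading on the superalgebra $\mathcal A$ is a group grading on the algebra $\mathcal A$ such that $\mathcal A^g=(\mathcal A^g\cap\mathcal A_{\bar0})\oplus(\mathcal A^g\cap\mathcal A_{\bar1})$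 for all $g$. The trivial grading is $\mathcal A=\mathcal A^e$. $\Gamma'$ is a coarsening of $\Gamma$ if every component of $\Gamma$ is contained in a component of $\Gamma'$. Two gradings are equivalent if there is an isomorphism of superalgebras (preserving the main grading) mapping each nonzero homogeneous component of the first onto a homogeneous component of the second. All groups considered are abelian (the support of a grading on these superalgebras always generates an abelian group). Hurwitz algebras. A Hurwitz algebra is a unital algebra over $F$ with a regular multiplicative quadratic form $q$ (the norm); its polar form is also denoted $q$, and $\bar x=q(x,1)1-x$. The trace of $x$ is $q(x,1)$. Orthogonality refers to the polar form; an element $x$ is nonisotropic if $q(x)\neq0$. A Hurwitz algebra is split if it has a nonzero $x$ with $q(x)=0$. Given a Hurwitz algebra $Q$ with norm $q$ and $0\ne\alpha\in F$, $\mathrm{CD}(Q,\alpha)=Q\oplus Qu$ has multiplication $(a+bu)(c+du)=(ac-\alpha\bar d b)+(da+b\bar c)u$ for $a,b,c,d\in Q$ and norm $q(a+bu)=q(a)+\alpha q(b)$. It is a superalgebra with even part $Q$ and odd part $Qu$. Canonical basis of a split Cayley ($8$-dimensional Hurwitz) algebra: a basis $\{e_1,e_2,u_1,u_2,u_3,v_1,v_2,v_3\}$ with (indices mod $3$) $e_i^2=e_i$, $e_1e_2=e_2e_1=0$, $e_1u_i=u_i=u_ie_2$, $e_2v_i=v_i=v_ie_1$, $e_2u_i=u_ie_1=e_1v_i=v_ie_2=0$, $u_iu_{i+1}=v_{i+2}=-u_{i+1}u_i$, $v_iv_{i+1}=u_{i+2}=-v_{i+1}v_i$, $u_i^2=v_i^2=0$,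 $u_iv_j=-\delta_{ij}e_1$, $v_iu_j=-\delta_{ij}e_2$. A canonical basis of the split quaternion ($4$-dimensional Hurwitz) algebra is a basis $\{e_1,e_2,u_1,v_1\}$ with the same multiplication rules.
   Formalization: In (i) and (ii), ''w nonisotropic with zero trace'' is impossible in characteristic 2 (w would lie in the radical of the norm of Q); it is replaced by: w is even and K=F1+Fw is 2-dimensional with nondegenerate polar form. Orthogonality of u, v, w and the conditions on u and v are kept. *)

(* Defs.v *)
From HB Require Import structures.
From mathcomp Require Import all_boot all_order all_algebra ring.

Set Implicit Arguments.
Unset Strict Implicit.
Unset Printing Implicit Defensive.

Import GRing.Theory.
Local Open Scope ring_scope.

Record nonassocAlg (F : fieldType) := NonassocAlg {
  na_vect :> vectType F;
  na_mul : na_vect -> na_vect -> na_vect;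
  na_mulP : bilinear_for *:%R *:%R na_mul
}.

Arguments na_mul {F n} _ _.
Arguments na_mulP {F} n.

HB.instance Definition _ (F : fieldType) (A : nonassocAlg F) :=
  bilinear_isBilinear.Build F A A A *:%R *:%R (@na_mul F A) (na_mulP A).

Infix "**" := na_mul (at level 40, left associativity) : ring_scope.

Lemma na_mulPl (F : fieldType) (A : nonassocAlg F) a (x y z : A) :
  (a *: x + y) ** z = a *: (x ** z) + y ** z.
Proof. exact: (na_mulP A).1. Qed.

Lemma na_mulPr (F : fieldType) (A : nonassocAlg F) a (x y z : A) :
  x ** (a *: y + z) = a *: (x ** y) + x ** z.
Proof. exact: (na_mulP A).2. Qed.

Lemma na_mul0l (F : fieldType) (A : nonassocAlg F) (x : A) : 0 ** x = 0.
Proof. exact: linear0l. Qed.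

Lemma na_mul0r (F : fieldType) (A : nonassocAlg F) (x : A) : x ** 0 = 0.
Proof. exact: linear0r. Qed.

Definition na_mulby (F : fieldType) (A : nonassocAlg F) (x k : A) : A := k ** x.

HB.instance Definition _ (F : fieldType) (A : nonassocAlg F) (x : A) :=
  GRing.isLinear.Build F A A *:%R (na_mulby x)
    (fun a y z => na_mulPl a y z x).

(* The subspace K x = {k x | k in K}. *)
Definition mulvr (F : fieldType) (A : nonassocAlg F) (K : {vspace A}) (x : A)
    : {vspace A} := (linfun (na_mulby x) @: K)%VS.

Lemma mulvrP (F : fieldType) (A : nonassocAlg F) (K : {vspace A}) (x y : A) :
  reflect (exists2 k, k \in K & y = k ** x) (y \in mulvr K x).
Proof.
by apply: (iffP memv_imgP) => -[k kK ->]; exists k; rewrite ?lfunE.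
Qed.

Definition polar (F : fieldType) (V : lmodType F) (q : V -> F) (x y : V) : F :=
  q (x + y) - q x - q y.

Definition quadratic_form (F : fieldType) (V : lmodType F) (q : V -> F) :=
  ((forall (a : F) (x : V), q (a *: x) = (a ^+ 2 * q x)%R) *
   bilinear_for *%R *%R (polar q))%type.

(* An algebra with a distinguished element and a quadratic form; that these
   are a unit and a regular multiplicative form is asserted by [hurwitz]. *)
Record quadAlg (F : fieldType) := QuadAlg {
  qa_alg :> nonassocAlg F;
  qa_one : qa_alg;
  qa_norm : qa_alg -> F;
  qa_normP : quadratic_form qa_norm
}.

Arguments qa_one {F} q.
Arguments qa_norm {F} q _.
Arguments qa_normP {F} q.

Definition qa_polar (F : fieldType) (A : quadAlg F) : A -> A -> F :=
  polar (qa_norm A).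

HB.instance Definition _ (F : fieldType) (A : quadAlg F) :=
  bilinear_isBilinear.Build F A A F *%R *%R (@qa_polar F A) (qa_normP A).2.

Lemma qa_polarPl (F : fieldType) (A : quadAlg F) a (x y z : A) :
  qa_polar (a *: x + y) z = a * qa_polar x z + qa_polar y z.
Proof. exact: (qa_normP A).2.1. Qed.

Lemma qa_polarPr (F : fieldType) (A : quadAlg F) a (x y z : A) :
  qa_polar x (a *: y + z) = a * qa_polar x y + qa_polar x z.
Proof. exact: (qa_normP A).2.2. Qed.

Definition qa_trace (F : fieldType) (A : quadAlg F) (x : A) : F :=
  qa_polar x (qa_one A).

Definition qa_conj (F : fieldType) (A : quadAlg F) (x : A) : A :=
  qa_polar x (qa_one A) *: qa_one A - x.

Definition qa_nonisotropic (F : fieldType) (A : quadAlg F) (x : A) : Prop :=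
  qa_norm A x != 0.

Definition qa_orthogonal (F : fieldType) (A : quadAlg F) (x y : A) : Prop :=
  qa_polar x y = 0.

(* The polar form restricts to a nondegenerate form on K.  This is regularity
   of the norm of K when dim K is even; in characteristic 2 regular forms of
   odd dimension need a different definition, but they do not occur here. *)
Definition regular_on (F : fieldType) (A : quadAlg F) (K : {vspace A}) : Prop :=
  forall x : A, x \in K -> (forall y : A, y \in K -> qa_orthogonal x y) -> x = 0.

Definition hurwitz (F : fieldType) (A : quadAlg F) : Prop :=
  [/\ forall x : A, qa_one A ** x = x /\ x ** qa_one A = x,
      regular_on {:A}%VS
    & forall x y : A, qa_norm A (x ** y) = qa_norm A x * qa_norm A y].

Definition qa_split (F : fieldType) (A : quadAlg F) : Prop :=
  exists2 x : A, x != 0 & qa_norm A x = 0.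

Section CayleyDickson.
Variables (F : fieldType) (Q : quadAlg F) (alpha : F).

(* The pair (a, b) stands for a + b u. *)
Definition CD_vect : vectType F := (Q * Q)%type.

Definition CD_mul (x y : CD_vect) : CD_vect :=
  (x.1 ** y.1 - alpha *: (qa_conj y.2 ** x.2),
   y.2 ** x.1 + x.2 ** qa_conj y.1).

Definition CD_norm (x : CD_vect) : F := qa_norm Q x.1 + alpha * qa_norm Q x.2.

Lemma qa_conjP a (x y : Q) : qa_conj (a *: x + y) = a *: qa_conj x + qa_conj y.
Proof.
by rewrite /qa_conj qa_polarPl scalerDl opprD scalerBr scalerA addrACA.
Qed.

Lemma CD_mulP : bilinear_for *:%R *:%R CD_mul.
Proof.
split=> [y a x z|x a y z]; rewrite /CD_mul ?qa_conjP; congr (_, _) => /=.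
- move: (qa_conj y.2) => c.
  rewrite na_mulPl na_mulPr scalerDr scalerBr opprD addrACA.
  by rewrite !scalerA [alpha * a]mulrC.
- move: (qa_conj y.1) => c.
  by rewrite na_mulPl na_mulPr scalerDr addrACA.
- move: (qa_conj y.2) (qa_conj z.2) => c d.
  rewrite na_mulPl na_mulPr scalerDr scalerBr opprD addrACA.
  by rewrite !scalerA [alpha * a]mulrC.
- move: (qa_conj y.1) (qa_conj z.1) => c d.
  by rewrite na_mulPl na_mulPr scalerDr addrACA.
Qed.

Lemma CD_polarE (x y : CD_vect) :
  polar CD_norm x y = qa_polar x.1 y.1 + alpha * qa_polar x.2 y.2.
Proof. by rewrite /qa_polar /polar /CD_norm /=; ring. Qed.

Lemma CD_normP : quadratic_form CD_norm.
Proof.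
split=> [a x|]; first by rewrite /CD_norm /= !(qa_normP Q).1; ring.
by split=> [y a x z|x a y z]; rewrite !CD_polarE !(qa_polarPl, qa_polarPr) /=;
  ring.
Qed.

Definition CD : quadAlg F :=
  @QuadAlg F (NonassocAlg CD_mulP) (qa_one Q, 0) CD_norm CD_normP.

(* The main grading: Q in degree 0 and Q u in degree 1. *)
Definition CD_main (i : 'Z_2) : {vspace CD} :=
  if i == 0 then lker (linfun (snd : CD_vect -> Q))
  else lker (linfun (fst : CD_vect -> Q)).

Lemma mem_CD_even (x : CD) : (x \in CD_main 0) = (x.2 == 0).
Proof. by rewrite memv_ker lfunE. Qed.

Lemma mem_CD_odd (x : CD) : (x \in CD_main 1) = (x.1 == 0).
Proof. by rewrite memv_ker lfunE. Qed.

End CayleyDickson.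

Section Gradings.
Variable F : fieldType.

(* The grading group is abelian and written additively. *)
Definition grading (A : nonassocAlg F) (G : zmodType) (Gam : G -> {vspace A})
    : Prop :=
  [/\ forall x : A, exists (s : seq G) (c : G -> A),
        (forall g, c g \in Gam g) /\ x = \sum_(g <- s) c g,
      forall (s : seq G) (c : G -> A), uniq s -> (forall g, c g \in Gam g) ->
        \sum_(g <- s) c g = 0 -> forall g, g \in s -> c g = 0
    & forall (g h : G) (x y : A),
        x \in Gam g -> y \in Gam h -> x ** y \in Gam (g + h)].

Definition in_support (A : nonassocAlg F) (G : zmodType)
    (Gam : G -> {vspace A}) (g : G) : Prop := Gam g <> 0%VS.

Definition support_relation (A : nonassocAlg F) (G : zmodType)
    (Gam : G -> {vspace A}) (g1 g2 g3 : G) : Prop :=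
  [/\ in_support Gam g1, in_support Gam g2, in_support Gam g3,
      exists x y : A, [/\ x \in Gam g1, y \in Gam g2 & x ** y != 0]
    & forall x y : A, x \in Gam g1 -> y \in Gam g2 -> x ** y \in Gam g3].

(* G is the abelian group presented by the support of Gam as generators,
   subject to the relations g1 + g2 = g3 of [support_relation]; the values of
   [f] outside the support play no role. *)
Definition universal_group (A : nonassocAlg F) (G : zmodType)
    (Gam : G -> {vspace A}) : Prop :=
  forall (H : zmodType) (f : G -> H),
    (forall g1 g2 g3, support_relation Gam g1 g2 g3 -> f g1 + f g2 = f g3) ->
    exists phi : {additive G -> H},
      (forall g, in_support Gam g -> phi g = f g) /\
      (forall psi : {additive G -> H},
         (forall g, in_support Gam g -> psi g = f g) -> psi =1 phi).

(* [P] is the main grading of the superalgebra [A]; the sum below is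
   automatically direct. *)
Definition super_grading (A : nonassocAlg F) (P : 'Z_2 -> {vspace A})
    (G : zmodType) (Gam : G -> {vspace A}) : Prop :=
  grading Gam /\
  forall g, Gam g = ((Gam g :&: P 0%R) + (Gam g :&: P 1%R))%VS.

Definition trivial_grading (A : nonassocAlg F) (G : zmodType)
    (Gam : G -> {vspace A}) : Prop := Gam 0 = fullv.

Definition homogeneous (A : nonassocAlg F) (G : zmodType)
    (Gam : G -> {vspace A}) (x : A) : Prop := exists g, x \in Gam g.

Definition super_iso (A B : nonassocAlg F) (P : 'Z_2 -> {vspace A})
    (R : 'Z_2 -> {vspace B}) (f : 'Hom(A, B)) : Prop :=
  [/\ bijective f, forall x y : A, f (x ** y) = f x ** f y
    & forall i, (f @: P i)%VS = R i].

Definition graded_equiv (A B : nonassocAlg F) (P : 'Z_2 -> {vspace A})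
    (R : 'Z_2 -> {vspace B}) (G H : zmodType) (Gam : G -> {vspace A})
    (Del : H -> {vspace B}) : Prop :=
  exists f : 'Hom(A, B), super_iso P R f /\
    forall g, Gam g <> 0%VS -> exists h, (f @: Gam g)%VS = Del h.

(* "G = H and Gam is the grading Del", the groups being identified along an
   isomorphism. *)
Definition graded_as (A : nonassocAlg F) (G H : zmodType)
    (Gam : G -> {vspace A}) (Del : H -> {vspace A}) : Prop :=
  exists phi : {additive G -> H}, bijective phi /\
    forall g, Gam g = Del (phi g).

(* The family of subspaces given by a list of (degree, component), the
   components in all degrees not listed being 0. *)
Definition table (A : nonassocAlg F) (H : zmodType)
    (t : seq (H * {vspace A})) (h : H) : {vspace A} :=
  (\sum_(p <- t | p.1 == h) p.2)%VS.

End Gradings.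

Lemma CD_main_grading (F : fieldType) (Q : quadAlg F) (alpha : F) :
  grading (CD_main Q alpha).
Proof.
have Z2 (i : 'Z_2) : i = 0 \/ i = 1.
  by case: i => [[|[|[]]]] // ?; [left|right]; apply/val_inj.
have pair0 (x : CD Q alpha) : x.1 = 0 -> x.2 = 0 -> x = 0.
  by case: x => ? ? /= -> ->.
have conj0 : qa_conj (0 : Q) = 0.
  by rewrite /qa_conj [qa_polar _ _]linear0l scale0r subr0.
split.
- move=> [a b]; exists [:: 0; 1].
  exists (fun i : 'Z_2 => if i == 0 then (a, 0) else (0, b) : CD Q alpha).
  split=> [i|]; last first.
    rewrite !big_cons big_nil addr0 /=.
    by congr (_, _) => /=; rewrite ?addr0 ?add0r.
  by case: (Z2 i) => ->; rewrite ?mem_CD_even ?mem_CD_odd /=.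
- move=> s c us hc hs g gs.
  have := hc 0; have := hc 1; rewrite mem_CD_even mem_CD_odd => /eqP c1 /eqP c0.
  have h1 : \sum_(g <- s) (c g).1 = 0.
    by rewrite -(big_morph (fst : CD_vect Q -> Q) (id1 := 0) (op1 := +%R)
      (id2 := 0) (op2 := +%R)) // [bigop.body _ _ _]hs.
  have h2 : \sum_(g <- s) (c g).2 = 0.
    by rewrite -(big_morph (snd : CD_vect Q -> Q) (id1 := 0) (op1 := +%R)
      (id2 := 0) (op2 := +%R)) // [bigop.body _ _ _]hs.
  case: (Z2 g) gs => -> gs; apply: pair0 => //.
    move: h1; rewrite (bigD1_seq 0) //= big1 ?addr0 // => i.
    by case: (Z2 i) => -> // /eqP.
  move: h2; rewrite (bigD1_seq 1) //= big1 ?addr0 // => i.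
  by case: (Z2 i) => -> // /eqP.
- move=> g h x y; case: (Z2 g) => ->; case: (Z2 h) => ->;
    rewrite ?(addr0, add0r) -?[1 + 1]/(0 : 'Z_2) ?mem_CD_even ?mem_CD_odd /=;
    move=> /eqP -> /eqP ->;
    by rewrite ?conj0 ?na_mul0l ?na_mul0r ?scaler0 ?subr0 ?addr0.
Qed.

Section CanonicalBases.
Variables (F : fieldType) (A : nonassocAlg F).

Definition canonical_basis4 (e1 e2 u1 v1 : A) : Prop :=
  [/\ basis_of fullv [:: e1; e2; u1; v1],
      [/\ e1 ** e1 = e1, e2 ** e2 = e2, e1 ** e2 = 0 & e2 ** e1 = 0],
      [/\ e1 ** u1 = u1, u1 ** e2 = u1, e2 ** v1 = v1 & v1 ** e1 = v1],
      [/\ e2 ** u1 = 0, u1 ** e1 = 0, e1 ** v1 = 0 & v1 ** e2 = 0]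
    & [/\ u1 ** u1 = 0, v1 ** v1 = 0, u1 ** v1 = - e1 & v1 ** u1 = - e2]].

(* The indices of u and v are integers mod 3. *)
Definition canonical_basis8 (e1 e2 : A) (u v : 'Z_3 -> A) : Prop :=
  [/\ basis_of fullv [:: e1; e2; u 1; u 2; u 3; v 1; v 2; v 3],
      [/\ e1 ** e1 = e1, e2 ** e2 = e2, e1 ** e2 = 0 & e2 ** e1 = 0],
      forall i,
        [/\ e1 ** u i = u i, u i ** e2 = u i, e2 ** v i = v i
          & v i ** e1 = v i] /\
        [/\ e2 ** u i = 0, u i ** e1 = 0, e1 ** v i = 0 & v i ** e2 = 0],
      forall i,
        [/\ u i ** u (i + 1) = v (i + 2), u (i + 1) ** u i = - v (i + 2),
            v i ** v (i + 1) = u (i + 2), v (i + 1) ** v i = - u (i + 2)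
          & u i ** u i = 0 /\ v i ** v i = 0]
    & forall i j,
        u i ** v j = - ((i == j)%:R *: e1) /\
        v i ** u j = - ((i == j)%:R *: e2)].

End CanonicalBases.

(* C = Q + Q u and Q = K + K v are obtained by doubling from K = F 1 + F w,
   with Q the even part of the superalgebra C and u odd.  In characteristic
   not 2 one may ask that w be nonisotropic of trace zero.  In characteristic 2
   that is impossible: w would be in the radical of the norm of Q.  What is
   asked of w is therefore that K be a 2-dimensional Hurwitz algebra. *)
Definition CD_doubling (F : fieldType) (C : quadAlg F) (P : 'Z_2 -> {vspace C})
    (w v u : C) : Prop :=
  let K := (<[qa_one C]> + <[w]>)%VS in
  [/\ [/\ \dim K = 2%N, regular_on K & w \in P 0],
      [/\ v \in P 0, qa_nonisotropic v, qa_trace v = 0 & qa_orthogonal v w],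
      [/\ u \in P 1, qa_nonisotropic u, qa_trace u = 0, qa_orthogonal u w
        & qa_orthogonal u v],
      directv (K + mulvr K v) /\ (K + mulvr K v)%VS = P 0
    & directv (P 0%R + mulvr (P 0%R) u) /\ (P 0%R + mulvr (P 0%R) u)%VS = fullv].

(* Main.v *)
From HB Require Import structures.
Require Import Defs.
From mathcomp Require Import all_boot all_order all_algebra ring zify.
From Stdlib Require Classical_Prop.

Set Implicit Arguments.
Unset Strict Implicit.
Unset Printing Implicit Defensive.

Import GRing.Theory.
Local Open Scope ring_scope.

(** Intersecting the components with those of the main grading gives a grading
    by G x Z/2; let R be its component of degree 0, on which the norm is
    nondegenerate.  If R is anisotropic, then so is every homogeneous component:
    all degrees have order at most 2, and doubling R by an even and an odd
    homogeneous element leads to the main grading, (i) or (ii).  Otherwise R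
    contains an idempotent e of trace 1 and norm 0, and homogeneous elements of
    the Peirce component {x | e x = x = x (1 - e)} can be completed to a
    homogeneous canonical basis.  The grading is then determined by the degrees
    a_1, a_2, a_3 of the u_i, whose sum is 0: the case is read off from which of
    the elements 0, a_i, - a_i coincide, and by universality G has no relations
    other than those coincidences.  *)

(** An idempotent found in R is even and of degree 0, so its Peirce components, and whatever is
    built from them, are homogeneous for both gradings at once; since R lies in the even part, an
    isotropic vector of R also makes Q split. Isotropy alone does not lead to the list (a)-(f): when
    every a_i is killed by 2, the canonical basis exists but the grading is the main one or a
    doubling, with K = F1 + Fe and with doubling elements among the sums u_i + v_i, which have norm
    1. Characteristic 2 shapes the argument in two ways. The polar form is alternating, so 1 is
    completed to a nondegenerate plane by an element of nonzero trace. Signs disappear, so u_1 and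
    u_2 may be exchanged, which reduces fourteen patterns of coincidences to the ten of the
    statement. As G is abstract, a homomorphism from the model group to G is written down by hand
    and only its inverse comes from universality. All bases are found inside C, so the equivalence
    in the statement is the identity. Finally, C is itself a Hurwitz algebra only because Q is
    associative, which is proved here from the norm. *)

Section Multiplication.
Variables (F : fieldType) (A : nonassocAlg F).
Implicit Types (x y z : A) (a : F).

Lemma na_mulDl x y z : (x + y) ** z = x ** z + y ** z.
Proof. exact: linearDl. Qed.

Lemma na_mulDr x y z : x ** (y + z) = x ** y + x ** z.
Proof. exact: linearDr. Qed.

Lemma na_mulNl x y : (- x) ** y = - (x ** y).
Proof. exact: linearNl. Qed.

Lemma na_mulNr x y : x ** (- y) = - (x ** y).
Proof. exact: linearNr. Qed.

Lemma na_mulZl a x y : (a *: x) ** y = a *: (x ** y).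
Proof. exact: linearZl_LR. Qed.

Lemma na_mulZr a x y : x ** (a *: y) = a *: (x ** y).
Proof. exact: linearZr_LR. Qed.

Definition na_mulE := (na_mulDl, na_mulDr, na_mulNl, na_mulNr, na_mulZl,
  na_mulZr, @na_mul0l F A, @na_mul0r F A).

End Multiplication.

(** * Identities that follow from the multiplicativity of the norm *)

Section Hurwitz.
Variables (F : fieldType) (A : quadAlg F).
Local Notation q := (qa_norm A).
Local Notation b := (@qa_polar F A).
Local Notation one := (qa_one A).
Implicit Types (x y z w : A) (a c : F).

Lemma polarDl x y z : b (x + y) z = b x z + b y z.
Proof. exact: linearDl. Qed.

Lemma polarDr x y z : b x (y + z) = b x y + b x z.
Proof. exact: linearDr. Qed.

Lemma polarNl x y : b (- x) y = - b x y.
Proof. exact: linearNl. Qed.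

Lemma polarNr x y : b x (- y) = - b x y.
Proof. exact: linearNr. Qed.

Lemma polarZl a x y : b (a *: x) y = a * b x y.
Proof. exact: linearZl_LR. Qed.

Lemma polarZr a x y : b x (a *: y) = a * b x y.
Proof. exact: linearZr_LR. Qed.

Lemma polar0l x : b 0 x = 0.
Proof. exact: linear0l. Qed.

Lemma polar0r x : b x 0 = 0.
Proof. exact: linear0r. Qed.

Definition polarE := (polarDl, polarDr, polarNl, polarNr, polarZl, polarZr,
  polar0l, polar0r).

Lemma polarC x y : b x y = b y x.
Proof. by rewrite /qa_polar /polar [y + x]addrC; ring. Qed.

Lemma normD x y : q (x + y) = q x + q y + b x y.
Proof. by rewrite /qa_polar /polar; ring. Qed.

Lemma normZ a x : q (a *: x) = a ^+ 2 * q x.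
Proof. exact: (qa_normP A).1. Qed.

Lemma norm0 : q 0 = 0.
Proof. by rewrite -(scale0r 0) normZ expr0n mul0r. Qed.

Lemma normN x : q (- x) = q x.
Proof. by rewrite -scaleN1r normZ sqrrN expr1n mul1r. Qed.

Lemma polarxx x : b x x = 2%:R * q x.
Proof.
rewrite /qa_polar /polar -mulr2n -scaler_nat normZ; ring.
Qed.

Hypothesis hA : hurwitz A.

Lemma na_mul1x x : one ** x = x.
Proof. by case: hA => /(_ x) []. Qed.

Lemma na_mulx1 x : x ** one = x.
Proof. by case: hA => /(_ x) []. Qed.

Lemma normM x y : q (x ** y) = q x * q y.
Proof. by case: hA. Qed.

Lemma polar_eq0 x : (forall y, b x y = 0) -> x = 0.
Proof. by case: hA => _ h _ ?; apply: h => [|? _]; rewrite ?memvf. Qed.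

Lemma polar_inj x y : (forall z, b x z = b y z) -> x = y.
Proof.
move=> h; apply/eqP; rewrite -subr_eq0; apply/eqP/polar_eq0 => z.
by rewrite !polarE h subrr.
Qed.

(** Testing the finitely many vectors of a basis makes the witness constructive: if all of them are
    orthogonal to [x], so is everything. *)
Lemma polar_neq0 x : x != 0 -> exists y, b x y != 0.
Proof.
move=> x0; have [h|h] := boolP [forall i : 'I_(\dim {:A}), b x (vbasis {:A})`_i == 0].
  case/eqP: x0; apply: polar_eq0 => y.
  rewrite (coord_vbasis (memvf y)) (big_morph (b x) (polarDr x) (polar0r x)).
  rewrite big1 // => i _; rewrite polarZr.
  by move/forallP/(_ i)/eqP: h => ->; rewrite mulr0.
by move: h; rewrite negb_forall => /existsP[i hi]; exists (vbasis {:A})`_i.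
Qed.

(** If [q x = q y = 0] for a pair with [b x y] nonzero, then [q (x + y) = b x y]. *)
Lemma norm_nontrivial : \dim {:A} != 0%N -> exists x, q x != 0.
Proof.
rewrite dimv_eq0 -subv0 => /subvPn[x _]; rewrite memv0 => /polar_neq0[y hb].
have [hx|] := eqVneq (q x) 0; last by exists x.
have [hy|] := eqVneq (q y) 0; last by exists y.
by exists (x + y); rewrite normD hx hy !add0r.
Qed.

Lemma polarMl x y z : b (x ** y) (x ** z) = q x * b y z.
Proof. by rewrite /qa_polar /polar -na_mulDr !normM; ring. Qed.

Lemma polarMr x y z : b (y ** x) (z ** x) = q x * b y z.
Proof. by rewrite /qa_polar /polar -na_mulDl !normM; ring. Qed.

(** Linearises [polarMl] in its first argument; the adjoint formulas, and through them the
    alternative laws, descend from it. *)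
Lemma polarMM x y z w : b (x ** y) (z ** w) = b x z * b y w - b (z ** y) (x ** w).
Proof.
have := polarMl (x + z) y w.
rewrite !na_mulE !polarE !polarMl normD => h; apply/eqP; rewrite -subr_eq0.
by move/eqP: h; rewrite -subr_eq0 => /eqP <-; apply/eqP; ring.
Qed.

Lemma norm1 : \dim {:A} != 0%N -> q one = 1.
Proof.
move/norm_nontrivial => [x qx]; apply: (mulIf qx).
by rewrite -normM na_mul1x mul1r.
Qed.

Lemma adjoint_l x y z : b (x ** y) z = b y (qa_conj x ** z).
Proof.
have := polarMM x y one z; rewrite !na_mul1x => ->.
by rewrite /qa_conj !na_mulE !polarE na_mul1x; ring.
Qed.

Lemma adjoint_r x y z : b (x ** y) z = b x (z ** qa_conj y).
Proof.
have := polarMM x y z one; rewrite !na_mulx1 => ->.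
by rewrite /qa_conj !na_mulE !polarE na_mulx1 [b (z ** y) x]polarC; ring.
Qed.

Lemma conj_mulK x y : qa_conj x ** (x ** y) = q x *: y.
Proof.
by apply: polar_inj => z; rewrite polarC -adjoint_l polarMl polarE [b z y]polarC.
Qed.

Lemma mulK_conj x y : (y ** x) ** qa_conj x = q x *: y.
Proof.
by apply: polar_inj => z; rewrite polarC -adjoint_r polarMr polarE [b z y]polarC.
Qed.

(** Writing out the conjugate in [conj_mulK] gives the left alternative law, as a quadratic equation
    for left multiplication by [x]. *)
Lemma na_mulKl x y : x ** (x ** y) = b x one *: (x ** y) - q x *: y.
Proof.
by rewrite -conj_mulK /qa_conj !na_mulE na_mul1x; rewrite opprB addrC subrK.
Qed.

Lemma na_mulKr x y : (y ** x) ** x = b x one *: (y ** x) - q x *: y.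
Proof.
by rewrite -mulK_conj /qa_conj !na_mulE na_mulx1; rewrite opprB addrC subrK.
Qed.

Lemma na_sqr x : x ** x = b x one *: x - q x *: one.
Proof. by have := na_mulKl x one; rewrite !na_mulx1. Qed.

Lemma na_mulKl_lin x y z :
  x ** (z ** y) = b x one *: (z ** y) + b z one *: (x ** y) - b x z *: y - z ** (x ** y).
Proof.
(* Pairing with an arbitrary [w] moves the identity into the field, where [ring] decides it. *)
apply: polar_inj => w.
have /(congr1 (fun t => b t w)) := na_mulKl (x + z) y.
rewrite !na_mulE !na_mulKl normD !polarE => h; apply/eqP; rewrite -subr_eq0.
by move/eqP: h; rewrite -subr_eq0 => /eqP <-; apply/eqP; ring.
Qed.

Lemma na_mulKr_lin x y z :
  (y ** z) ** x = b x one *: (y ** z) + b z one *: (y ** x) - b x z *: y - (y ** x) ** z.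
Proof.
apply: polar_inj => w.
have /(congr1 (fun t => b t w)) := na_mulKr (x + z) y.
rewrite !na_mulE !na_mulKr normD !polarE => h; apply/eqP; rewrite -subr_eq0.
by move/eqP: h; rewrite -subr_eq0 => /eqP <-; apply/eqP; ring.
Qed.

Lemma na_anticomm x z :
  x ** z = b x one *: z + b z one *: x - b x z *: one - z ** x.
Proof. by have := na_mulKl_lin x one z; rewrite !na_mulx1. Qed.

Lemma na_mulr_eq0 x y : q x != 0 -> y ** x = 0 -> y = 0.
Proof.
move=> qx yx0; have := mulK_conj x y; rewrite yx0 na_mulE.
by move/esym/eqP; rewrite scaler_eq0 (negPf qx) => /eqP.
Qed.

Lemma polar_conj1 x : \dim {:A} != 0%N -> b (qa_conj x) one = b x one.
Proof.
by move=> /norm1 h1; rewrite /qa_conj !polarE polarxx h1; ring.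
Qed.

Lemma conj_conj x : \dim {:A} != 0%N -> qa_conj (qa_conj x) = x.
Proof.
by move=> hd; rewrite {1}/qa_conj polar_conj1 // /qa_conj opprB addrC subrK.
Qed.

Lemma norm_conj x : \dim {:A} != 0%N -> q (qa_conj x) = q x.
Proof.
move=> hd; rewrite /qa_conj normD normZ normN norm1 // !polarE [b one _]polarC.
ring.
Qed.

End Hurwitz.

(** * Associativity in dimensions 2 and 4 *)

Section Associativity.
Variables (F : fieldType) (A : quadAlg F) (hA : hurwitz A).
Hypothesis char2 : 2%N \in [pchar F].
Local Notation q := (qa_norm A).
Local Notation b := (@qa_polar F A).
Local Notation one := (qa_one A).
Implicit Types (x y z w : A) (a c : F).

Lemma addvv x : x + x = 0.
Proof. by rewrite -mulr2n -scaler_nat (pcharf0 char2) scale0r. Qed.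

Lemma oppvv x : - x = x.
Proof. by apply/eqP; rewrite eq_sym -subr_eq0 opprK addvv. Qed.

Lemma polar_alt x : b x x = 0.
Proof. by rewrite polarxx (pcharf0 char2) mul0r. Qed.

(** The functional [b _ z] kills the span of [X] but not [x]. Linear independence is proved below by
    exhibiting dual vectors in this way. *)
Lemma free_cons_polar (x z : A) (X : seq A) :
  (forall y, y \in X -> b y z = 0) -> b x z != 0 -> free X -> free (x :: X).
Proof.
move=> hX hx fX; rewrite free_cons fX andbT; apply: contra hx => xX.
rewrite (@coord_span _ _ _ (in_tuple X) _ xX) polarC (big_morph (b z) (polarDr z) (polar0r z)).
rewrite big1 // => i _; rewrite polarE polarC hX ?mulr0 //.
by rewrite mem_nth //= size_tuple.
Qed.

Definition associator x y z := (x ** y) ** z - x ** (y ** z).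

Lemma associatorDl x x' y z :
  associator (x + x') y z = associator x y z + associator x' y z.
Proof. by rewrite /associator !na_mulE opprD addrACA. Qed.

Lemma associatorZl a x y z : associator (a *: x) y z = a *: associator x y z.
Proof. by rewrite /associator !na_mulE scalerBr. Qed.

(** Alternativity gives [associator w w z = 0]; for [w = x + y] the diagonal terms vanish and the
    mixed ones must cancel. *)
Lemma associator12 x y z : associator x y z = - associator y x z.
Proof.
have h w : associator w w z = 0.
  by rewrite /associator na_sqr // na_mulKl // !na_mulE (na_mul1x hA) subrr.
have := h (x + y); rewrite /associator !na_mulE !opprD !addrA => e.
apply/eqP; rewrite -subr_eq0 opprK; apply/eqP.
have := h x; have := h y; rewrite /associator => h1 h2.
rewrite -e -[LHS]addr0 -[LHS]addr0 -{1}h1 -{1}h2.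
apply: polar_inj => // t; rewrite !polarE; ring.
Qed.

Lemma associator23 x y z : associator x y z = - associator x z y.
Proof.
have h w : associator x w w = 0.
  by rewrite /associator na_sqr // na_mulKr // !na_mulE (na_mulx1 hA) subrr.
have := h (z + y); rewrite /associator !na_mulE !opprD !addrA => e.
apply/eqP; rewrite -subr_eq0 opprK; apply/eqP.
have := h y; have := h z; rewrite /associator => h1 h2.
rewrite -e -[LHS]addr0 -[LHS]addr0 -{1}h1 -{1}h2.
apply: polar_inj => // t; rewrite !polarE; ring.
Qed.

Lemma associator1 y z : associator one y z = 0.
Proof. by rewrite /associator !(na_mul1x hA) subrr. Qed.

Lemma associator_xxz x z : associator x x z = 0.
Proof.
by rewrite /associator na_sqr // na_mulKl // !na_mulE (na_mul1x hA) subrr.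
Qed.

(** Up to order this is the only triple of distinct vectors among [w], [v], [w ** v]. With [w] in
    front, both products collapse under the alternative laws. *)
Lemma associator_wv w v : associator (w ** v) w v = 0.
Proof.
rewrite associator12 /associator na_mulKl // na_mulKr // !na_mulE.
rewrite na_mulKr // na_mulKl // !na_sqr //.
apply: polar_inj => // t; rewrite !polarE; ring.
Qed.

(** The associator is trilinear, alternating and zero when an argument is [one]; on an algebra
    spanned by these four vectors it is therefore determined by its value at [w], [v], [w ** v]. *)
Lemma associator_eq0 w v :
  (forall x, exists a0 a1 a2 a3,
     x = a0 *: one + a1 *: w + a2 *: v + a3 *: (w ** v)) ->
  forall x y z, (x ** y) ** z = x ** (y ** z).
Proof.
move=> hx.
(* [ind] expands the first argument; [swap12] and [swap23] bring the other arguments there in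
   turn. *)
have ind y z : associator w y z = 0 -> associator v y z = 0 ->
    associator (w ** v) y z = 0 -> forall x, associator x y z = 0.
  move=> h1 h2 h3 x; have [a0 [a1 [a2 [a3 ->]]]] := hx x.
  by rewrite !(associatorDl, associatorZl) h1 h2 h3 associator1 !scaler0 !addr0.
have swap12 x y z : associator y x z = 0 -> associator x y z = 0.
  by move=> h; rewrite associator12 h oppr0.
have swap23 x y z : associator x z y = 0 -> associator x y z = 0.
  by move=> h; rewrite associator23 h oppr0.
have xx x z : associator x z x = 0 by apply/swap23/associator_xxz.
have wv := associator_wv w v.
have h1 : forall x, associator x w v = 0.
  by apply: ind => //; rewrite ?associator_xxz // xx.
have h2 : forall x, associator x w (w ** v) = 0.
  apply: ind => //; rewrite ?associator_xxz ?xx //.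
  exact/swap23/swap12/swap23/wv.
have h3 : forall x, associator x v (w ** v) = 0.
  apply: ind => //; rewrite ?associator_xxz ?xx //.
  exact/swap23/swap12/wv.
have gw x y : associator x y w = 0.
  apply: (swap12); apply: (ind); first exact: xx.
    exact/swap12/swap23/h1.
  exact/swap12/swap23/h2.
have gv x y : associator x y v = 0.
  apply: (swap12); apply: (ind); last exact/swap12/swap23/h3.
    exact/swap12/h1.
  exact: xx.
have gp x y : associator x y (w ** v) = 0.
  by apply: (swap12); apply: (ind); [exact/swap12/h2|exact/swap12/h3|exact: xx].
move=> x y z; apply/eqP; rewrite -subr_eq0; apply/eqP/swap23/swap12.
by apply: (ind); apply/swap12/swap23.
Qed.

End Associativity.

Section SmallHurwitz.
Variables (F : fieldType) (A : quadAlg F) (hA : hurwitz A).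
Hypothesis char2 : 2%N \in [pchar F].
Hypothesis dimA : \dim {:A} != 0%N.
Local Notation q := (qa_norm A).
Local Notation b := (@qa_polar F A).
Local Notation one := (qa_one A).
Implicit Types (x y z w : A) (a c : F).

Lemma one_neq0 : one != 0.
Proof.
apply/eqP => h; have := norm1 hA dimA; rewrite h norm0 => /esym/eqP.
by rewrite oner_eq0.
Qed.

Lemma trace1_ex : exists w, b w one = 1.
Proof.
have [w hw] := polar_neq0 hA one_neq0; exists ((b one w)^-1 *: w).
by rewrite polarE [b w _]polarC mulVf.
Qed.

Lemma polar11 : b one one = 0.
Proof. exact: (polar_alt char2). Qed.

Lemma free_1w w : b w one != 0 -> free [:: one; w].
Proof.
move=> hw; apply: (@free_cons_polar _ _ _ w) => [y||].
- by rewrite inE => /eqP ->; exact: (polar_alt char2).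
- by rewrite polarC.
- by rewrite seq1_free; apply: contraNneq hw => ->; rewrite polar0l.
Qed.

Lemma span_size4P (x1 x2 x3 x4 x : A) :
  x \in <<[:: x1; x2; x3; x4]>>%VS -> exists a1 a2 a3 a4,
    x = a1 *: x1 + a2 *: x2 + a3 *: x3 + a4 *: x4.
Proof.
rewrite !span_cons span_nil addv0.
move=> /memv_addP[_ /vlineP[a1 ->] [_ /memv_addP[_ /vlineP[a2 ->]
  [_ /memv_addP[_ /vlineP[a3 ->] [_ /vlineP[a4 ->] ->]] ->]] ->]].
by exists a1, a2, a3, a4; rewrite !addrA.
Qed.

Lemma nonisotropic_orth w : b w one = 1 -> (2 < \dim {:A})%N ->
  exists v, [/\ b v one = 0, b v w = 0 & q v != 0].
Proof.
(* [p] projects orthogonally along the plane spanned by [one] and [w]; this plane is nondegenerate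
   because [b one w = 1] while [b one one = b w w = 0]. *)
move=> hw hd; pose p x := x - b x w *: one - b x one *: w.
have h1w : b one w = 1 by rewrite polarC.
have p1 x : b (p x) one = 0 by rewrite /p !polarE polar11 hw; ring.
have pw x : b (p x) w = 0 by rewrite /p !polarE (polar_alt char2 w) h1w; ring.
have bp x y : b x one = 0 -> b x w = 0 -> b x (p y) = b x y.
  by move=> h1 h2; rewrite /p !polarE h1 h2; ring.
have : ~~ (fullv <= <<[:: one; w]>>)%VS.
  apply: contraL hd => /dimvS h; rewrite -leqNgt; apply: leq_trans h _.
  exact: dim_span.
move=> /subvPn[x _ xK].
have px : p x != 0.
  apply: contra xK => /eqP; rewrite /p => /eqP; rewrite !subr_eq add0r => /eqP ->.
  by rewrite memvD // memvZ // memv_span // !inE eqxx ?orbT.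
have [y hy] := polar_neq0 hA px; rewrite -bp // in hy.
have [q1|q1] := eqVneq (q (p x)) 0; last by exists (p x).
have [q2|q2] := eqVneq (q (p y)) 0; last by exists (p y).
exists (p x + p y); split; last by rewrite normD q1 q2 !add0r.
  by rewrite polarDl !p1 addr0.
by rewrite polarDl !pw addr0.
Qed.

(** The planes of [one], [w] and of [v], [w ** v] are orthogonal, and in each the two vectors pair
    nontrivially, so every vector is split off by its partner. *)
Lemma free_double w v : b w one = 1 -> b v one = 0 -> b v w = 0 -> q v != 0 ->
  free [:: one; w; v; w ** v].
Proof.
move=> hw hv hvw qv; have h1w : b one w = 1 by rewrite polarC.
have alt := polar_alt char2.
have hp1 : b (w ** v) one = 0.
  by rewrite adjoint_l // na_mulx1 // /qa_conj !polarE hv hvw; ring.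
have hpw : b (w ** v) w = 0.
  by rewrite -{2}[w](na_mulx1 hA) polarMl // hv mulr0.
have hvp : b v (w ** v) = q v.
  by rewrite -{1}[v](na_mul1x hA) polarMr // h1w mulr1.
apply: (@free_cons_polar _ _ _ w); rewrite ?h1w ?oner_eq0 //.
  by move=> y; rewrite !inE => /or3P[] /eqP -> //; exact: alt.
apply: (@free_cons_polar _ _ _ one); rewrite ?hw ?oner_eq0 //.
  by move=> y; rewrite !inE => /orP[] /eqP -> //; exact: alt.
apply: (@free_cons_polar _ _ _ (w ** v)); rewrite ?hvp //.
  by move=> y; rewrite !inE => /eqP -> //; exact: alt.
rewrite seq1_free; apply: contraNneq qv => h; by rewrite -hvp h polar0r.
Qed.

Lemma free_span_full (X : seq A) : free X -> size X = \dim {:A} -> <<X>>%VS = fullv.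
Proof.
move=> fX hs; apply/eqP; rewrite eqEdim subvf /= -hs.
by move: fX; rewrite /free => /eqP ->.
Qed.

(** Needed because the norm of a Cayley-Dickson double is multiplicative only over an associative
    algebra. In dimension 2 the vectors [one] and [w] already span, and [v = 0] fills the remaining
    place. *)
Lemma hurwitz_assoc : \dim {:A} = 2%N \/ \dim {:A} = 4%N ->
  forall x y z, (x ** y) ** z = x ** (y ** z).
Proof.
have [w hw] := trace1_ex; case=> hd.
  apply: (associator_eq0 hA (w := w) (v := 0)) => x.
  have /free_span_full h : free [:: one; w] by rewrite free_1w ?hw ?oner_eq0.
  have : x \in <<[:: one; w]>>%VS by rewrite h ?hd ?memvf.
  rewrite !span_cons span_nil addv0 => /memv_addP[_ /vlineP[a1 ->] [_ /vlineP[a2 ->] ->]].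
  by exists a1, a2, 0, 0; rewrite !na_mul0r !scaler0 !addr0.
have [v [hv hvw qv]] : exists v, [/\ b v one = 0, b v w = 0 & q v != 0].
  by apply: nonisotropic_orth; rewrite ?hd.
apply: (associator_eq0 hA (w := w) (v := v)) => x; apply: span_size4P.
by rewrite (free_span_full (free_double _ _ _ _)) ?hd ?memvf.
Qed.

End SmallHurwitz.

(** * Norm and dimension of the Cayley-Dickson double *)

Section CayleyDicksonHurwitz.
Variables (F : fieldType) (Q : quadAlg F) (hQ : hurwitz Q) (alpha : F).
Hypothesis assocQ : forall x y z : Q, (x ** y) ** z = x ** (y ** z).
Hypothesis alpha_neq0 : alpha != 0.
Hypothesis dimQ : \dim {:Q} != 0%N.

Lemma hurwitz_CD : hurwitz (CD Q alpha).
Proof.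
have conj1 : qa_conj (qa_one Q) = qa_one Q.
  by rewrite /qa_conj polarxx norm1 // mulr1 scaler_nat mulr2n addrK.
have conj0 : qa_conj (0 : Q) = 0.
  by rewrite /qa_conj polar0l scale0r subr0.
split.
- move=> [x1 x2]; split; congr (_, _) => /=.
  + by rewrite na_mul1x // na_mul0r scaler0 subr0.
  + by rewrite na_mulx1 // na_mul0l addr0.
  + by rewrite na_mulx1 // conj0 na_mul0l scaler0 subr0.
  + by rewrite na_mul0l add0r conj1 na_mulx1.
- move=> [x1 x2] _ h; congr (_, _); apply: (polar_eq0 hQ) => y.
    have := h (y, 0) (memvf _); rewrite /qa_orthogonal /qa_polar CD_polarE /=.
    by rewrite polar0r mulr0 addr0.
  have := h (0, y) (memvf _); rewrite /qa_orthogonal /qa_polar CD_polarE /=.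
  by rewrite polar0r add0r => /eqP; rewrite mulf_eq0 (negPf alpha_neq0) => /eqP.
- move=> [a b] [c d]; rewrite /= /CD_norm /=.
  rewrite !normD !normN !normZ !normM // !polarE !norm_conj //.
  (* By this equality the two cross terms of the norm cancel. Associativity enters here, regrouping
     [d ** (a ** c)] between two adjunctions. *)
  have -> : qa_polar (a ** c) (qa_conj d ** b) = qa_polar (d ** a) (b ** qa_conj c).
    by rewrite polarC adjoint_l // conj_conj // polarC -assocQ adjoint_r.
  by ring.
Qed.

Lemma CD_split_even x : x \in CD_main Q alpha 0 -> x != 0 ->
  qa_norm (CD Q alpha) x = 0 -> qa_split Q.
Proof.
rewrite mem_CD_even; case: x => x1 x2 /= /eqP -> h.
rewrite /CD_norm /= norm0 mulr0 addr0 => hq; exists x1 => //.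
by apply: contra h => /eqP ->.
Qed.

(** Rank-nullity for the first projection, which maps the even part injectively onto [Q]. *)
Lemma dim_CD_even : \dim (CD_main Q alpha 0) = \dim {:Q}.
Proof.
have h := limg_ker_dim (linfun (fst : CD_vect Q -> Q)) (CD_main Q alpha 0).
rewrite -h (_ : (_ :&: _)%VS = 0%VS) ?dimv0 ?add0n.
  congr (\dim _); apply/eqP; rewrite eqEsubv subvf /=; apply/subvP => x _.
  by apply/memv_imgP; exists (x, 0); rewrite ?mem_CD_even ?lfunE.
apply/eqP; rewrite -subv0; apply/subvP => -[x y]; rewrite memv_cap mem_CD_even.
by rewrite memv_ker lfunE /= memv0 => /andP[/eqP -> /eqP ->].
Qed.

Lemma dim_CD : \dim {:CD Q alpha} = (2 * \dim {:Q})%N.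
Proof. by rewrite !dimvf /dim /= mul2n addnn. Qed.

End CayleyDicksonHurwitz.

(** * Gradings determined by homogeneous subspaces, and their universal groups *)

Section Tables.
Variables (F : fieldType) (A : nonassocAlg F) (G : zmodType).
Variable Gam : G -> {vspace A}.
Hypothesis grad : grading Gam.

Lemma grading_disjoint g h x : x \in Gam g -> x \in Gam h -> x != 0 -> g = h.
Proof.
move=> xg xh /eqP x0; have [//|ne] := eqVneq g h; case: x0.
have [_ indep _] := grad.
(* Independence is applied to [x] in degree [g] and [- x] in degree [h], whose sum is 0. *)
have := indep [:: g; h] (fun k => if k == g then x else if k == h then - x else 0).
rewrite /= inE ne !big_cons big_nil eqxx [h == g]eq_sym (negPf ne) eqxx addr0 subrr.
move=> /(_ isT) i; have := i _ erefl g; rewrite eqxx inE eqxx; apply=> // k.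
case: eqP => [-> //|_]; case: eqP => [->|_]; last exact: mem0v.
by rewrite memvN.
Qed.

(** Subspaces that lie in components and together span the algebra must fill these components. Every
    table of a grading below is obtained from this. *)
Lemma grading_eq_sum (I : finType) (g : I -> G) (W : I -> {vspace A}) :
  (forall i, W i <= Gam (g i))%VS -> (\sum_i W i)%VS = fullv ->
  forall h, Gam h = (\sum_(i | g i == h) W i)%VS.
Proof.
move=> sub full h; apply/eqP; rewrite eqEsubv; apply/andP; split; last first.
  by apply/subv_sumP => i /eqP <-.
apply/subvP => x xh; have /memv_sumP[c hc xE] : x \in (\sum_i W i)%VS.
  by rewrite full memvf.
have [_ indep _] := grad.
(* Degree [k] part of the decomposition of [x] along the [W i], minus [x] itself when [k = h]. These
   differences sum to 0, so each vanishes. *)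
pose d k := (\sum_(i | g i == k) c i) - (if k == h then x else 0).
have dk k : d k \in Gam k.
  apply: memvB; last by case: eqP => [->|_] //; exact: mem0v.
  by apply: memv_suml => i /eqP <-; apply: (subvP (sub i)); exact: hc.
(* [h] is added because no [g i] need be equal to it. *)
pose s := undup (h :: [seq g i | i : I]).
have hs : h \in s by rewrite mem_undup inE eqxx.
have d0 : \sum_(k <- s) d k = 0.
  rewrite /d big_split /= sumrN -big_mkcond /= [X in _ - X](_ : _ = x); last first.
    by rewrite big_mkcond (bigD1_seq h) ?undup_uniq //= eqxx big1 ?addr0 // => k /negPf ->.
  apply/eqP; rewrite subr_eq0 xE; apply/eqP.
  rewrite (exchange_big_dep xpredT) //=; apply: eq_bigr => i _.
  rewrite (big_rem (g i)) /= ?eqxx; last first.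
    by rewrite mem_undup inE map_f ?orbT // mem_enum.
  rewrite big_seq_cond big1 ?addr0 // => k.
  by rewrite mem_rem_uniq ?undup_uniq // inE => /andP[/andP[/negPf]]; rewrite eq_sym => ->.
have := indep s d (undup_uniq _) dk d0 h hs.
rewrite /d eqxx => /eqP; rewrite subr_eq0 => /eqP <-.
by apply: memv_sumr => i hi; exact: hc.
Qed.

Variables (H : zmodType).

Lemma tableE (t : seq (H * {vspace A})) h : table t h =
  (\sum_(i < size t | (tnth (in_tuple t) i).1 == h) (tnth (in_tuple t) i).2)%VS.
Proof. by rewrite /table big_tnth. Qed.

Lemma grading_table (t : seq (H * {vspace A})) (psi : H -> G) :
  (forall p, p \in t -> (p.2 <= Gam (psi p.1))%VS) ->
  (\sum_(p <- t) p.2)%VS = fullv ->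
  forall g h, (forall p, p \in t -> (psi p.1 == g) = (p.1 == h)) ->
  Gam g = table t h.
Proof.
move=> sub; rewrite big_tnth => full g h hgh.
rewrite (grading_eq_sum (g := fun i => psi (tnth (in_tuple t) i).1) _ full); last first.
  by move=> i; apply/sub/mem_tnth.
by rewrite tableE; apply: eq_bigl => i; apply/hgh/mem_tnth.
Qed.

Variable psi : {additive H -> G}.

Definition additive_iso : Prop :=
  exists phi : {additive G -> H}, cancel phi psi /\ cancel psi phi.

Lemma graded_as_iso (t : seq (H * {vspace A})) : additive_iso ->
  (forall p, p \in t -> (p.2 <= Gam (psi p.1))%VS) ->
  (\sum_(p <- t) p.2)%VS = fullv -> graded_as Gam (table t).
Proof.
move=> [phi [phiK psiK]] sub full; exists phi; split; first by exists psi.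
move=> g; apply: (grading_table sub full) => p pt.
by apply/eqP/eqP => [<-|->].
Qed.

Lemma sum_spans (K : Type) (t : seq (K * seq A)) (B : seq A) :
  basis_of fullv B -> {subset B <= flatten [seq p.2 | p <- t]} ->
  (\sum_(p <- [seq (p.1, <<p.2>>%VS) | p <- t]) p.2)%VS = fullv.
Proof.
move=> bB sB; rewrite big_map /=.
rewrite (_ : (\sum_(p <- t) _)%VS = <<flatten [seq p.2 | p <- t]>>%VS).
  apply/eqP; rewrite eqEsubv subvf /= -(span_basis bB); exact: sub_span.
by elim: t {sB} => [|p t ih]; rewrite ?big_nil ?span_nil // big_cons ih /= span_cat.
Qed.

Lemma graded_as_spans (t : seq (H * seq A)) (B : seq A) : additive_iso ->
  (forall p x, p \in t -> x \in p.2 -> x \in Gam (psi p.1)) ->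
  basis_of fullv B -> {subset B <= flatten [seq p.2 | p <- t]} ->
  graded_as Gam (table [seq (p.1, <<p.2>>%VS) | p <- t]).
Proof.
move=> iso sub bB sB; apply: graded_as_iso => //; last exact: sum_spans bB sB.
by move=> _ /mapP[p pt ->] /=; apply/span_subvP => x; exact: sub.
Qed.

Hypothesis univ : universal_group Gam.
Variable t : seq (H * {vspace A}).
Hypothesis sub : forall p, p \in t -> (p.2 <= Gam (psi p.1))%VS.
Hypothesis full : (\sum_(p <- t) p.2)%VS = fullv.
Hypothesis nz : forall p, p \in t -> p.2 != 0%VS.
Hypothesis gen : forall f : {additive H -> H},
  (forall p, p \in t -> f p.1 = p.1) -> f =1 id.

Lemma support_table g : in_support Gam g -> exists2 p, p \in t & psi p.1 = g.
Proof.
have [/hasP[p pt /eqP <-] _|/hasPn hn []] := boolP (has (fun p => psi p.1 == g) t).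
  by exists p.
move: full; rewrite big_tnth => full'.
rewrite (grading_eq_sum (g := fun i => psi (tnth (in_tuple t) i).1) _ full'); last first.
  by move=> i; apply/sub/mem_tnth.
rewrite big_pred0 // => i.
by apply: negbTE; apply: (hn _ (mem_tnth i (in_tuple t))).
Qed.

Hypothesis inj : forall p p', p \in t -> p' \in t ->
  psi p.1 = psi p'.1 -> p.1 = p'.1.
Hypothesis mul : forall p p' x y, p \in t -> p' \in t ->
  x \in p.2 -> y \in p'.2 -> x ** y != 0 -> exists2 p'', p'' \in t & p''.1 = p.1 + p'.1.

(** By [mul] and [inj] the labelling of the support by [t] respects the support relations, so
    universality extends it to [phi]. That [phi] inverts [psi] follows from [gen] on one side, and
    on the other from the uniqueness clause for the identity of [G]. *)
Lemma universal_iso : additive_iso.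
Proof.
have injE p p' : p \in t -> p' \in t -> (psi p.1 == psi p'.1) = (p.1 == p'.1).
  by move=> pt pt'; apply/eqP/eqP => [|-> //]; exact: inj.
have gamE p : p \in t -> Gam (psi p.1) = table t p.1.
  by move=> pt; apply: (grading_table (psi := psi)) => // p' pt'; exact: injE.
(* The label in [t] of a degree of the support; the default 0 is taken only off the support. *)
pose f g := head 0 [seq p.1 | p <- t & psi p.1 == g].
have fE p : p \in t -> f (psi p.1) = p.1.
  move=> pt; rewrite /f; case e: [seq p0 <- t | _] => [|p' s] /=.
    have : p \in [seq p0 <- t | psi p0.1 == psi p.1] by rewrite mem_filter eqxx.
    by rewrite e.
  have : p' \in [seq p0 <- t | psi p0.1 == psi p.1] by rewrite e inE eqxx.
  by rewrite mem_filter => /andP[/eqP h p't]; exact: inj.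
have [|phi [phiE _]] := univ (f := f).
  move=> g1 g2 g3 [/support_table[p1 t1 <-] /support_table[p2 t2 <-]
    /support_table[p3 t3 <-] [x [y [x1 y2 xy0]]] x3].
  rewrite !fE //.
  have xy3 := x3 _ _ x1 y2; have [_ _ gm] := grad.
  have : exists2 p'', p'' \in t & p''.1 = p1.1 + p2.1.
    move: x1 y2 xy0; rewrite !gamE // !tableE.
    move=> /memv_sumP[c hc ->] /memv_sumP[d hd ->].
    (* Without an entry of degree [p1.1 + p2.1], every product of a summand of [x] with one of [y]
       would vanish by [mul], against [x ** y != 0]. *)
    have [/hasP[p'' pt /eqP <-] _|/hasPn h] := boolP (has (fun p => p.1 == p1.1 + p2.1) t).
      by exists p''.
    case/eqP.
    rewrite (big_morph (fun x => x ** _) (fun x y => na_mulDl x y _) (@na_mul0l _ _ _)).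
    rewrite big1 // => i hi; rewrite (big_morph _ (na_mulDr _) (na_mul0r _)).
    rewrite big1 // => j hj; apply/eqP; apply/negPn/negP => hij.
    have := mul (mem_tnth i (in_tuple t)) (mem_tnth j (in_tuple t)) (hc i hi) (hd j hj) hij.
    case=> p'' pt; rewrite (eqP hi) (eqP hj) => e.
    by have /= := h _ pt; rewrite e eqxx.
  move=> [p'' t'' e]; rewrite -e; apply: inj => //; rewrite e raddfD.
  exact: (grading_disjoint (gm _ _ _ _ x1 y2) xy3 xy0).
have suppE p : p \in t -> in_support Gam (psi p.1).
  move=> pt h; case/negP: (nz pt); rewrite -subv0 -h; exact: sub.
have phiK h : phi (psi h) = h.
  apply: (gen (f := phi \o psi : {additive H -> H})) => p pt /=.
  by rewrite phiE ?fE //; exact: suppE.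
(* [psi \o phi] and the identity of [G] agree on the support, hence everywhere by uniqueness. *)
have psiK g : psi (phi g) = g.
  have [|th [thE thU]] := univ (f := idfun).
    move=> g1 g2 g3 [_ _ _ [x [y [x1 y2 xy0]]] x3].
    have [_ _ gm] := grad.
    exact: (grading_disjoint (gm _ _ _ _ x1 y2) (x3 _ _ x1 y2) xy0).
  have h1 : (psi \o phi : {additive G -> G}) =1 th.
    by apply: thU => k /support_table[p pt <-] /=; rewrite phiK.
  have h2 : (idfun : {additive G -> G}) =1 th by apply: thU.
  by rewrite -[RHS]/(idfun g) (h2 g) -(h1 g).
by exists phi.
Qed.

End Tables.

(** For injective [psi] the closure condition [mul] is automatic: the degree of a nonzero product is
    in the support, hence labelled by [t], and injectivity carries the sum back to [H]. *)
Lemma universal_iso_inj (F : fieldType) (A : nonassocAlg F) (G H : zmodType)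
    (Gam : G -> {vspace A}) (t : seq (H * {vspace A})) (psi : {additive H -> G}) :
  grading Gam -> universal_group Gam ->
  (forall p, p \in t -> (p.2 <= Gam (psi p.1))%VS) ->
  (\sum_(p <- t) p.2)%VS = fullv ->
  (forall p, p \in t -> p.2 != 0%VS) ->
  (forall f : {additive H -> H}, (forall p, p \in t -> f p.1 = p.1) -> f =1 id) ->
  injective psi -> additive_iso psi.
Proof.
move=> grad univ sub full nz gen inj.
apply: (universal_iso grad univ sub full nz gen) => [p p' _ _ /inj //|].
move=> p p' x y pt pt' xp yp' xy0.
have [_ _ gm] := grad.
have xyg := gm _ _ _ _ (subvP (sub _ pt) _ xp) (subvP (sub _ pt') _ yp').
have [h0|p'' pt'' e] := support_table grad sub full (g := psi p.1 + psi p'.1).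
  by case/eqP: xy0; apply/eqP; rewrite -memv0 -h0.
by exists p'' => //; apply: inj; rewrite e raddfD.
Qed.

Lemma graded_as_ext (F : fieldType) (A : nonassocAlg F) (G H : zmodType)
    (Gam : G -> {vspace A}) (D D' : H -> {vspace A}) :
  D =1 D' -> graded_as Gam D -> graded_as Gam D'.
Proof. by move=> e [phi [bphi h]]; exists phi; split=> // g; rewrite h e. Qed.

(** [F^o] is [F] as a vector space over itself; this makes the orthogonal complement below a kernel,
    hence a subspace. *)
Definition polar_with (F : fieldType) (A : quadAlg F) (x y : A) : F^o :=
  qa_polar x y.

HB.instance Definition _ (F : fieldType) (A : quadAlg F) (x : A) :=
  GRing.isLinear.Build F A F^o *:%R (polar_with x)
    (fun a y z => qa_polarPr a x y z).

Definition orthv (F : fieldType) (A : quadAlg F) (x : A) : {vspace A} :=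
  lker (linfun (polar_with x)).

Lemma mem_orthv (F : fieldType) (A : quadAlg F) (x y : A) :
  (y \in orthv x) = (qa_polar x y == 0).
Proof. by rewrite memv_ker lfunE. Qed.

(** * Degrees, traces and norms in a graded Hurwitz algebra *)

Section GradedHurwitz.
Variables (F : fieldType) (A : quadAlg F) (hA : hurwitz A).
Hypothesis dimA : \dim {:A} != 0%N.
Local Notation q := (qa_norm A).
Local Notation b := (@qa_polar F A).
Local Notation one := (qa_one A).

(* The properties of gradings of Hurwitz algebras that are needed below; unlike
   [grading], they pass immediately to common refinements. *)
Definition hurwitz_graded (H : zmodType) (L : H -> {vspace A}) : Prop :=
  [/\ one \in L 0,
      forall (W : {vspace A}) x, x \notin W -> exists h y, y \in L h /\ y \notin W,
      forall g h x y, x \in L g -> y \in L h -> x ** y \in L (g + h),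
      forall g h x y, x \in L g -> y \in L h -> b x y != 0 -> g + h = 0
    & forall g x, x \in L g -> q x != 0 -> g + g = 0].

Section OfGrading.
Variables (G : zmodType) (Gam : G -> {vspace A}).
Hypothesis grad : grading Gam.

Lemma grading_uniq_sum x : exists (s : seq G) (c : G -> A),
  [/\ uniq s, forall g, c g \in Gam g & x = \sum_(g <- s) c g].
Proof.
have [dec _ _] := grad; have [s [c [hc ->]]] := dec x.
exists (undup s), (fun g => \sum_(k <- s | k == g) c k).
split=> [|g|]; first exact: undup_uniq.
  by apply: memv_suml => k /eqP <-.
rewrite (exchange_big_dep xpredT) //= big_seq [RHS]big_seq.
apply: eq_bigr => k ks.
rewrite big_mkcond (bigD1_seq k) ?undup_uniq ?mem_undup //= eqxx big1 ?addr0 //.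
by move=> g; rewrite eq_sym => /negPf ->.
Qed.

Lemma grading_hom_ex (W : {vspace A}) x :
  x \notin W -> exists h y, y \in Gam h /\ y \notin W.
Proof.
have [s [c [us hc ->]]] := grading_uniq_sum x => h.
have [/allP hs|] := boolP (all (fun g => c g \in W) s).
  by case/negP: h; rewrite big_seq; apply: memv_suml => g /hs.
by rewrite -has_predC => /hasP[g _ /= hg]; exists g, (c g).
Qed.

(** Comparing degrees in [one ** x = x] for homogeneous [x] shows that the degree 0 part of [one] is
    a left unit on homogeneous elements, hence equal to [one]. *)
Lemma grading_one : one \in Gam 0.
Proof.
have [_ indep gm] := grad.
have [s [c [us hc hs]]] := grading_uniq_sum one.
(* [c] may be nonzero off [s], so [d] truncates it; [s'] ensures that degree 0 is listed. *)
pose s' := undup (0 :: s); pose d k := if k \in s then c k else 0.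
have hd k : d k \in Gam k by rewrite /d; case: ifP => // _; exact: mem0v.
have e_id h x : x \in Gam h -> d 0 ** x = x.
  (* Degree [k] part of [one ** x - x]. *)
  move=> xh; pose f k := d (k - h) ** x - (if k == h then x else 0).
  have fk k : f k \in Gam k.
    apply: memvB; last by case: eqP => [->//|_]; exact: mem0v.
    by have := gm _ _ _ _ (hd (k - h)) xh; rewrite subrK.
  have : \sum_(k <- [seq k + h | k <- s']) f k = 0.
    rewrite big_map big_split /= sumrN; apply/eqP; rewrite subr_eq0; apply/eqP.
    rewrite [RHS](bigD1_seq 0) ?undup_uniq ?mem_undup ?inE ?eqxx //= add0r eqxx.
    rewrite [X in _ = _ + X]big1 ?addr0; last first.
      by move=> k /negPf k0; rewrite -{2}[h]add0r (inj_eq (addIr h)) k0.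
    under eq_bigr do rewrite addrK.
    rewrite -(big_morph (fun z => z ** x) (fun y z => na_mulDl y z x) (@na_mul0l _ _ x)).
    rewrite -[RHS](na_mul1x hA) hs; congr (_ ** _).
    rewrite [LHS](bigID (mem s)) /= [X in _ + X]big1 ?addr0; last first.
      by move=> k /negPf ks; rewrite /d ks.
    rewrite -big_filter [RHS](perm_big [seq k <- s' | k \in s]) /=.
      by rewrite !big_filter; apply: eq_bigr => k ks; rewrite /d ks.
    apply: uniq_perm => //; first by rewrite filter_uniq ?undup_uniq.
    by move=> k; rewrite mem_filter mem_undup inE; case: (k \in s); rewrite ?orbT.
  move/(indep _ f _ fk)=> hf.
  have := hf _ h; rewrite /f subrr eqxx => hh; apply/eqP; rewrite -subr_eq0.
  apply/eqP/hh; first by rewrite map_inj_uniq ?undup_uniq //; exact: addIr.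
  by apply/mapP; exists 0; rewrite ?add0r // mem_undup inE eqxx.
suff -> : one = d 0 by exact: hd.
rewrite -[RHS](na_mulx1 hA) {2}hs.
rewrite (big_morph _ (na_mulDr _) (na_mul0r _)) [in LHS]hs.
by apply: eq_bigr => k _; rewrite (e_id k).
Qed.

(** The degrees of [y] and [z] may coincide; [y + z] is then homogeneous and [grading_disjoint]
    takes the place of independence. *)
Lemma grading_sum0 a1 a2 a3 (x y z : A) : x \in Gam a1 -> y \in Gam a2 ->
  z \in Gam a3 -> x = y + z -> a1 != a2 -> a1 != a3 -> x = 0.
Proof.
move=> x1 y2 z3 e n12 n13; have [_ indep _] := grad.
have [//|/eqP x0] := eqVneq x 0.
have [e23|n23] := eqVneq a2 a3.
  rewrite e23 in y2 n12; case/eqP: n12; apply: (grading_disjoint grad x1); last exact/eqP.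
  by rewrite e memvD.
have := indep [:: a1; a2; a3] (fun k => if k == a1 then - x else
  if k == a2 then y else if k == a3 then z else 0).
rewrite /= !inE !negb_or n12 n13 n23 !big_cons big_nil !eqxx.
rewrite ![_ == a1]eq_sym (negPf n12) (negPf n13) eq_sym (negPf n23) addr0 -e addNr.
move=> /(_ isT) i; have := i _ erefl a1; rewrite eqxx inE eqxx => {}i.
rewrite -[x]opprK i ?oppr0 // => k.
case: (k =P a1) => [->|_]; first by rewrite memvN.
case: (k =P a2) => [->//|_]; case: (k =P a3) => [->//|_].
exact: mem0v.
Qed.

(** In [x ** x = b x one *: x - q x *: one] the terms have degrees [g + g], [g] and 0, and [g]
    differs from the other two. *)
Lemma grading_trace g x : x \in Gam g -> g != 0 -> b x one = 0.
Proof.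
move=> xg g0; have [_ _ gm] := grad.
have [->|x0] := eqVneq x 0; first exact: polar0l.
have : b x one *: x = 0.
  apply: (@grading_sum0 g (g + g) 0 _ (x ** x) (q x *: one)) => //.
  - exact: memvZ.
  - exact: gm.
  - by apply/memvZ/grading_one.
  - by rewrite na_sqr // subrK.
  - by rewrite -{1}[g]addr0 (inj_eq (addrI g)) eq_sym.
by move/eqP; rewrite scaler_eq0 (negPf x0) orbF => /eqP.
Qed.

(** The same quadratic equation, read in degree 0: if [g + g] were nonzero, so would be [g], and
    [q x *: one] would stand alone. *)
Lemma grading_norm g x : x \in Gam g -> q x != 0 -> g + g = 0.
Proof.
move=> xg qx; have [_ _ gm] := grad; apply/eqP.
apply: contraNT qx => g2; suff /eqP : q x *: one = 0.
  by rewrite scaler_eq0 (negPf (one_neq0 hA dimA)) orbF.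
apply: (@grading_sum0 0 g (g + g) _ (b x one *: x) (- (x ** x))).
- by apply/memvZ/grading_one.
- exact: memvZ.
- by rewrite memvN gm.
- by rewrite na_sqr // opprB addrC subrK.
- by apply: contraNneq g2 => <-; rewrite addr0.
- by rewrite eq_sym.
Qed.

(** [b x y] is the trace of [qa_conj x ** y], which has degree [g + h]. *)
Lemma grading_polar g h x y :
  x \in Gam g -> y \in Gam h -> b x y != 0 -> g + h = 0.
Proof.
move=> xg yh; have [_ _ gm] := grad; apply: contraNeq => gh.
rewrite -[x](na_mulx1 hA) adjoint_l // polarC (grading_trace _ gh) //.
apply: gm => //; rewrite /qa_conj memvB //.
have [->|g0] := eqVneq g 0; first by apply/memvZ/grading_one.
by rewrite (grading_trace xg) // scale0r mem0v.
Qed.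

Lemma grading_hurwitz_graded : hurwitz_graded Gam.
Proof.
split; [exact: grading_one|exact: grading_hom_ex|by case: grad
  |exact: grading_polar|exact: grading_norm].
Qed.

End OfGrading.

Definition refine (G K : zmodType) (Gam : G -> {vspace A}) (P : K -> {vspace A})
  (h : (G * K)%type) : {vspace A} := (Gam h.1 :&: P h.2)%VS.

(** Compatibility with parity serves the second clause: the even and odd parts of a homogeneous
    vector outside [W] cannot both lie in [W]. *)
Lemma hurwitz_graded_refine (G : zmodType) (Gam : G -> {vspace A})
    (P : 'Z_2 -> {vspace A}) :
  hurwitz_graded Gam -> hurwitz_graded P -> super_grading P Gam ->
  hurwitz_graded (refine Gam P).
Proof.
move=> [o1 h1 m1 p1 n1] [o2 h2 m2 p2 n2] [_ sg]; split.
- by rewrite memv_cap o1.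
- move=> W x /h1[g [y [yg yW]]]; move: yg; rewrite sg => /memv_addP[y0 hy0 [y1 hy1 e]].
  have [y0W|] := boolP (y0 \in W); last by exists (g, 0), y0.
  have [y1W|] := boolP (y1 \in W); last by exists (g, 1), y1.
  by case/negP: yW; rewrite e memvD.
- move=> g h x y; rewrite !memv_cap => /andP[xg xg'] /andP[yh yh'].
  by rewrite m1 // m2.
- move=> [g i] [h j] x y; rewrite !memv_cap => /andP[/= xg xg'] /andP[yh yh'] hb.
  by congr (_, _); [exact: (p1 _ _ x y)|exact: (p2 _ _ x y)].
- move=> [g i] x; rewrite !memv_cap => /andP[/= xg xg'] hb.
  by congr (_, _); [exact: (n1 _ x)|exact: (n2 _ x)].
Qed.

Section Pairing.
Variables (H : zmodType) (L : H -> {vspace A}) (hL : hurwitz_graded L).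

Lemma graded_conj g x : x \in L g -> qa_conj x \in L g.
Proof.
have [o _ _ p _] := hL => xg; rewrite /qa_conj memvB //.
have [->|/(p _ _ _ _ xg o)] := eqVneq (b x one) 0; first by rewrite scale0r mem0v.
by rewrite addr0 => ->; apply: memvZ.
Qed.

(** Nondegeneracy provides a homogeneous vector not orthogonal to [x], and its degree can only be
    [- g]. *)
Lemma graded_pairing g x : x \in L g -> x != 0 -> exists2 y, y \in L (- g) & b x y = 1.
Proof.
have [_ hom _ p _] := hL => xg /(polar_neq0 hA)[z hz].
have [h [y [yh]]] : exists h y, y \in L h /\ y \notin orthv x.
  by apply: (hom _ z); rewrite mem_orthv.
rewrite mem_orthv => hy; have /eqP := p _ _ _ _ xg yh hy.
rewrite addrC addr_eq0 => /eqP <-.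
by exists ((b x y)^-1 *: y); rewrite ?memvZ // polarE mulVf.
Qed.

End Pairing.

End GradedHurwitz.

(** * Peirce decomposition and canonical bases *)

Section Peirce.
Variables (F : fieldType) (A : quadAlg F) (hA : hurwitz A).
Hypothesis dimA : \dim {:A} != 0%N.
Local Notation q := (qa_norm A).
Local Notation b := (@qa_polar F A).
Local Notation one := (qa_one A).
Implicit Types (x y z w e v : A) (a c : F).

(** By [na_sqr], norm 0 and trace 1 give [e ** e = e], with [e] different from 0 and [one]. *)
Definition rank1_idempotent e := q e = 0 /\ b e one = 1.

(** The Peirce space of [e]: it will contain the [u i] of a canonical basis, and that of [one - e]
    the [v i]. *)
Definition in_peirce e x := e ** x = x /\ x ** (one - e) = x.

(** Left multiplication by [e] keeps the [e] and Peirce components of [x] and kills the others;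
    [b x (one - e)] is the coordinate of [x] along [e]. *)
Definition peirce_proj e x := e ** x - b x (one - e) *: e.

Lemma peirce_projP e a x y :
  peirce_proj e (a *: x + y) = a *: peirce_proj e x + peirce_proj e y.
Proof.
rewrite /peirce_proj na_mulDr na_mulZr polarDl polarZl.
by rewrite scalerDl scalerBr opprD addrACA scalerA.
Qed.

HB.instance Definition _ e :=
  GRing.isLinear.Build F A A *:%R (peirce_proj e) (peirce_projP e).

Lemma idempotent_compl e : rank1_idempotent e -> rank1_idempotent (one - e).
Proof.
move=> [qe te]; split.
  by rewrite normD normN qe norm1 // polarNr polarC te addr0 subrr.
by rewrite polarDl polarNl te polarxx norm1 // mulr1 mulr2n addrK.
Qed.

Lemma complK e : one - (one - e) = e.
Proof. by rewrite opprB addrC subrK. Qed.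

Section Idempotent.
Variables (e : A) (he : rank1_idempotent e).
Local Notation e' := (one - e).

Lemma idem_norm : q e = 0. Proof. by case: he. Qed.
Lemma idem_trace : b e one = 1. Proof. by case: he. Qed.

Lemma idem_sqr : e ** e = e.
Proof. by rewrite na_sqr // idem_norm idem_trace scale0r scale1r subr0. Qed.

Lemma idem_mul_compl : e ** e' = 0.
Proof. by rewrite na_mulDr na_mulx1 // na_mulNr idem_sqr subrr. Qed.

Lemma compl_mul_idem : e' ** e = 0.
Proof. by rewrite na_mulDl na_mul1x // na_mulNl idem_sqr subrr. Qed.

Lemma idem_polar : b e e = 0.
Proof. by rewrite polarxx idem_norm mulr0. Qed.

Lemma idem_polar_compl : b e e' = 1.
Proof. by rewrite polarDr polarNr idem_trace idem_polar subr0. Qed.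

Lemma idem_conj : qa_conj e = e'.
Proof. by rewrite /qa_conj idem_trace scale1r. Qed.

Lemma peirce_compl_mul x : in_peirce e x -> e' ** x = 0.
Proof. by move=> [h _]; rewrite na_mulDl na_mulNl na_mul1x // h subrr. Qed.

Lemma peirce_mul_idem x : in_peirce e x -> x ** e = 0.
Proof.
by move=> [_]; rewrite na_mulDr na_mulNr na_mulx1 // => /(canRL (addKr _));
  rewrite addNr => /eqP; rewrite oppr_eq0 => /eqP.
Qed.

Lemma peirce_polar_compl x : in_peirce e x -> b x e' = 0.
Proof.
move=> [h1 h2]; rewrite -h2 -{2}[e'](na_mul1x hA) polarMr //.
by rewrite (idempotent_compl he).1 mul0r.
Qed.

Lemma peirce_trace x : in_peirce e x -> b x one = 0.
Proof.
move=> hx; rewrite -hx.1 adjoint_l // na_mulx1 // idem_conj.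
exact: peirce_polar_compl.
Qed.

Lemma peirce_polar_idem x : in_peirce e x -> b x e = 0.
Proof.
move=> hx; have := peirce_polar_compl hx.
by rewrite polarDr polarNr peirce_trace // add0r => /eqP; rewrite oppr_eq0 => /eqP.
Qed.

Lemma peirce_norm x : in_peirce e x -> q x = 0.
Proof. by move=> [<- _]; rewrite normM // idem_norm mul0r. Qed.

Lemma peirce_isotropic x y : in_peirce e x -> in_peirce e y -> b x y = 0.
Proof. by move=> [<- _] [<- _]; rewrite polarMl // idem_norm mul0r. Qed.

Lemma peirce_sqr x : in_peirce e x -> x ** x = 0.
Proof.
by move=> hx; rewrite na_sqr // peirce_trace // peirce_norm // !scale0r subrr.
Qed.

Lemma peirce_skew x y : in_peirce e x -> in_peirce e y -> x ** y = - (y ** x).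
Proof.
move=> hx hy; rewrite na_anticomm // !peirce_trace // peirce_isotropic //.
by rewrite !scale0r addr0 subrr sub0r.
Qed.

(** The linearised alternative law gives [e ** (x ** y) = x ** y - x ** (e ** y) = 0], and
    symmetrically on the right. *)
Lemma peirce_mulUU x y : in_peirce e x -> in_peirce e y -> in_peirce e' (x ** y).
Proof.
move=> hx hy; have [e1 e2] := (idem_trace, (idempotent_compl he).2); split.
  suff h : e ** (x ** y) = 0 by rewrite na_mulDl na_mulNl h na_mul1x // subr0.
  rewrite na_mulKl_lin // e1 peirce_trace // scale1r scale0r addr0.
  by rewrite polarC peirce_polar_idem // scale0r subr0 hy.1 subrr.
suff h : (x ** y) ** e' = 0 by rewrite na_mulDr na_mulNr h na_mulx1 // subr0.
rewrite na_mulKr_lin // e2 peirce_trace // scale1r scale0r addr0.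
by rewrite polarC peirce_polar_compl // scale0r subr0 hx.2 subrr.
Qed.

Lemma peirce_proj_in z : in_peirce e (peirce_proj e z).
Proof.
(* [z] stripped of its components along [e] and [e']. It has trace 0 and is orthogonal to [e], so
   [e ** z' + z' ** e = z'], whence [z' ** e' = e ** z']. *)
pose z' := z - b z e' *: e - b z e *: e'.
have -> : peirce_proj e z = e ** z'.
  rewrite /z' 2!(na_mulDr e) !(na_mulNr e) !(na_mulZr _ e).
  by rewrite idem_sqr idem_mul_compl scaler0 subr0.
have t1 : b z' one = 0.
  rewrite /z' !polarDl !polarNl !polarZl idem_trace (idempotent_compl he).2.
  by rewrite polarDr polarNr; ring.
have te : b z' e = 0.
  rewrite /z' polarDl polarNl polarZl polarDl polarNl polarZl idem_polar.
  by rewrite [b e' _]polarC idem_polar_compl; ring.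
have ze : z' ** e = z' - e ** z'.
  rewrite na_anticomm // t1 te idem_trace scale0r add0r scale1r scale0r.
  by rewrite subr0.
have ze' : z' ** e' = e ** z'.
  by rewrite na_mulDr na_mulNr ze na_mulx1 // opprB addrC subrK.
split; first by rewrite na_mulKl // idem_trace idem_norm scale0r scale1r subr0.
rewrite -ze' na_mulKr // (idempotent_compl he).2 (idempotent_compl he).1.
by rewrite scale0r scale1r subr0.
Qed.

Lemma peirce_proj_id x : in_peirce e x -> peirce_proj e x = x.
Proof.
by move=> hx; rewrite /peirce_proj hx.1 peirce_polar_compl // scale0r subr0.
Qed.

Lemma peirce_decomp z :
  z = b z e' *: e + b z e *: e' + (peirce_proj e z + peirce_proj e' z).
Proof.
rewrite /peirce_proj complK na_mulDl na_mulNl na_mul1x //.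
rewrite addrACA [_ + (_ - _)]addrC subrK [_ + (_ - _)]addrC subrK.
by rewrite addrC subrK.
Qed.

End Idempotent.

Section Products.
Variables (e : A) (he : rank1_idempotent e).
Local Notation e' := (one - e).
Let he' := idempotent_compl he.

Lemma in_peirceK x : in_peirce e x -> in_peirce (one - e') x.
Proof. by rewrite complK. Qed.

(** [x ** y] and [y ** x] add up to [- (b x y *: one)]; left multiplication by [e] fixes the first
    and kills the second. *)
Lemma peirce_mulUV x y : in_peirce e x -> in_peirce e' y -> x ** y = - (b x y *: e).
Proof.
move=> hx hy; have ey : e ** y = 0 by have := peirce_compl_mul hy; rewrite complK.
have tx := peirce_trace he hx; have ty := peirce_trace he' hy.
have e1 : e ** (x ** y) = x ** y.
  rewrite na_mulKl_lin // (idem_trace he) tx ey polarC (peirce_polar_idem he hx).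
  by rewrite na_mul0r !scale0r ?scaler0 addr0 !subr0 scale1r.
have e2 : e ** (y ** x) = 0.
  rewrite na_mulKl_lin // (idem_trace he) ty [b e y]polarC hx.1.
  have := peirce_polar_compl he' hy; rewrite complK => ->.
  by rewrite !scale0r addr0 !subr0 scale1r subrr.
have h : x ** y = - (b x y *: one) - y ** x.
  by rewrite na_anticomm // tx ty !scale0r addr0 sub0r.
rewrite -e1 h na_mulDr !na_mulNr e2.
by rewrite na_mulZr na_mulx1 // subr0.
Qed.

(** The double cross product formula. It yields both that [x ** y = 0] forces proportionality and
    the products [v i ** v (i + 1)] of a canonical basis. *)
Lemma peirce_mulUU_V x y v : in_peirce e x -> in_peirce e y -> in_peirce e' v ->
  (x ** y) ** v = b x v *: y - b y v *: x.
Proof.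
move=> hx hy hv; rewrite na_mulKr_lin // (peirce_trace he' hv) (peirce_trace he hy).
rewrite !scale0r addr0 sub0r (peirce_mulUV hx hv) na_mulNl na_mulZl hy.1 opprK.
by rewrite addrC [b v y]polarC.
Qed.

Lemma peirce_polar_proj z v : in_peirce e' v -> b (peirce_proj e z) v = b z v.
Proof.
move=> hv; rewrite /peirce_proj polarDl polarNl polarZl adjoint_l //.
rewrite (idem_conj he) hv.1 [b e v]polarC.
by have := peirce_polar_compl he' hv; rewrite complK => ->; rewrite mulr0 subr0.
Qed.

Lemma peirce_mul0 x y v : in_peirce e x -> in_peirce e y -> in_peirce e' v ->
  b x v = 1 -> x ** y = 0 -> y = b y v *: x.
Proof.
move=> hx hy hv h1 h0; have := peirce_mulUU_V hx hy hv.
by rewrite h0 na_mul0l h1 scale1r => /esym/eqP; rewrite subr_eq0 => /eqP.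
Qed.

Lemma polar_x_xy x y : in_peirce e x -> in_peirce e y -> b x (x ** y) = 0.
Proof.
by move=> hx hy; rewrite -{1}[x](na_mulx1 hA) polarMl // (peirce_norm he) // mul0r.
Qed.

Lemma polar_x_yx x y : in_peirce e x -> in_peirce e y -> b x (y ** x) = 0.
Proof.
by move=> hx hy; rewrite -{1}[x](na_mul1x hA) polarMr // (peirce_norm he) // mul0r.
Qed.

(** With [polar_x_xy] and [polar_x_yx] this lets [b x (y ** z)] play the role of a volume form on
    the Peirce space. *)
Lemma polar_cyclic x y z : in_peirce e x -> in_peirce e y -> in_peirce e z ->
  b x (y ** z) = b y (z ** x).
Proof.
move=> hx hy hz; rewrite polarC adjoint_r // /qa_conj (peirce_trace he) //.
by rewrite scale0r sub0r na_mulNr polarNr (peirce_skew he hx hz) polarNr opprK.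
Qed.

End Products.

Lemma Z3P (P : 'Z_3 -> Prop) : P 0 -> P 1 -> P 2 -> forall i, P i.
Proof.
move=> h0 h1 h2; have e (i j : 'Z_3) : i = j :> nat -> P i -> P j.
  by move=> /val_inj ->.
by case=> [[|[|[|//]]] hi]; [apply: e h0|apply: e h1|apply: e h2].
Qed.

Section CanonicalBasis.
Variables (e : A) (he : rank1_idempotent e).
Local Notation e' := (one - e).
Let he' := idempotent_compl he.

Lemma canonical4 u v : \dim {:A} = 4%N -> in_peirce e u -> in_peirce e' v ->
  b u v = 1 -> canonical_basis4 e e' u v.
Proof.
move=> d4 hu hv huv; have hvu : b v u = 1 by rewrite polarC.
have ev : b v e = 0 by have := peirce_polar_compl he' hv; rewrite complK.
have eu := peirce_polar_idem he hu.
have ev' := peirce_polar_idem he' hv; have eu' := peirce_polar_compl he hu.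
have vv := peirce_isotropic he' hv hv; have uu := peirce_isotropic he hu hu.
have ee := idem_polar he; have ee' := idem_polar he'; have e1 := idem_polar_compl he.
have n1 : (1 : F) != 0 by exact: oner_neq0.
have fr : free [:: e; e'; u; v].
  apply: (@free_cons_polar _ _ _ e'); rewrite ?e1 //.
    by move=> y; rewrite !inE => /or3P[] /eqP ->.
  apply: (@free_cons_polar _ _ _ e); rewrite ?[b e' _]polarC ?e1 //.
    by move=> y; rewrite !inE => /orP[] /eqP ->.
  apply: (@free_cons_polar _ _ _ v); rewrite ?huv //.
    by move=> y; rewrite !inE => /eqP ->.
  by rewrite seq1_free; apply: contraNneq n1 => h; rewrite -huv h polar0r.
have := peirce_compl_mul hv; rewrite complK => ev0.
have := peirce_mul_idem hu => ue0.
split.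
- by rewrite basisEfree fr subvf d4.
- by split; rewrite ?idem_sqr ?idem_mul_compl ?compl_mul_idem.
- by case: hu => ? ?; case: hv; rewrite complK.
- by split=> //; [exact: peirce_compl_mul|exact: peirce_mul_idem].
- split; rewrite ?(peirce_sqr he hu) ?(peirce_sqr he' hv) //.
    by rewrite (peirce_mulUV he hu hv) huv scale1r.
  by rewrite (peirce_mulUV he' hv (in_peirceK hu)) hvu scale1r.
Qed.

(** A triple of volume 1 suffices: the products [u (i + 1) ** u (i + 2)] are then dual to the [u i],
    and the Peirce products give the rest of the table. *)
Lemma canonical8 (u : 'Z_3 -> A) : \dim {:A} = 8%N ->
  (forall i, in_peirce e (u i)) -> b (u 0) (u 1 ** u 2) = 1 ->
  canonical_basis8 e e' u (fun i => u (i + 1) ** u (i + 2)).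
Proof.
move=> d8 hu h1; pose v i := u (i + 1) ** u (i + 2); rewrite -/v.
have hv i : in_peirce e' (v i) by exact: peirce_mulUU.
have Z3 (i j : 'Z_3) : i = j :> nat -> i = j by exact: val_inj.
have e33 : 3 = 0 :> 'Z_3 by exact: Z3.
have huv i j : b (u i) (v j) = (i == j)%:R.
  have h1' : b (u 1) (u 2 ** u 0) = 1 by rewrite -(polar_cyclic he).
  have h2' : b (u 2) (u 0 ** u 1) = 1 by rewrite -(polar_cyclic he).
  have [v0 v1 v2] : [/\ v 0 = u 1 ** u 2, v 1 = u 2 ** u 0 & v 2 = u 0 ** u 1].
    by split; congr (u _ ** u _); exact: Z3.
  by move: i j; do 2 apply: Z3P; rewrite ?(v0, v1, v2) ?(polar_x_xy he, polar_x_yx he).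
have hvu i j : b (v i) (u j) = (i == j)%:R by rewrite polarC huv eq_sym.
have ev i : b (v i) e = 0 by have := peirce_polar_compl he' (hv i); rewrite complK.
have eu i := peirce_polar_idem he (hu i).
have ev' i := peirce_polar_idem he' (hv i).
have eu' i := peirce_polar_compl he (hu i).
have vv i j := peirce_isotropic he' (hv i) (hv j).
have uu i j := peirce_isotropic he (hu i) (hu j).
have ee := idem_polar he; have ee' := idem_polar he'; have e1 := idem_polar_compl he.
have n1 : (1 : F) != 0 by exact: oner_neq0.
(* Each vector is split off by its dual: [e] and [e'] by each other, [u i] by [v i] and
   conversely. *)
have fr : free [:: e; e'; u 1; u 2; u 3; v 1; v 2; v 3].
  rewrite e33.
  apply: (@free_cons_polar _ _ _ e'); rewrite ?e1 //.
    by move=> y; rewrite !inE => /or4P[|||/or4P[]] /eqP ->.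
  apply: (@free_cons_polar _ _ _ e); rewrite ?[b e' _]polarC ?e1 //.
    by move=> y; rewrite !inE => /or4P[|||/or3P[]] /eqP ->.
  apply: (@free_cons_polar _ _ _ (v 1)); rewrite ?huv //.
    by move=> y; rewrite !inE => /or4P[|||/orP[]] /eqP ->; rewrite ?vv ?huv.
  apply: (@free_cons_polar _ _ _ (v 2)); rewrite ?huv //.
    by move=> y; rewrite !inE => /or4P[] /eqP ->; rewrite ?vv ?huv.
  apply: (@free_cons_polar _ _ _ (v 0)); rewrite ?huv //.
    by move=> y; rewrite !inE => /or3P[] /eqP ->; rewrite ?vv ?huv.
  apply: (@free_cons_polar _ _ _ (u 1)); rewrite ?hvu //.
    by move=> y; rewrite !inE => /orP[] /eqP ->; rewrite ?hvu.
  apply: (@free_cons_polar _ _ _ (u 2)); rewrite ?hvu //.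
    by move=> y; rewrite !inE => /eqP ->; rewrite ?hvu.
  rewrite seq1_free; apply: contraNneq n1 => h.
  by have := hvu 0 0; rewrite h polar0l eqxx => ->.
split.
- by rewrite basisEfree fr subvf d8.
- by split; rewrite ?idem_sqr ?idem_mul_compl ?compl_mul_idem.
- move=> i; split; first by case: (hu i) => ? ?; case: (hv i); rewrite complK.
  have := peirce_compl_mul (hv i); rewrite complK => ev0.
  by split=> //; [exact: peirce_compl_mul|exact: peirce_mul_idem
    |exact: peirce_mul_idem].
- move=> i; rewrite /v.
  have i21 : i + 2 + 1 = i by rewrite -addrA (Z3 (2 + 1) 0) ?addr0.
  have i22 : i + 2 + 2 = i + 1 by rewrite -addrA; congr (_ + _); exact: Z3.
  have key : v i ** v (i + 1) = u (i + 2).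
    rewrite {1}/v (peirce_mulUU_V he (hu _) (hu _) (hv _)) !huv eqxx scale1r.
    rewrite (inj_eq (addrI i)) (_ : (2 == 1 :> 'Z_3) = false) //.
    by rewrite scale0r subr0.
  rewrite !(i21, i22) (peirce_skew he (hu (i + 1)) (hu i)).
  rewrite -/(v i) -/(v (i + 1)) (peirce_skew he' (hv (i + 1)) (hv i)) key.
  by split=> //; split; [exact: (peirce_sqr he)|exact: (peirce_sqr he')].
- move=> i j; rewrite (peirce_mulUV he (hu i) (hv j)).
  rewrite (peirce_mulUV he' (hv i) (in_peirceK (hu j))) huv.
  by rewrite polarC huv [j == i]eq_sym.
Qed.

End CanonicalBasis.
End Peirce.

(** * Homogeneous triples in the Peirce space *)

Section HomogeneousPeirce.
Variables (F : fieldType) (A : quadAlg F) (hA : hurwitz A).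
Hypothesis dimA : \dim {:A} != 0%N.
Local Notation q := (qa_norm A).
Local Notation b := (@qa_polar F A).
Local Notation one := (qa_one A).

Section OneGrading.
Variables (H : zmodType) (L : H -> {vspace A}) (hL : hurwitz_graded L).

(** For [y] of degree 0 with [b x y = 1], the product [qa_conj x ** y] has trace [b x y = 1], and
    norm 0 because [q x = 0]. *)
Lemma homogeneous_idempotent x : x \in L 0 -> x != 0 -> q x = 0 ->
  exists2 e, e \in L 0 & rank1_idempotent e.
Proof.
move=> x0 nx qx; have [y] := graded_pairing hA hL x0 nx; rewrite oppr0 => y0 hxy.
have [_ _ m _ _] := hL; exists (qa_conj x ** y).
  by have := m _ _ _ _ (graded_conj hL x0) y0; rewrite addr0.
split; first by rewrite normM // norm_conj // qx mul0r.
by rewrite polarC -adjoint_l // na_mulx1.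
Qed.

Variables (e : A) (he : rank1_idempotent e) (e0 : e \in L 0).

Lemma compl_graded : one - e \in L 0.
Proof. by have [o _ _ _ _] := hL; rewrite memvB. Qed.

Lemma peirce_proj_graded h z : z \in L h -> peirce_proj e z \in L h.
Proof.
have [_ _ m p _] := hL => zh; rewrite /peirce_proj memvB //.
  by have := m _ _ _ _ e0 zh; rewrite add0r.
have [->|/(p _ _ _ _ zh compl_graded)] := eqVneq (b z (one - e)) 0.
  by rewrite scale0r mem0v.
by rewrite addr0 => ->; exact: memvZ.
Qed.

(** Homogeneous generation is applied to the preimage of [W] under the Peirce projection, which
    preserves degrees. *)
Lemma peirce_hom_ex (W : {vspace A}) x : in_peirce e x -> x \notin W ->
  exists h y, [/\ y \in L h, in_peirce e y & y \notin W].
Proof.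
have [_ hom _ _ _] := hL => hx xW.
have [h [y [yh]]] : exists h y, y \in L h /\ y \notin (linfun (peirce_proj e) @^-1: W)%VS.
  by apply: (hom _ x); rewrite -memv_preim lfunE /= peirce_proj_id.
rewrite -memv_preim lfunE => yW; exists h, (peirce_proj e y).
by split=> //; [exact: peirce_proj_graded|exact: peirce_proj_in].
Qed.

Lemma peirce_dual u : in_peirce e u -> u != 0 ->
  exists2 w, in_peirce (one - e) w & b u w = 1.
Proof.
move=> hu u0; have [w hw] := polar_neq0 hA u0.
have he' := idempotent_compl hA dimA he.
exists ((b u w)^-1 *: peirce_proj (one - e) w).
  have [h1 h2] := peirce_proj_in hA dimA he' w.
  by split; rewrite ?na_mulZl ?na_mulZr ?h1 ?h2.
rewrite polarZr [b u (_ _ _)]polarC (peirce_polar_proj hA dimA he'); last exact: in_peirceK.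
by rewrite [b w u]polarC mulVf.
Qed.

Lemma peirce_dual_hom h u : u \in L h -> in_peirce e u -> u != 0 ->
  exists w, [/\ w \in L (- h), in_peirce (one - e) w & b u w = 1].
Proof.
move=> uh hu u0; have [w wh hw] := graded_pairing hA hL uh u0.
have he' := idempotent_compl hA dimA he.
exists (peirce_proj (one - e) w); split; last 1 first.
- by rewrite polarC (peirce_polar_proj hA dimA he') 1?polarC //; exact: in_peirceK.
- have [o _ m p _] := hL; rewrite /peirce_proj complK memvB //.
    by have := m _ _ _ _ compl_graded wh; rewrite add0r.
  have [->|/(p _ _ _ _ wh e0)] := eqVneq (b w e) 0; first by rewrite scale0r mem0v.
  by rewrite addr0 => ->; apply: memvZ; exact: compl_graded.
- exact: peirce_proj_in.
Qed.

End OneGrading.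

Section MainGrading.
Variables (G : zmodType) (Gam : G -> {vspace A}) (P : 'Z_2 -> {vspace A}).
Hypothesis gP : grading P.
Let L := refine Gam P.
Hypothesis hL : hurwitz_graded L.
Variables (e : A) (he : rank1_idempotent e) (e0 : e \in L 0).
Local Notation e' := (one - e).
Let hP := grading_hurwitz_graded hA dimA gP.
Let he' := idempotent_compl hA dimA he.

Lemma Z2P (i : 'Z_2) : i = 0 \/ i = 1.
Proof. by case: i => [[|[|[]]]] // ?; [left|right]; apply/val_inj. Qed.

Lemma Z2_addii (i : 'Z_2) : i + i = 0.
Proof. by case: (Z2P i) => ->; apply/val_inj. Qed.

Lemma memL h x : x \in L h -> x \in Gam h.1 /\ x \in P h.2.
Proof. by rewrite memv_cap => /andP. Qed.

(** [y] has a nonzero projection to one of the two Peirce spaces. If only to that of [e'], a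
    homogeneous element of the Peirce space of [e] pairing with it has parity [- i], that is,
    [i]. *)
Lemma peirce_parity_ex i y : y \in P i -> y \notin (<[e]> + <[e']>)%VS ->
  exists h u, [/\ u \in L h, h.2 = i, in_peirce e u & u != 0].
Proof.
move=> yi hy; have [_ _ _ pP _] := hP.
have eP0 : e \in P 0 by have [] := memL e0.
have [z0|z0] := eqVneq (peirce_proj e y) 0; last first.
  have zi : peirce_proj e y \in P i by exact: (peirce_proj_graded hP).
  have zin := peirce_proj_in hA dimA he y.
  have [|h [u [uh hu uW]]] := peirce_hom_ex hL he e0 (W := P (i + 1)) zin.
    apply: contra z0 => z1; apply/eqP; apply: contraTeq (oner_neq0 'Z_2) => z0.
    have := grading_disjoint gP zi z1 z0.
    by rewrite -{1}[i]addr0 => /addrI <-.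
  exists h, u; split=> //; last by apply: contraNneq uW => ->; exact: mem0v.
  have [_ u2] := memL uh; case: (Z2P (h.2 - i)) => /eqP; rewrite subr_eq ?add0r => /eqP // h2.
  by case/negP: uW; rewrite addrC -h2.
have [z0'|z0'] := eqVneq (peirce_proj e' y) 0.
  case/negP: hy; rewrite (peirce_decomp hA e y) z0 z0' !addr0.
  by rewrite memv_add // memvZ // memv_line.
have zi : peirce_proj e' y \in P i.
  by apply: (peirce_proj_graded hP) => //; exact: (compl_graded hP).
have zin := peirce_proj_in hA dimA he' y.
have [w hw hbw] := peirce_dual he' zin z0'; rewrite complK in hw.
have [|h [u [uh hu]]] := peirce_hom_ex hL he e0 (W := orthv (peirce_proj e' y)) hw.
  by rewrite mem_orthv hbw oner_neq0.
rewrite mem_orthv => hbu; have [_ u2] := memL uh.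
exists h, u; split=> //; last by apply: contraNneq hbu => ->; rewrite polar0r.
have /eqP := pP _ _ _ _ zi u2 hbu; rewrite addrC addr_eq0 => /eqP ->.
by apply/eqP; rewrite eq_sym -addr_eq0 Z2_addii.
Qed.

Hypothesis P1_neq0 : P 1 != 0%VS.

Lemma peirce_odd_ex :
  exists h u, [/\ u \in L h, h.2 = 1, in_peirce e u & u != 0].
Proof.
have eP0 : e \in P 0 by have [] := memL e0.
have eP0' := compl_graded hP eP0.
move: P1_neq0; rewrite -subv0 => /subvPn[y y1]; rewrite memv0 => y0.
apply: (peirce_parity_ex y1); apply: contra y0 => hy.
apply/eqP; apply: contraTeq (oner_neq0 'Z_2) => y0; rewrite negbK.
apply/eqP/(grading_disjoint gP y1) => //; apply: subvP hy.
by rewrite subv_add -!memvE eP0 eP0'.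
Qed.

Hypothesis P0_big : (2 < \dim (P 0%R))%N.

Lemma peirce_even_ex :
  exists h u, [/\ u \in L h, h.2 = 0, in_peirce e u & u != 0].
Proof.
have /subvPn[y y0 hy] : ~~ (P 0%R <= <[e]> + <[e']>)%VS.
  apply: contraL P0_big => /dimvS h; rewrite -leqNgt; apply: leq_trans h _.
  apply: leq_trans (dimv_add_leqif _ _) _; rewrite !dim_vline.
  by case: (e != 0); case: (e' != 0).
exact: (peirce_parity_ex y0 hy).
Qed.

(** An even [u0] and an odd [u1] are not proportional, so [u0 ** u1] is nonzero. A homogeneous [u2]
    pairing with it is rescaled to volume 1; the pairing forces the degrees to sum to 0, so [u2] is
    odd. *)
Lemma homogeneous_triple : exists (u : 'Z_3 -> A) (a : 'Z_3 -> G * 'Z_2),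
  [/\ forall i, u i \in L (a i), forall i, in_peirce e (u i),
      b (u 0) (u 1 ** u 2) = 1, a 0 + a 1 + a 2 = 0
    & [/\ (a 0).2 = 0, (a 1).2 = 1 & (a 2).2 = 1]].
Proof.
have [h0 [u0 [u0L p0 hu0 nu0]]] := peirce_even_ex.
have [h1 [u1 [u1L p1 hu1 nu1]]] := peirce_odd_ex.
have v0 : u0 ** u1 != 0.
  have [w hw bw] := peirce_dual he hu0 nu0.
  apply: contra nu1 => /eqP h; have e1 := peirce_mul0 hA dimA he hu0 hu1 hw bw h.
  apply: contraTT (oner_neq0 'Z_2) => nu1; rewrite negbK.
  apply/eqP/(grading_disjoint gP _ _ nu1).
    by rewrite -p1; have [] := memL u1L.
  by rewrite e1 memvZ //; have [] := memL u0L; rewrite p0.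
have hv := peirce_mulUU hA dimA he hu0 hu1.
have [w hw bw] := peirce_dual he' hv v0; rewrite complK in hw.
have [|h2 [u2 [u2L hu2]]] := peirce_hom_ex hL he e0 (W := orthv (u0 ** u1)) hw.
  by rewrite mem_orthv bw oner_neq0.
rewrite mem_orthv => c0; have [_ _ m p _] := hL.
have sum0 := p _ _ _ _ (m _ _ _ _ u0L u1L) u2L c0.
pose c := b (u0 ** u1) u2.
pose u (i : 'Z_3) := if i == 0 then u0 else if i == 1 then u1 else c^-1 *: u2.
pose a (i : 'Z_3) := if i == 0 then h0 else if i == 1 then h1 else h2.
have hu2' : in_peirce e (c^-1 *: u2).
  by case: hu2 => x1 x2; split; rewrite ?na_mulZl ?na_mulZr ?x1 ?x2.
exists u, a; split=> //.
- by apply: Z3P => //; exact: memvZ.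
- exact: Z3P.
- rewrite /u /= (polar_cyclic hA dimA he hu0 hu1 hu2').
  rewrite (polar_cyclic hA dimA he hu1 hu2' hu0).
  by rewrite polarZl [b u2 _]polarC mulVf.
- split=> //; move: sum0 => /(congr1 snd) /=; rewrite p0 p1 add0r.
  by rewrite addrC => /eqP; rewrite addr_eq0 => /eqP; rewrite /a /= => ->; exact: val_inj.
Qed.

End MainGrading.
End HomogeneousPeirce.

(** * Homomorphisms out of the model groups *)

Section AdditiveMaps.
Variable G : zmodType.
Implicit Types g h : G.

Definition int_map g (n : int) : G := g *~ n.

Lemma int_map_additive g : zmod_morphism (int_map g).
Proof. by move=> m n; rewrite /int_map mulrzBr. Qed.

HB.instance Definition _ g := GRing.isZmodMorphism.Build int G (int_map g)
  (int_map_additive g).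

(** The modulus is written [n.+2] because ['Z_m] has order [m] only for [m] at least 2. *)
Definition Zp_map n g (hg : g *+ n.+2 = 0) (i : 'Z_n.+2) : G := g *+ i.

Lemma Zp_map_additive n g (hg : g *+ n.+2 = 0) : zmod_morphism (Zp_map hg).
Proof.
have modE m : g *+ (m %% (Zp_trunc n.+2).+2) = g *+ m.
  by rewrite {2}(divn_eq m n.+2) mulrnDr mulnC mulrnA hg mul0rn add0r.
move=> i j; rewrite /Zp_map /= !modE mulrnDr modE; congr (_ + _).
by apply/eqP; rewrite -addr_eq0 -mulrnDr subnK ?hg // ltnW.
Qed.

HB.instance Definition _ n g (hg : g *+ n.+2 = 0) :=
  GRing.isZmodMorphism.Build 'Z_n.+2 G (Zp_map hg) (Zp_map_additive hg).

Variables (H K : zmodType) (f : {additive H -> G}) (k : {additive K -> G}).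

Definition pair_map (x : H * K) : G := f x.1 + k x.2.

Lemma pair_map_additive : zmod_morphism pair_map.
Proof. by move=> x y; rewrite /pair_map !raddfB addrACA opprD. Qed.

HB.instance Definition _ := GRing.isZmodMorphism.Build (H * K)%type G pair_map
  pair_map_additive.

End AdditiveMaps.

Lemma int_additive_eq (G : zmodType) (f k : {additive int -> G}) :
  f 1 = k 1 -> f =1 k.
Proof. by move=> h n; rewrite -(intz n) !raddfMz h. Qed.

Lemma Zp_additive_eq n (G : zmodType) (f k : {additive 'Z_n.+2 -> G}) :
  f 1 = k 1 -> f =1 k.
Proof. by move=> h i; rewrite -(natr_Zp i) !raddfMn h. Qed.

Lemma int_additive_id (f : {additive int -> int}) : f 1 = 1 -> f =1 id.
Proof. by move=> h; apply: (int_additive_eq (k := idfun)). Qed.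

Lemma Zp_additive_id n (f : {additive 'Z_n.+2 -> 'Z_n.+2}) : f 1 = 1 -> f =1 id.
Proof. by move=> h; apply: (Zp_additive_eq (k := idfun)). Qed.

Section PairMaps.
Variables H K : zmodType.

Definition pair_l (x : H) : H * K := (x, 0).
Definition pair_r (y : K) : H * K := (0, y).

Lemma pair_l_additive : zmod_morphism pair_l.
Proof. by move=> x y; congr (_, _); rewrite /= subr0. Qed.

Lemma pair_r_additive : zmod_morphism pair_r.
Proof. by move=> x y; congr (_, _); rewrite /= subr0. Qed.

HB.instance Definition _ := GRing.isZmodMorphism.Build H (H * K)%type pair_l
  pair_l_additive.
HB.instance Definition _ := GRing.isZmodMorphism.Build K (H * K)%type pair_r
  pair_r_additive.

Lemma pair_additive_eq (G : zmodType) (f k : {additive (H * K) -> G}) :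
  f \o pair_l =1 k \o pair_l -> f \o pair_r =1 k \o pair_r -> f =1 k.
Proof.
move=> h1 h2 [x y]; have -> : (x, y) = pair_l x + pair_r y.
  by congr (_, _); rewrite /= ?addr0 ?add0r.
by rewrite !raddfD [f _]h1 [f _]h2.
Qed.

End PairMaps.

Lemma int2_additive_id (f : {additive (int * int) -> (int * int)}) :
  f (1, 0) = (1, 0) -> f (0, 1) = (0, 1) -> f =1 id.
Proof.
move=> h1 h2; apply: (pair_additive_eq (k := idfun)).
  exact: (int_additive_eq (f := f \o @pair_l _ _) (k := idfun \o @pair_l _ _)).
exact: (int_additive_eq (f := f \o @pair_r _ _) (k := idfun \o @pair_r _ _)).
Qed.

Lemma intZp_additive_id n (f : {additive (int * 'Z_n.+2) -> (int * 'Z_n.+2)}) :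
  f (1, 0) = (1, 0) -> f (0, 1) = (0, 1) -> f =1 id.
Proof.
move=> h1 h2; apply: (pair_additive_eq (k := idfun)).
  exact: (int_additive_eq (f := f \o @pair_l _ _) (k := idfun \o @pair_l _ _)).
exact: (Zp_additive_eq (f := f \o @pair_r _ _) (k := idfun \o @pair_r _ _)).
Qed.

Lemma Zp2_additive_id m n (f : {additive ('Z_m.+2 * 'Z_n.+2) -> ('Z_m.+2 * 'Z_n.+2)}) :
  f (1, 0) = (1, 0) -> f (0, 1) = (0, 1) -> f =1 id.
Proof.
move=> h1 h2; apply: (pair_additive_eq (k := idfun)).
  exact: (Zp_additive_eq (f := f \o @pair_l _ _) (k := idfun \o @pair_l _ _)).
exact: (Zp_additive_eq (f := f \o @pair_r _ _) (k := idfun \o @pair_r _ _)).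
Qed.

(** * Universal group of a grading with a homogeneous canonical basis *)

Section CanonicalGrading.
Variables (F : fieldType) (A : nonassocAlg F).
Variables (G : zmodType) (Gam : G -> {vspace A}).
Hypotheses (grad : grading Gam) (univ : universal_group Gam).
Variables (e1 e2 : A) (u v : 'Z_3 -> A) (a : 'Z_3 -> G).

(* The degree of [v i] is forced to be the opposite of that of [u i]. *)
Definition homogeneous8 : Prop :=
  [/\ e1 \in Gam 0, e2 \in Gam 0, forall i, u i \in Gam (a i)
    & forall i, v i \in Gam (- a i)].

Hypothesis cb : canonical_basis8 e1 e2 u v.
Hypothesis hom : homogeneous8.
Variables (H : zmodType) (psi : {additive H -> G}) (b : 'Z_3 -> H).

Let t : seq (H * {vspace A}) :=
  [:: (0, <[e1]>%VS); (0, <[e2]>%VS)]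
    ++ [seq (b i, <[u i]>%VS) | i <- [:: 1; 2; 3]]
    ++ [seq (- b i, <[v i]>%VS) | i <- [:: 1; 2; 3]].

Lemma Z3_enum (i : 'Z_3) : i \in [:: 1; 2; 3].
Proof. by move: i; apply: Z3P. Qed.

Let memt (P : H * {vspace A} -> Prop) : P (0, <[e1]>%VS) -> P (0, <[e2]>%VS) ->
  (forall i, P (b i, <[u i]>%VS)) -> (forall i, P (- b i, <[v i]>%VS)) ->
  forall p, p \in t -> P p.
Proof.
move=> h1 h2 h3 h4 p; rewrite !mem_cat => /or3P[].
- by rewrite !inE => /orP[] /eqP ->.
- by move=> /mapP[i _ ->].
- by move=> /mapP[i _ ->].
Qed.

Let tE : (0, <[e1]>%VS) \in t.
Proof. by rewrite inE eqxx. Qed.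

Let tu i : (b i, <[u i]>%VS) \in t.
Proof. by rewrite !mem_cat map_f ?orbT // Z3_enum. Qed.

Let tv i : (- b i, <[v i]>%VS) \in t.
Proof. by rewrite !mem_cat [X in _ || (_ || X)]map_f ?orbT // Z3_enum. Qed.

Hypothesis psib : forall i, psi (b i) = a i.
Hypothesis sumb : b 0 + b 1 + b 2 = 0.
Hypothesis I0 : forall i, a i = 0 -> b i = 0.
Hypothesis I1 : forall i, a i = a (i + 1) -> b i = b (i + 1).
Hypothesis I2 : forall i, a i + a i = 0 -> b i + b i = 0.
Hypothesis gen : forall f : {additive H -> H}, (forall i, f (b i) = b i) -> f =1 id.

Lemma Z3_two (i j : 'Z_3) : [\/ j = i, j = i + 1 | i = j + 1].
Proof.
move: i j; do 2 apply: Z3P;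
  first [by apply: Or31; apply: val_inj | by apply: Or32; apply: val_inj
    | by apply: Or33; apply: val_inj].
Qed.

Lemma canonical8_neq0 : [/\ e1 != 0, e2 != 0, forall i, u i != 0 & forall i, v i != 0].
Proof.
have [/andP[_ /free_not0 nz] _ _ _ _] := cb.
by split=> [||i|i]; apply: nz; rewrite !inE ?eqxx ?orbT //;
  have := Z3_enum i; rewrite !inE => /or3P[] /eqP ->; rewrite eqxx ?orbT.
Qed.

(** The coincidences in [I0], [I1], [I2] imply all others among 0, [a i], [- a i]: since the sum is
    0, [a i = - a (i + 1)] means [a (i + 2) = 0]. *)
Lemma canonical8_iso : additive_iso psi.
Proof.
have [bas [m11 m22 m12 m21] muv muu mUV] := cb.
have [he1 he2 hu hv] := hom; have [n1 n2 nu nv] := canonical8_neq0.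
have b3 i : b i + b (i + 1) + b (i + 2) = 0.
  have Z3 (j k : 'Z_3) : j = k :> nat -> j = k by exact: val_inj.
  move: i; apply: Z3P; first by rewrite !add0r.
    by rewrite (Z3 (1 + 1) 2) // (Z3 (1 + 2) 0) // -[RHS]sumb [LHS]addrC addrA.
  by rewrite (Z3 (2 + 1) 0) // (Z3 (2 + 2) 1) // -[RHS]sumb -addrA addrC.
have a3 i : a i + a (i + 1) + a (i + 2) = 0 by rewrite -!psib -!raddfD b3 raddf0.
have sub p : p \in t -> (p.2 <= Gam (psi p.1))%VS.
  by move: p; apply: memt => [||i|i] /=; rewrite ?raddf0 ?raddfN ?psib -memvE.
have J0 i j : a i = a j -> b i = b j.
  by case: (Z3_two i j) => [->|->|->] //; [exact: I1|move=> /esym/I1 ->].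
have J1 i j : a i = - a j -> b i = - b j.
  have K i' : a i' = - a (i' + 1) -> b i' = - b (i' + 1).
    move=> e; have := a3 i'; have := b3 i'; rewrite e addNr add0r => hb /I0 h0.
    by move: hb; rewrite h0 addr0 => /eqP; rewrite addr_eq0 => /eqP.
  case: (Z3_two i j) => [->|->|->].
  - by move/eqP; rewrite -addr_eq0 => /eqP/I2/eqP; rewrite addr_eq0 => /eqP.
  - exact: K.
  - by move=> /(congr1 -%R); rewrite opprK => /esym/K ->; rewrite opprK.
have Z0 i : 0 = a i -> 0 = b i by move=> /esym/I0 ->.
have N0 i : - a i = 0 -> - b i = 0.
  by move/eqP; rewrite oppr_eq0 => /eqP/I0 ->; rewrite oppr0.
have ZN i : 0 = - a i -> 0 = - b i by move=> /esym/N0 ->.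
have J2 i j : - a i = a j -> - b i = b j by move=> /esym/J1 ->.
have J3 i j : - a i = - a j -> - b i = - b j by move=> /oppr_inj/J0 ->.
apply: (universal_iso grad univ (t := t)) => //.
- rewrite /t /= !big_cons big_nil addv0 /=; have := span_basis bas.
  by rewrite !span_cons span_nil addv0.
- apply: memt => [||i|i] /=; rewrite -subv0 -memvE memv0;
    [exact: n1|exact: n2|exact: nu|exact: nv].
- move=> f hf; apply: gen => i; exact: (hf _ (tu i)).
- move=> p p' pt; move: p pt p'.
  apply: memt => [||i|i]; apply: memt => [||j|j] //=;
    rewrite ?raddf0 ?raddfN ?psib;
    first [exact: I0 | exact: Z0 | exact: N0 | exact: ZN | exact: J0 | exact: J1
      | exact: J2 | exact: J3].
(* The degrees are closed under nonzero products: [u i ** u (i + 1)] is a [v], of degree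
   [- b (i + 2) = b i + b (i + 1)], and products of a [u] with a [v] vanish or have degree 0. *)
- have D i : b (i + 2) = - (b i + b (i + 1)).
    by apply/eqP; rewrite -addr_eq0 addrC b3.
  move=> p p' x y pt; move: p pt p'.
  apply: memt => [||i|i]; apply: memt => [||j|j] /= /vlineP[c ->] /vlineP[d ->];
    rewrite na_mulZl na_mulZr.
  all: rewrite ?m11 ?m22 ?m12 ?m21 ?scaler0 ?eqxx // => nz.
  all: try by exists (0, <[e1]>%VS); [exact: tE|rewrite addr0].
  all: try by exists (b j, <[u j]>%VS); [exact: tu|rewrite add0r].
  all: try by exists (b i, <[u i]>%VS); [exact: tu|rewrite addr0].
  all: try by exists (- b j, <[v j]>%VS); [exact: tv|rewrite add0r].
  all: try by exists (- b i, <[v i]>%VS); [exact: tv|rewrite addr0].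
  + move: nz; case: (Z3_two i j) => [e|e|e].
    * by rewrite e; have [_ _ _ _ [-> _]] := muu i; rewrite !scaler0 eqxx.
    * by exists (- b (i + 2), <[v (i + 2)%R]>%VS); [exact: tv|rewrite /= D opprK e].
    * by exists (- b (j + 2), <[v (j + 2)%R]>%VS); [exact: tv|rewrite /= D opprK e addrC].
  + move: nz; have [-> _] := mUV i j; have [-> _|_] := eqVneq i j.
      by exists (0, <[e1]>%VS); [exact: tE|rewrite subrr].
    by rewrite scale0r oppr0 !scaler0 eqxx.
  + move: nz; have [_ ->] := mUV i j; have [-> _|_] := eqVneq i j.
      by exists (0, <[e1]>%VS); [exact: tE|rewrite addNr].
    by rewrite scale0r oppr0 !scaler0 eqxx.
  + move: nz; case: (Z3_two i j) => [e|e|e].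
    * by rewrite e; have [_ _ _ _ [_ ->]] := muu i; rewrite !scaler0 eqxx.
    * by exists (b (i + 2), <[u (i + 2)%R]>%VS); [exact: tu|rewrite /= D e opprD].
    * by exists (b (j + 2), <[u (j + 2)%R]>%VS); [exact: tu|rewrite /= D e opprD addrC].
Qed.

End CanonicalGrading.

(** * Gradings associated to a Cayley-Dickson doubling *)

Section Doubling.
Variables (F : fieldType) (A : quadAlg F) (hA : hurwitz A).
Hypothesis char2 : 2%N \in [pchar F].
Hypothesis dimA : \dim {:A} = 8%N.
Local Notation q := (qa_norm A).
Local Notation b := (@qa_polar F A).
Local Notation one := (qa_one A).

Lemma grading_cap0 (G : zmodType) (Gam : G -> {vspace A}) g h (U V : {vspace A}) :
  grading Gam -> (U <= Gam g)%VS -> (V <= Gam h)%VS -> g != h -> (U :&: V)%VS = 0%VS.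
Proof.
move=> grad Ug Vh gh; apply/eqP; rewrite -subv0; apply/subvP => x.
rewrite memv_cap memv0 => /andP[/(subvP Ug) xg /(subvP Vh) xh].
by apply: contraNT gh => x0; apply/eqP/(grading_disjoint grad xg xh x0).
Qed.

Lemma dim_mulvr (K : {vspace A}) x : q x != 0 -> \dim (mulvr K x) = \dim K.
Proof.
move=> qx; apply/limg_dim_eq/eqP; rewrite -subv0; apply/subvP => y.
rewrite memv_cap memv_ker lfunE memv0 => /andP[_ /eqP h].
by apply/eqP/(na_mulr_eq0 hA qx).
Qed.

Variables (P : 'Z_2 -> {vspace A}) (gP : grading P).
Hypothesis dimP0 : \dim (P 0%R) = 4%N.
Variables (G : zmodType) (Gam : G -> {vspace A}).
Hypotheses (grad : grading Gam) (univ : universal_group Gam).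
Let L := refine Gam P.
Hypothesis hL : hurwitz_graded L.

Let memK w x : x \in (<[one]> + <[w]>)%VS -> exists a c, x = a *: one + c *: w.
Proof. by move=> /memv_addP[_ /vlineP[a ->] [_ /vlineP[c ->] ->]]; exists a, c. Qed.

Lemma mulvr_sub w g h x : w \in L 0 -> x \in L (g, h) ->
  (mulvr (<[one]> + <[w]>)%VS x <= L (g, h))%VS.
Proof.
have [o _ m _ _] := hL.
move=> w0 xg; apply/subvP => y /mulvrP[k kK ->].
suff k0 : k \in L 0 by have := m _ _ _ _ k0 xg; rewrite add0r.
by have [a [c ->]] := memK kK; rewrite memvD ?memvZ.
Qed.

Lemma dim_plane w : b w one != 0 -> \dim (<[one]> + <[w]>)%VS = 2%N.
Proof.
move=> hw; have /eqP := free_1w char2 hw.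
by rewrite span_cons span_seq1 /= => ->.
Qed.

Section Data.
Variables (w v u : A) (h g : G).
Local Notation K := (<[one]> + <[w]>)%VS.
Hypotheses (w0 : w \in L 0) (hw : b w one != 0).
Hypotheses (vh : v \in L (h, 0)) (h_neq0 : h != 0) (qv : q v != 0).
Hypotheses (ug : u \in L (g, 1)) (qu : q u != 0).

Let K0 : (K <= L 0%R)%VS.
Proof.
have [o _ _ _ _] := hL; rewrite subv_add -!memvE o; exact: w0.
Qed.

Let vuL : v ** u \in L (h + g, 1).
Proof.
have [_ _ m _ _] := hL; have := m _ _ _ _ vh ug.
by rewrite (_ : (h, 0) + (g, 1) = (h + g, 1 : 'Z_2)) //; congr (_, _); rewrite /= add0r.
Qed.

Let qvu : q (v ** u) != 0.
Proof. by rewrite normM // mulf_neq0. Qed.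

Let LG k : (L k <= Gam k.1)%VS. Proof. exact: capvSl. Qed.
Let LP k : (L k <= P k.2)%VS. Proof. exact: capvSr. Qed.

Let Kv_sub := mulvr_sub w0 vh.
Let Ku_sub := mulvr_sub w0 ug.
Let Kvu_sub := mulvr_sub w0 vuL.

(** Here and in the next two lemmas, summands meet trivially because their degrees or parities
    differ, and they fill the space because the dimensions add up. *)
Lemma doubling_even : directv (K + mulvr K v) /\ (K + mulvr K v)%VS = P 0%R.
Proof.
have d0 : (K :&: mulvr K v)%VS = 0%VS.
  apply: (grading_cap0 grad (subv_trans K0 (LG _)) (subv_trans Kv_sub (LG _))).
  by rewrite eq_sym.
split.
  rewrite directvE /= dimv_disjoint_sum // dim_plane // !dim_vline.
  rewrite (one_neq0 hA) ?dimA // (_ : w != 0) //.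
  by apply: contraNneq hw => ->; rewrite polar0l.
apply/eqP; rewrite eqEdim subv_add (subv_trans K0 (LP _)) (subv_trans Kv_sub (LP _)).
by rewrite /= dimP0 dimv_disjoint_sum // dim_mulvr // dim_plane.
Qed.

Lemma doubling_full : directv (P 0%R + mulvr (P 0%R) u) /\
  (P 0%R + mulvr (P 0%R) u)%VS = fullv.
Proof.
have [_ _ m] := gP.
have s1 : (mulvr (P 0%R) u <= P 1%R)%VS.
  apply/subvP => y /mulvrP[k k0 ->]; rewrite -[1]add0r; apply: m => //.
  exact: (subvP (LP _) _ ug).
have d0 : (P 0%R :&: mulvr (P 0%R) u)%VS = 0%VS.
  by apply: (grading_cap0 gP (subvv _) s1).
split; first exact/directv_addP.
apply/eqP; rewrite eqEdim subvf.
by rewrite /= dimA dimv_disjoint_sum // dim_mulvr // dimP0.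
Qed.

Lemma doubling_odd : (P 0%R + (mulvr K u + mulvr K (v ** u)))%VS = fullv.
Proof.
have d1 : (mulvr K u :&: mulvr K (v ** u))%VS = 0%VS.
  apply: (grading_cap0 grad (subv_trans Ku_sub (LG _)) (subv_trans Kvu_sub (LG _))).
  by rewrite /= -{1}[g]add0r (inj_eq (addIr g)) eq_sym.
have s1 : (mulvr K u + mulvr K (v ** u) <= P 1%R)%VS.
  by rewrite subv_add (subv_trans Ku_sub (LP _)) (subv_trans Kvu_sub (LP _)).
have d0 : (P 0%R :&: (mulvr K u + mulvr K (v ** u)))%VS = 0%VS.
  by apply: (grading_cap0 gP (subvv _) s1).
apply/eqP; rewrite eqEdim subvf.
by rewrite /= dimA !dimv_disjoint_sum // !dim_mulvr // dimP0 dim_plane.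
Qed.

Lemma doubling_CD : CD_doubling P w v u.
Proof.
have [o _ _ p _] := hL.
(* Vectors whose degrees in [G * 'Z_2] do not cancel are orthogonal; this gives all the traces and
   orthogonality relations asked of [v] and [u]. *)
have orth x y i j : x \in L i -> y \in L j -> i + j != 0 -> b x y = 0.
  by move=> xi yj; apply: contraNeq => /(p _ _ _ _ xi yj)/eqP.
split.
- split; [exact: dim_plane| |exact: (subvP (LP _) _ w0)].
  (* The form being alternating, pairing [x] with [one] and with [w] isolates its two
     coefficients. *)
  move=> x /memK[a [c ->]] hx.
  have h1 : b one w != 0 by rewrite polarC.
  have /eqP := hx one (subvP (addvSl _ _) _ (memv_line _)).
  have /eqP := hx w (subvP (addvSr _ _) _ (memv_line _)).
  rewrite /qa_orthogonal !polarE !(polar_alt char2) !mulr0 add0r addr0.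
  rewrite !mulf_eq0 (negPf h1) (negPf hw) !orbF => /eqP -> /eqP ->.
  by rewrite !scale0r addr0.
- split=> //; first exact: (subvP (LP _) _ vh).
    by apply: (orth _ _ _ _ vh o); rewrite addr0; apply: contra h_neq0 => /eqP[->].
  by apply: (orth _ _ _ _ vh w0); rewrite addr0; apply: contra h_neq0 => /eqP[->].
- split=> //; first exact: (subvP (LP _) _ ug).
  + by apply: (orth _ _ _ _ ug o); rewrite addr0; apply/eqP => -[].
  + by apply: (orth _ _ _ _ ug w0); rewrite addr0; apply/eqP => -[].
  + by apply: (orth _ _ _ _ ug vh); apply/eqP => -[].
- exact: doubling_even.
- exact: doubling_full.
Qed.

Let h2 : h *+ 2 = 0.
Proof. by have [_ _ _ _ n] := hL; have [] := n _ _ vh qv; rewrite mulr2n. Qed.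

Let g2 : g *+ 2 = 0.
Proof. by have [_ _ _ _ n] := hL; have [] := n _ _ ug qu; rewrite mulr2n. Qed.

Let nzK x : q x != 0 -> mulvr K x != 0%VS.
Proof. by move=> qx; rewrite -dimv_eq0 dim_mulvr // dim_plane. Qed.

Lemma doubling_Z2 : g = 0 -> graded_as Gam (table (H := 'Z_2)
  [:: (0, (K + mulvr K u)%VS); (1, (mulvr K v + mulvr K (v ** u))%VS)]).
Proof.
move=> g0; pose psi : {additive 'Z_2 -> G} := Zp_map (n := 0) h2.
set t := [:: _; _].
have sub p : p \in t -> (p.2 <= Gam (psi p.1))%VS.
  rewrite !inE => /orP[] /eqP -> /=; rewrite subv_add.
    rewrite raddf0 (subv_trans K0 (LG _)) /=.
    by apply: subv_trans Ku_sub _; apply: subv_trans (LG _) _; rewrite /= g0.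
  rewrite /Zp_map (subv_trans Kv_sub (LG _)) /=.
  by apply: subv_trans Kvu_sub _; apply: subv_trans (LG _) _; rewrite /= g0 addr0.
have full : (\sum_(p <- t) p.2)%VS = fullv.
  rewrite /t !big_cons big_nil addv0 /= -doubling_odd -(proj2 doubling_even).
  by rewrite -!addvA; do 2 congr (_ + _)%VS; rewrite addvA [in LHS](addvC (mulvr K u)) -addvA.
apply: (graded_as_iso grad (psi := psi)) => //.
apply: (universal_iso_inj grad univ sub full).
- move=> p; rewrite !inE => /orP[] /eqP -> /=; rewrite -subv0 subv_add negb_and !subv0.
    by rewrite nzK ?orbT.
  by rewrite nzK.
- move=> f hf; apply: Zp_additive_id.
  by apply: (hf (1, (mulvr K v + mulvr K (v ** u))%VS)); rewrite !inE eqxx orbT.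
- apply: raddf_inj => x; case: (Z2P x) => -> // hx.
  by case/eqP: h_neq0.
Qed.

(** [h], [g] and [h + g] are nonzero and killed by 2, which makes the map from ['Z_2 * 'Z_2]
    injective; [g != h] is what keeps [h + g] from being 0. *)
Lemma doubling_Z22 : g != 0 -> g != h -> graded_as Gam (table (H := ('Z_2 * 'Z_2)%type)
       [:: ((0, 0), K); ((1, 0), mulvr K v);
           ((0, 1), mulvr K u); ((1, 1), mulvr K (v ** u))]).
Proof.
move=> g0 gh.
pose psi : {additive ('Z_2 * 'Z_2) -> G} := pair_map (Zp_map (n := 0) h2) (Zp_map (n := 0) g2).
set t := [:: _; _; _; _].
have psiE x y : psi (x, y) = h *+ (x : nat) + g *+ (y : nat) by [].
have sub p : p \in t -> (p.2 <= Gam (psi p.1))%VS.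
  rewrite !inE => /or4P[] /eqP -> /=; rewrite psiE /= ?addr0 ?add0r.
  - exact: subv_trans K0 (LG _).
  - exact: subv_trans Kv_sub (LG _).
  - exact: subv_trans Ku_sub (LG _).
  - exact: subv_trans Kvu_sub (LG _).
have full : (\sum_(p <- t) p.2)%VS = fullv.
  rewrite /t !big_cons big_nil addv0 /= -doubling_odd -(proj2 doubling_even).
  by rewrite -!addvA.
apply: (graded_as_iso grad (psi := psi)) => //.
apply: (universal_iso_inj grad univ sub full).
- move=> p; rewrite !inE => /or4P[] /eqP -> /=; rewrite ?nzK //.
  by rewrite -dimv_eq0 dim_plane.
- move=> f hf; apply: Zp2_additive_id.
    by apply: (hf ((1, 0), mulvr K v)); rewrite !inE eqxx ?orbT.
  by apply: (hf ((0, 1), mulvr K u)); rewrite !inE eqxx ?orbT.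
- apply: raddf_inj => -[x y]; rewrite psiE.
  case: (Z2P x) => ->; case: (Z2P y) => -> //=; rewrite ?addr0 ?add0r => /eqP.
  + by rewrite (negPf g0).
  + by rewrite (negPf h_neq0).
  + rewrite -[eqbLHS]/(h + g) addr_eq0 => /eqP e; case/eqP: gh; apply/eqP; rewrite e -addr_eq0.
    by rewrite -mulr2n g2.
Qed.

End Data.

(** If [g = h], replacing [u] by [v ** u], of degree [h + h = 0] in [G], reduces to the case
    [g = 0]. *)
Lemma doubling_cases w v u h g :
  w \in L 0 -> b w one != 0 -> v \in L (h, 0) -> h != 0 -> q v != 0 ->
  u \in L (g, 1) -> q u != 0 ->
  (exists w v u : A, let K := (<[one]> + <[w]>)%VS in CD_doubling P w v u /\
     graded_as Gam (table (H := ('Z_2 * 'Z_2)%type)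
       [:: ((0, 0), K); ((1, 0), mulvr K v);
           ((0, 1), mulvr K u); ((1, 1), mulvr K (v ** u))]))
  \/
  (exists w v u : A, let K := (<[one]> + <[w]>)%VS in CD_doubling P w v u /\
     graded_as Gam (table (H := 'Z_2)
       [:: (0, (K + mulvr K u)%VS); (1, (mulvr K v + mulvr K (v ** u))%VS)])).
Proof.
move=> w0 hw vh h0 qv ug qu; have [e|g0] := eqVneq g 0.
  right; exists w, v, u; split; first exact: doubling_CD w0 hw vh h0 qv ug qu.
  exact: doubling_Z2 w0 hw vh h0 qv ug qu e.
have [e|gh] := eqVneq g h; last first.
  left; exists w, v, u; split; first exact: doubling_CD w0 hw vh h0 qv ug qu.
  exact: doubling_Z22 w0 hw vh h0 qv ug qu g0 gh.
have [_ _ m _ n] := hL; have h2 : h + h = 0 by have [] := n _ _ vh qv.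
have vu : v ** u \in L (0, 1).
  have := m _ _ _ _ vh ug.
  by rewrite (_ : (h, 0) + (g, 1) = (0, 1 : 'Z_2)) //; congr (_, _); rewrite /= ?e ?add0r.
have qvu : q (v ** u) != 0 by rewrite normM // mulf_neq0.
right; exists w, v, (v ** u); split; first exact: doubling_CD w0 hw vh h0 qv vu qvu.
exact: doubling_Z2 w0 hw vh h0 qv vu qvu _.
Qed.

End Doubling.

(** * Coincidences among the degrees, and the list (a)-(f) *)

(* Which elements of {0, a_i, - a_i} coincide, when the a_i have sum 0. *)
Definition degree_pattern (G : zmodType) (a : 'Z_3 -> G) : seq bool :=
  [:: a 0 == 0; a 1 == 0; a 2 == 0;
      a 0 + a 0 == 0; a 1 + a 1 == 0; a 2 + a 2 == 0;
      a 0 == a 1; a 1 == a 2; a 2 == a 0].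

Definition basic_patterns : seq (seq bool) := let T := true in let f := false in
  [:: [:: T; f; f; T; f; f; f; f; f]; [:: f; T; f; f; T; f; f; f; f];
      [:: f; f; f; T; f; f; f; T; f]; [:: f; f; f; T; f; f; f; f; f];
      [:: f; f; f; f; T; f; f; f; T]; [:: f; f; f; f; T; f; f; f; f];
      [:: f; f; f; f; f; f; T; T; T]; [:: f; f; f; f; f; f; f; T; f];
      [:: f; f; f; f; f; f; f; f; T]; [:: f; f; f; f; f; f; f; f; f]].

(* These become basic after exchanging the indices 1 and 2. *)
Definition swapped_patterns : seq (seq bool) := let T := true in let f := false in
  [:: [:: f; f; T; f; f; T; f; f; f]; [:: f; f; f; f; f; T; T; f; f];
      [:: f; f; f; f; f; T; f; f; f]; [:: f; f; f; f; f; f; T; f; f]].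

Section DegreePattern.
Variables (G : zmodType).

(** Consequences of [z = - (x + y)] and of transitivity, chosen strong enough to prune the [2^9]
    conceivable patterns. *)
Lemma degree_pattern_laws (x y z : G) : x + y + z = 0 ->
  [&& (x == 0) ==> (x + x == 0), (x == 0) ==> ((y == z) == (y + y == 0)),
      (x + x == 0) && (y + y == 0) ==> (z + z == 0),
      (x == y) ==> [&& (x == 0) == (y == 0), (x + x == 0) == (y + y == 0)
                     & (z == 0) == (x + x == 0)]
    & (x == y) && (y == z) ==> (z == x)].
Proof.
move=> s; have zE : z = - (x + y) by apply/eqP; rewrite -addr_eq0 addrC s.
apply/and5P; split; apply/implyP.
- by move=> /eqP ->; rewrite addr0.
- by move=> /eqP x0; rewrite zE x0 add0r -addr_eq0.
- by move=> /andP[/eqP x2 /eqP y2]; rewrite zE -opprD addrACA x2 y2 addr0 oppr0.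
- by move=> /eqP e; rewrite zE e oppr_eq0 !eqxx.
- by move=> /andP[/eqP -> /eqP ->].
Qed.

(** Applied to the three rotations of the degrees, the laws leave fourteen patterns, by exhaustion
    of truth values. The second hypothesis sets aside the main grading and the doublings. *)
Lemma degree_patternP (a : 'Z_3 -> G) : a 0 + a 1 + a 2 = 0 ->
  (a 0 + a 0 = 0 -> a 1 + a 1 <> 0) ->
  degree_pattern a \in basic_patterns ++ swapped_patterns.
Proof.
move=> s N; have {}N : ~~ ((a 0 + a 0 == 0) && (a 1 + a 1 == 0)).
  by apply/negP => /andP[/eqP /N h /eqP].
move: N (degree_pattern_laws s).
have s1 : a 1 + a 2 + a 0 = 0 by rewrite -[RHS]s [LHS]addrC addrA.
have s2 : a 2 + a 0 + a 1 = 0 by rewrite -[RHS]s -addrA addrC.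
move: (degree_pattern_laws s1) (degree_pattern_laws s2); rewrite /degree_pattern.
case: (a 0 == 0); case: (a 1 == 0); case: (a 2 == 0);
case: (a 0 + a 0 == 0); case: (a 1 + a 1 == 0); case: (a 2 + a 2 == 0);
by case: (a 0 == a 1); case: (a 1 == a 2); case: (a 2 == a 0).
Qed.

End DegreePattern.

(* The gradings in (a)-(f). *)
Definition canonical_type (F : fieldType) (A : nonassocAlg F) (G : zmodType)
    (Gam : G -> {vspace A}) (e1 e2 : A) (u v : 'Z_3 -> A) : Prop :=
     graded_as Gam (table (H := (int * int)%type)
       [:: ((0, 0), <<[:: e1; e2]>>%VS);
           ((1, 1), <[v 3]>%VS); ((-1, -1), <[u 3]>%VS);
           ((1, 0), <[u 1]>%VS); ((-1, 0), <[v 1]>%VS);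
           ((0, 1), <[u 2]>%VS); ((0, -1), <[v 2]>%VS)])
     \/
     (graded_as Gam (table (H := int)
        [:: (0, <<[:: e1; e2; u 3; v 3]>>%VS);
            (1, <<[:: u 1; v 2]>>%VS); (-1, <<[:: u 2; v 1]>>%VS)])
      \/
      graded_as Gam (table (H := int)
        [:: (0, <<[:: e1; e2; u 1; v 1]>>%VS);
            (1, <<[:: u 3; v 2]>>%VS); (-1, <<[:: u 2; v 3]>>%VS)]))
     \/
     (graded_as Gam (table (H := int)
        [:: (0, <<[:: e1; e2]>>%VS);
            (2, <[v 3]>%VS); (-2, <[u 3]>%VS);
            (1, <<[:: u 1; u 2]>>%VS); (-1, <<[:: v 1; v 2]>>%VS)])
      \/
      graded_as Gam (table (H := int)
        [:: (0, <<[:: e1; e2]>>%VS);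
            (2, <[v 1]>%VS); (-2, <[u 1]>%VS);
            (1, <<[:: u 2; u 3]>>%VS); (-1, <<[:: v 2; v 3]>>%VS)]))
     \/
     graded_as Gam (table (H := 'Z_3)
       [:: (0, <<[:: e1; e2]>>%VS);
           (1, <<[:: u 1; u 2; u 3]>>%VS); (2, <<[:: v 1; v 2; v 3]>>%VS)])
     \/
     (graded_as Gam (table (H := 'Z_4)
        [:: (0, <<[:: e1; e2]>>%VS); (1, <<[:: u 1; u 2]>>%VS);
            (2, <<[:: u 3; v 3]>>%VS); (3, <<[:: v 1; v 2]>>%VS)])
      \/
      graded_as Gam (table (H := 'Z_4)
        [:: (0, <<[:: e1; e2]>>%VS); (1, <<[:: u 2; u 3]>>%VS);
            (2, <<[:: u 1; v 1]>>%VS); (3, <<[:: v 2; v 3]>>%VS)]))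
     \/
     (graded_as Gam (table (H := (int * 'Z_2)%type)
        [:: ((0, 0), <<[:: e1; e2]>>%VS);
            ((1, 0), <[u 2]>%VS); ((-1, 0), <[v 2]>%VS);
            ((0, 1), <<[:: u 1; v 1]>>%VS);
            ((-1, 1), <[u 3]>%VS); ((1, 1), <[v 3]>%VS)])
      \/
      graded_as Gam (table (H := (int * 'Z_2)%type)
        [:: ((0, 0), <<[:: e1; e2]>>%VS);
            ((1, 0), <[u 2]>%VS); ((-1, 0), <[v 2]>%VS);
            ((0, 1), <<[:: u 3; v 3]>>%VS);
            ((-1, 1), <[u 1]>%VS); ((1, 1), <[v 1]>%VS)])).

Section CanonicalTypes.
Variables (F : fieldType) (A : quadAlg F) (G : zmodType) (Gam : G -> {vspace A}).
Hypotheses (grad : grading Gam) (univ : universal_group Gam).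
Variables (e1 e2 : A).

Section Leaves.
Variables (u v : 'Z_3 -> A) (a : 'Z_3 -> G).
Hypothesis cb : canonical_basis8 e1 e2 u v.
Hypothesis hom : homogeneous8 Gam e1 e2 u v a.

(** [b] lists the degrees of the [u i] in the model group. Comparing the patterns with [implb] says
    that each coincidence in [G] already holds in [H], which is what [canonical8_iso] asks for. *)
Lemma canonical8_graded_as (H : zmodType) (psi : {additive H -> G}) (b : 'Z_3 -> H)
    (t : seq (H * seq A)) :
  psi (b 0) = a 0 -> psi (b 1) = a 1 -> psi (b 2) = a 2 -> b 0 + b 1 + b 2 = 0 ->
  all2 implb (degree_pattern a) (degree_pattern b) ->
  (forall f : {additive H -> H}, f (b 0) = b 0 -> f (b 1) = b 1 -> f (b 2) = b 2 ->
     f =1 id) ->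
  (e1 \in Gam (psi 0) -> e2 \in Gam (psi 0) ->
   (forall i, u i \in Gam (psi (b i))) -> (forall i, v i \in Gam (psi (- b i))) ->
   forall p x, p \in t -> x \in p.2 -> x \in Gam (psi p.1)) ->
  {subset [:: e1; e2; u 1; u 2; u 3; v 1; v 2; v 3] <= flatten [seq p.2 | p <- t]} ->
  graded_as Gam (table [seq (p.1, <<p.2>>%VS) | p <- t]).
Proof.
move=> p0 p1 p2 sb pat gen sub full.
have psib i : psi (b i) = a i by move: i; apply: Z3P.
have [bas _ _ _ _] := cb.
apply: (graded_as_spans grad _ _ bas full).
  move: pat; rewrite /degree_pattern /= andbT.
  case/and5P=> /implyP i1 /implyP i2 /implyP i3 /implyP i4.
  case/and5P=> /implyP i5 /implyP i6 /implyP i7 /implyP i8 /implyP i9.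
  have Z3 (j k : 'Z_3) : j = k :> nat -> j = k by exact: val_inj.
  apply: (canonical8_iso grad univ cb hom psib sb).
  - by apply: Z3P => /eqP h; apply/eqP; [apply: i1|apply: i2|apply: i3].
  - apply: Z3P.
    + by rewrite (Z3 (0 + 1) 1) // => /eqP h; apply/eqP/i7.
    + by rewrite (Z3 (1 + 1) 2) // => /eqP h; apply/eqP/i8.
    + by rewrite (Z3 (2 + 1) 0) // => /eqP h; apply/eqP/i9.
  - by apply: Z3P => /eqP h; apply/eqP; [apply: i4|apply: i5|apply: i6].
  - by move=> f hf; apply: gen; apply: hf.
have [h1 h2 hu hv] := hom.
by apply: sub; rewrite ?raddf0 // => i; rewrite ?raddfN psib.
Qed.

(** The first entry [b0] is the degree of [u 3], because 3 is 0 in ['Z_3]. *)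
Definition three (H : Type) (b0 b1 b2 : H) (i : 'Z_3) : H :=
  if i == 0 then b0 else if i == 1 then b1 else b2.

Local Ltac span_cover :=
  let x := fresh "x" in
  by move=> x; rewrite /= !inE; case: (x == e1); case: (x == e2);
     case: (x == u 1); case: (x == u 2); case: (x == u 3);
     case: (x == v 1); case: (x == v 2); case: (x == v 3).

Local Ltac degrees :=
  let h1 := fresh in let h2 := fresh in let hu := fresh in let hv := fresh in
  let p := fresh "p" in let x := fresh "x" in
  move=> h1 h2 hu hv p x; rewrite !inE;
  repeat (case/orP; [|]); move=> /eqP -> /=; rewrite ?inE;
  repeat (case/orP; [|]); move=> /eqP ->;
  first [exact: h1 | exact: h2 | exact: (hu 1) | exact: (hu 2) | exact: (hu 3)
    | exact: (hv 1) | exact: (hv 2) | exact: (hv 3)].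

Hypothesis sum0 : a 0 + a 1 + a 2 = 0.

(** In each case [psi] sends generators of the model group to some of the [a i], and [sum0] together
    with the coincidences of the pattern gives the remaining degrees. *)
Lemma canonical_typeP :
  degree_pattern a \in basic_patterns -> canonical_type Gam e1 e2 u v.
Proof.
have a0E : a 0 = - (a 1 + a 2) by apply/eqP; rewrite -addr_eq0 addrA sum0.
have a1E : a 1 = - (a 2 + a 0).
  by apply/eqP; rewrite -addr_eq0 addrA addrC addrA sum0.
rewrite /= !inE.
case/orP => [/eqP pat|].
  have a0 : a 0 = 0 := eqP (congr1 (nth false ^~ 0) pat).
  right; left; left.
  apply: (canonical8_graded_as (psi := int_map (a 1)) (b := three 0 1 (-1))
    (t := [:: (0, [:: e1; e2; u 3; v 3]); (1, [:: u 1; v 2]); (-1, [:: u 2; v 1])])).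
  - by rewrite a0 raddf0.
  - by [].
  - by rewrite /= -[RHS]opprK -[a 2]addr0 -a0 -a1E.
  - by [].
  - by rewrite pat.
  - by move=> f _ h _; apply: int_additive_id.
  - degrees.
  - span_cover.
case/orP => [/eqP pat|].
  have a1 : a 1 = 0 := eqP (congr1 (nth false ^~ 1) pat).
  right; left; right.
  apply: (canonical8_graded_as (psi := int_map (a 0)) (b := three 1 0 (-1))
    (t := [:: (0, [:: e1; e2; u 1; v 1]); (1, [:: u 3; v 2]); (-1, [:: u 2; v 3])])).
  - by [].
  - by rewrite a1 raddf0.
  - by rewrite /= -[RHS]opprK -[a 2]add0r -a1 -a0E.
  - by [].
  - by rewrite pat.
  - by move=> f h _ _; apply: int_additive_id.
  - degrees.
  - span_cover.
case/orP => [/eqP pat|].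
  have s12 : a 1 = a 2 := eqP (congr1 (nth false ^~ 7) pat).
  have t0 : a 0 + a 0 = 0 := eqP (congr1 (nth false ^~ 3) pat).
  (* [a 0 = - (a 1 + a 1)] is killed by 2, so [a 1] is killed by 4. *)
  have a14 : a 1 *+ 4 = 0.
    by rewrite -[a 1 *+ 4]/(a 1 *+ (2 + 2)) mulrnDr mulr2n
      {2 4}s12 -[_ + _]opprK opprD -a0E t0 oppr0.
  right; right; right; right; left; left.
  apply: (canonical8_graded_as (psi := Zp_map a14) (b := three 2 1 1)
    (t := [:: (0, [:: e1; e2]); (1, [:: u 1; u 2]); (2, [:: u 3; v 3]); (3, [:: v 1; v 2])])).
  - rewrite -[LHS]/(a 1 + a 1) {2}s12 -[LHS]opprK -a0E; apply/eqP.
    by rewrite eq_sym -addr_eq0 t0.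
  - by [].
  - by rewrite -s12.
  - exact: val_inj.
  - by rewrite pat.
  - by move=> f _ h _; apply: Zp_additive_id.
  - degrees.
  - span_cover.
case/orP => [/eqP pat|].
  have t0 : a 0 + a 0 = 0 := eqP (congr1 (nth false ^~ 3) pat).
  have a02 : a 0 *+ 2 = 0 by rewrite mulr2n.
  right; right; right; right; right; right.
  rewrite -!span_seq1.
  (* The generators are [a 2] and [a 0], the latter killed by 2; then
     [a 1 = - a 2 - a 0 = - a 2 + a 0] has coordinates [(-1, 1)]. *)
  apply: (canonical8_graded_as (psi := pair_map (int_map (a 2)) (Zp_map (n := 0) a02))
    (b := three (0, 1) (-1, 1) (1, 0))
    (t := [:: ((0, 0), [:: e1; e2]); ((1, 0), [:: u 2]); ((-1, 0), [:: v 2]);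
            ((0, 1), [:: u 3; v 3]); ((-1, 1), [:: u 1]); ((1, 1), [:: v 1])])).
  - by rewrite -[LHS]/(int_map (a 2) 0 + a 0) raddf0 add0r.
  - rewrite -[LHS]/(- a 2 + a 0) a1E opprD; congr (_ + _); apply/eqP.
    by rewrite -addr_eq0; apply/eqP.
  - by rewrite -[LHS]/(a 2 + Zp_map (n := 0) a02 0) raddf0 addr0.
  - by congr (_, _); apply: val_inj.
  - by rewrite pat.
  - by move=> f h1 _ h2; apply: intZp_additive_id.
  - degrees.
  - span_cover.
case/orP => [/eqP pat|].
  have s20 : a 2 = a 0 := eqP (congr1 (nth false ^~ 8) pat).
  have t1 : a 1 + a 1 = 0 := eqP (congr1 (nth false ^~ 4) pat).
  have a24 : a 2 *+ 4 = 0.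
    by rewrite -[a 2 *+ 4]/(a 2 *+ (2 + 2)) mulrnDr mulr2n
      {2 4}s20 -[_ + _]opprK opprD -a1E t1 oppr0.
  right; right; right; right; left; right.
  apply: (canonical8_graded_as (psi := Zp_map a24) (b := three 1 2 1)
    (t := [:: (0, [:: e1; e2]); (1, [:: u 2; u 3]); (2, [:: u 1; v 1]); (3, [:: v 2; v 3])])).
  - by rewrite -s20.
  - rewrite -[LHS]/(a 2 + a 2) {2}s20 -[LHS]opprK -a1E; apply/eqP.
    by rewrite eq_sym -addr_eq0 t1.
  - by [].
  - exact: val_inj.
  - by rewrite pat.
  - by move=> f h _ _; apply: Zp_additive_id.
  - degrees.
  - span_cover.
case/orP => [/eqP pat|].
  have t1 : a 1 + a 1 = 0 := eqP (congr1 (nth false ^~ 4) pat).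
  have a12 : a 1 *+ 2 = 0 by rewrite mulr2n.
  right; right; right; right; right; left.
  rewrite -!span_seq1.
  apply: (canonical8_graded_as (psi := pair_map (int_map (a 2)) (Zp_map (n := 0) a12))
    (b := three (-1, 1) (0, 1) (1, 0))
    (t := [:: ((0, 0), [:: e1; e2]); ((1, 0), [:: u 2]); ((-1, 0), [:: v 2]);
            ((0, 1), [:: u 1; v 1]); ((-1, 1), [:: u 3]); ((1, 1), [:: v 3])])).
  - rewrite -[LHS]/(- a 2 + a 1) a0E opprD addrC; congr (_ + _); apply/eqP.
    by rewrite -addr_eq0; apply/eqP.
  - by rewrite -[LHS]/(int_map (a 2) 0 + a 1) raddf0 add0r.
  - by rewrite -[LHS]/(a 2 + Zp_map (n := 0) a12 0) raddf0 addr0.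
  - by congr (_, _); apply: val_inj.
  - by rewrite pat.
  - by move=> f _ h1 h2; apply: intZp_additive_id.
  - degrees.
  - span_cover.
case/orP => [/eqP pat|].
  have s12 : a 1 = a 2 := eqP (congr1 (nth false ^~ 7) pat).
  have s01 : a 0 = a 1 := eqP (congr1 (nth false ^~ 6) pat).
  have a13 : a 1 *+ 3 = 0 by rewrite -[LHS]/(a 1 + (a 1 + a 1)) -[RHS]sum0 s01 -s12 addrA.
  right; right; right; left.
  apply: (canonical8_graded_as (psi := Zp_map a13) (b := three 1 1 1)
    (t := [:: (0, [:: e1; e2]); (1, [:: u 1; u 2; u 3]); (2, [:: v 1; v 2; v 3])])).
  - by rewrite s01.
  - by [].
  - by rewrite -s12.
  - exact: val_inj.
  - by rewrite pat.
  - by move=> f h _ _; apply: Zp_additive_id.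
  - degrees.
  - span_cover.
case/orP => [/eqP pat|].
  have s12 : a 1 = a 2 := eqP (congr1 (nth false ^~ 7) pat).
  right; right; left; left.
  rewrite -!span_seq1.
  apply: (canonical8_graded_as (psi := int_map (a 1)) (b := three (-2) 1 1)
    (t := [:: (0, [:: e1; e2]); (2, [:: v 3]); (-2, [:: u 3]);
            (1, [:: u 1; u 2]); (-1, [:: v 1; v 2])])).
  - by rewrite a0E -s12.
  - by [].
  - by rewrite -s12.
  - by [].
  - by rewrite pat.
  - by move=> f _ h _; apply: int_additive_id.
  - degrees.
  - span_cover.
case/orP => [/eqP pat|].
  have s20 : a 2 = a 0 := eqP (congr1 (nth false ^~ 8) pat).
  right; right; left; right.
  rewrite -!span_seq1.
  apply: (canonical8_graded_as (psi := int_map (a 2)) (b := three 1 (-2) 1)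
    (t := [:: (0, [:: e1; e2]); (2, [:: v 1]); (-2, [:: u 1]);
            (1, [:: u 2; u 3]); (-1, [:: v 2; v 3])])).
  - by rewrite -s20.
  - by rewrite a1E -s20.
  - by [].
  - by [].
  - by rewrite pat.
  - by move=> f h _ _; apply: int_additive_id.
  - degrees.
  - span_cover.
move=> /eqP pat; left.
rewrite -!span_seq1.
(* No coincidences at all: the model is free on the degrees of [u 1] and [u 2]. *)
apply: (canonical8_graded_as (psi := pair_map (int_map (a 1)) (int_map (a 2)))
  (b := three (-1, -1) (1, 0) (0, 1))
  (t := [:: ((0, 0), [:: e1; e2]); ((1, 1), [:: v 3]); ((-1, -1), [:: u 3]);
          ((1, 0), [:: u 1]); ((-1, 0), [:: v 1]); ((0, 1), [:: u 2]); ((0, -1), [:: v 2])])).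
- by rewrite a0E opprD.
- by rewrite -[LHS]/(a 1 + int_map (a 2) 0) raddf0 addr0.
- by rewrite -[LHS]/(int_map (a 1) 0 + a 2) raddf0 add0r.
- by [].
- by rewrite pat.
- by move=> f _ h1 h2; apply: int2_additive_id.
- degrees.
- span_cover.
Qed.

End Leaves.
End CanonicalTypes.

Section Swap.
Variables (F : fieldType) (A : quadAlg F).
Hypothesis char2 : 2%N \in [pchar F].
Variables (e1 e2 : A) (u v : 'Z_3 -> A).

(* In characteristic 2 the signs in the multiplication table disappear, so
   exchanging the indices 1 and 2 preserves canonical bases. *)
Lemma canonical_basis8_swap : canonical_basis8 e1 e2 u v ->
  canonical_basis8 e1 e2 (fun i => u (- i)) (fun i => v (- i)).
Proof.
move=> [bas m1 m2 m3 m4]; split=> //.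
- have Z3 (j k : 'Z_3) : j = k :> nat -> j = k by exact: val_inj.
  rewrite (Z3 (- 1) 2) // (Z3 (- 2) 1) // (Z3 (- 3) 3) //.
  rewrite -(perm_basis _ (_ : perm_eq [:: e1; e2; u 1; u 2; u 3; v 1; v 2; v 3] _)) //.
  rewrite !perm_cons -[X in perm_eq X _]/([:: u 1; u 2] ++ [:: u 3; v 1; v 2; v 3]).
  rewrite -[X in perm_eq _ X]/([:: u 2; u 1] ++ [:: u 3; v 2; v 1; v 3]).
  have sw (x y : A) : perm_eq [:: x; y] [:: y; x].
    by apply/permP => p /=; rewrite !addn0 addnC.
  apply: perm_cat; first exact: sw.
  by rewrite perm_cons; exact: (perm_cat (sw _ _) (perm_refl [:: v 3])).
(* [u (- i) ** u (- (i + 1))] is in reverse cyclic order, so the table gives it with a sign, which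
   [oppvv] removes. *)
- move=> i; have := m3 (- (i + 1)).
  have -> : - (i + 1) + 1 = - i by rewrite opprD subrK.
  have -> : - (i + 1) + 2 = - (i + 2) by move: i; apply: Z3P; exact: val_inj.
  have [_ _ _ _ z] := m3 (- i).
  by move=> [-> -> -> -> _]; rewrite !(oppvv char2); split.
- by move=> i j; have := m4 (- i) (- j); rewrite eqr_opp.
Qed.

End Swap.

Section CanonicalParity.
Variables (F : fieldType) (A : nonassocAlg F) (P : 'Z_2 -> {vspace A}).
Hypothesis gP : grading P.

Lemma main_grading_spans (X Y : seq A) : basis_of fullv (X ++ Y) ->
  {subset X <= P 0} -> {subset Y <= P 1} -> P 0 = <<X>>%VS /\ P 1 = <<Y>>%VS.
Proof.
move=> bas XP YP; pose t : seq ('Z_2 * {vspace A}) := [:: (0, <<X>>%VS); (1, <<Y>>%VS)].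
have sub p : p \in t -> (p.2 <= P p.1)%VS.
  by rewrite !inE => /orP[] /eqP -> /=; apply/span_subvP.
have full : (\sum_(p <- t) p.2)%VS = fullv.
  by rewrite !big_cons big_nil addv0 -span_cat (span_basis bas).
have PE h := grading_table (psi := id) gP sub full (fun p _ => erefl (p.1 == h)).
by rewrite (PE 0) (PE 1) /table !big_cons !big_nil /= !addv0.
Qed.

End CanonicalParity.

(** * The main grading and the anisotropic case *)

Section MainGradingCase.
Variables (F : fieldType) (A : quadAlg F) (P : 'Z_2 -> {vspace A}).
Hypothesis gP : grading P.
Hypotheses (P0_neq0 : P 0 != 0%VS) (P1_neq0 : P 1 != 0%VS).
Variables (G : zmodType) (Gam : G -> {vspace A}).
Hypotheses (grad : grading Gam) (univ : universal_group Gam).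
Hypothesis nontriv : ~ trivial_grading Gam.

Lemma main_full : (P 0%R + P 1%R)%VS = fullv.
Proof.
apply/eqP; rewrite eqEsubv subvf /=; apply/subvP => x _; have [dec _ _] := gP.
have [s [c [hc ->]]] := dec x; apply: memv_suml => i _.
by case: (Z2P i) (hc i) => ->; [apply: subvP (addvSl _ _) _|apply: subvP (addvSr _ _) _].
Qed.

(** Nontriviality of [Gam] excludes [g = 0], so the map from ['Z_2] sending 1 to [g] is
    injective. *)
Lemma graded_as_main g : (P 0%R <= Gam 0)%VS -> (P 1%R <= Gam g)%VS -> g + g = 0 ->
  graded_as Gam P.
Proof.
move=> P0 P1 g2; have g2' : g *+ 2 = 0 by rewrite mulr2n.
have g0 : g != 0.
  apply/eqP => g0; apply: nontriv; apply/eqP; rewrite eqEsubv subvf /= -main_full.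
  by rewrite subv_add P0 -g0.
pose psi : {additive 'Z_2 -> G} := Zp_map (n := 0) g2'.
pose t : seq ('Z_2 * {vspace A}) := [:: (0, P 0); (1, P 1)].
have sub p : p \in t -> (p.2 <= Gam (psi p.1))%VS.
  by rewrite !inE => /orP[] /eqP -> /=; rewrite ?raddf0.
have full : (\sum_(p <- t) p.2)%VS = fullv.
  by rewrite !big_cons big_nil addv0 /= main_full.
apply: (@graded_as_ext _ _ _ _ _ (table t)).
  move=> h; rewrite /table !big_cons big_nil /=.
  by case: (Z2P h) => -> /=; rewrite ?addv0.
apply: (graded_as_iso grad (psi := psi)) => //.
apply: (universal_iso_inj grad univ sub full).
- by move=> p; rewrite !inE => /orP[] /eqP ->.
- move=> f hf; apply: Zp_additive_id.
  by apply: (hf (1, P 1)); rewrite !inE eqxx orbT.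
- by apply: raddf_inj => x; case: (Z2P x) => -> // hx; case/eqP: g0.
Qed.

End MainGradingCase.

Section Anisotropic.
Variables (F : fieldType) (A : quadAlg F) (hA : hurwitz A).
Hypothesis dimA : \dim {:A} != 0%N.
Local Notation q := (qa_norm A).
Local Notation b := (@qa_polar F A).
Local Notation one := (qa_one A).
Variables (P : 'Z_2 -> {vspace A}) (gP : grading P).
Hypothesis P1_neq0 : P 1 != 0%VS.
Variables (G : zmodType) (Gam : G -> {vspace A}).
Hypotheses (grad : grading Gam) (univ : universal_group Gam).
Hypothesis nontriv : ~ trivial_grading Gam.
Let L := refine Gam P.
Hypothesis hL : hurwitz_graded L.

Lemma odd_hom_ex : exists g u, u \in L (g, 1) /\ u != 0.
Proof.
have [_ hom _ _ _] := hL.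
move: P1_neq0; rewrite -subv0 => /subvPn[x x1]; rewrite memv0 => x0.
have [|[g i] [u [ug uP]]] := hom (P 0) x.
  apply/negP => xP0; have /eqP := grading_disjoint gP x1 xP0 x0.
  by rewrite (negPf (oner_neq0 'Z_2)).
have u0 : u != 0 by apply: contraNneq uP => ->; exact: mem0v.
exists g, u; split=> //; case: (Z2P i) ug => -> //.
by move=> /memL[_ /= h]; rewrite h in uP.
Qed.

(** Homogeneous generation is applied to [L 0 + P 1]: a homogeneous vector outside it is neither odd
    nor of degree 0. *)
Lemma even_hom_ex : ~~ (P 0%R <= L 0%R)%VS -> exists h v, [/\ v \in L (h, 0), h != 0 & v != 0].
Proof.
have [_ hom _ _ _] := hL.
move=> /subvPn[x x0 xL].
have [|[h i] [v [vh]]] := hom (L 0%R + P 1%R)%VS x.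
  apply: contra xL => /memv_addP[l lL [p pP e]].
  have [lG lP] := memL lL.
  have [p0|p0] := eqVneq p 0; first by rewrite e p0 addr0.
  have pP0 : p \in P 0 by rewrite -[p](addKr l) -e addrC memvB.
  have /eqP := grading_disjoint gP pP pP0 p0.
  by rewrite (negPf (oner_neq0 'Z_2)).
move=> hv; have v0 : v != 0 by apply: contraNneq hv => ->; exact: mem0v.
have [vG vP] := memL vh; case: (Z2P i) => ei; rewrite ei /= in vh vP *.
  exists h, v; split=> //; apply: contraNneq hv => h0; rewrite h0 in vh.
  exact: subvP (addvSl _ _) _ vh.
by case/negP: hv; exact: subvP (addvSr _ _) _ vP.
Qed.

Lemma trace1_hom_ex : exists2 w, w \in L 0 & b w one = 1.
Proof.
have [o _ _ _ _] := hL.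
have [w] := graded_pairing hA hL o (one_neq0 hA dimA).
by rewrite oppr0 => w0 hw; exists w; rewrite // polarC.
Qed.

Hypothesis aniso : forall x, x \in L 0 -> q x = 0 -> x = 0.

(** If [q x = 0] and [b x y = 1] with [y] of degree [- k], then [qa_conj x ** y] lies in [L 0] and
    has norm 0, hence vanishes; but its trace is 1. *)
Lemma anisotropic_norm k x : x \in L k -> x != 0 -> q x != 0.
Proof.
move=> xk x0; have [y yk hxy] := graded_pairing hA hL xk x0.
have [_ _ m _ _] := hL.
have z0 : qa_conj x ** y \in L 0.
  by have := m _ _ _ _ (graded_conj hL xk) yk; rewrite subrr.
apply/eqP => qx; have /aniso h : q (qa_conj x ** y) = 0.
  by rewrite normM // norm_conj // qx mul0r.
have : b (x ** one) y = 1 by rewrite na_mulx1.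
rewrite adjoint_l // h // polar0r => /eqP.
by rewrite eq_sym (negPf (oner_neq0 F)).
Qed.

(** A single nonisotropic homogeneous odd [u] fixes the degree of every odd [y], because [y] is a
    multiple of [(y ** qa_conj u) ** u], whose left factor is even. *)
Lemma anisotropic_main : (P 0%R <= L 0%R)%VS -> graded_as Gam P.
Proof.
move=> P0L; have [g [u [ug u0]]] := odd_hom_ex.
have qu := anisotropic_norm ug u0; have [_ _ _ _ n] := hL.
have g2 : g + g = 0 by have [] := n _ _ ug qu.
have [uG uP] := memL ug; have [_ _ mP] := gP; have [_ _ mG] := grad.
have hP := grading_hurwitz_graded hA dimA gP.
have [o _ _ _ _] := hL; have [oG oP] := memL o.
apply: (graded_as_main gP _ P1_neq0 grad univ nontriv _ _ g2).
- apply: contraNneq (one_neq0 hA dimA) => h; by rewrite -memv0 -h.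
- by apply: subv_trans P0L _; exact: capvSl.
apply/subvP => y y1.
have -> : y = (q u)^-1 *: ((y ** qa_conj u) ** u).
  have := mulK_conj hA (qa_conj u) y.
  by rewrite conj_conj // norm_conj // => ->; rewrite scalerA mulVf // scale1r.
have yu : y ** qa_conj u \in Gam 0.
  apply: (subvP (capvSl _ _)); apply: (subvP P0L).
  have := mP _ _ _ _ y1 (graded_conj hP uP); rewrite /= (_ : 1 + 1 = 0) //.
  exact: val_inj.
by apply: memvZ; have := mG _ _ _ _ yu uG; rewrite add0r.
Qed.

End Anisotropic.

(** * The isotropic case *)

Section Isotropic.
Variables (F : fieldType) (A : quadAlg F) (hA : hurwitz A).
Hypothesis char2 : 2%N \in [pchar F].
Local Notation q := (qa_norm A).
Local Notation b := (@qa_polar F A).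
Local Notation one := (qa_one A).
Variables (P : 'Z_2 -> {vspace A}) (gP : grading P).
Hypothesis P1_neq0 : P 1 != 0%VS.
Variables (G : zmodType) (Gam : G -> {vspace A}).
Hypotheses (grad : grading Gam) (univ : universal_group Gam).
Hypothesis nontriv : ~ trivial_grading Gam.
Let L := refine Gam P.
Hypothesis hL : hurwitz_graded L.
Variables (e : A) (he : rank1_idempotent e) (e0 : e \in L 0).
Local Notation e' := (one - e).

Let e0' : e' \in L 0. Proof. by have [o _ _ _ _] := hL; rewrite memvB. Qed.

Let idem_neq0 : e != 0.
Proof.
case: he => _ he1; apply: contraTneq (oner_neq0 F) => h.
by rewrite -he1 h polar0l eqxx.
Qed.

Let P0_neq0 : P 0 != 0%VS.
Proof. by apply: contraNneq idem_neq0 => h; rewrite -memv0 -h; case: (memL e0). Qed.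

Section Dim8.
Hypotheses (dimA : \dim {:A} = 8%N) (dimP0 : \dim (P 0%R) = 4%N).

Let dimA0 : \dim {:A} != 0%N. Proof. by rewrite dimA. Qed.

Definition canonical_family : Prop := exists u v,
  [/\ canonical_basis8 e e' u v,
      {in [:: e; e'; u 1; u 2; u 3; v 1; v 2; v 3], forall x, homogeneous Gam x},
      P 0 = <<[:: e; e'; u 3; v 3]>>%VS, P 1 = <<[:: u 1; u 2; v 1; v 2]>>%VS
    & canonical_type Gam e e' u v].

Section Basis.
Variables (u v : 'Z_3 -> A) (a : 'Z_3 -> G * 'Z_2).
Hypothesis cb : canonical_basis8 e e' u v.
Hypotheses (uL : forall i, u i \in L (a i)) (vL : forall i, v i \in L (- a i)).
Hypothesis par : [/\ (a 0).2 = 0, (a 1).2 = 1 & (a 2).2 = 1].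

Let hom8 : homogeneous8 Gam e e' u v (fun i => (a i).1).
Proof.
have [eG _] := memL e0; have [eG' _] := memL e0'.
by split=> // i; [have [] := memL (uL i)|have [] := memL (vL i)].
Qed.

Lemma canonical_main_spans :
  P 0 = <<[:: e; e'; u 3; v 3]>>%VS /\ P 1 = <<[:: u 1; u 2; v 1; v 2]>>%VS.
Proof.
have [bas _ _ _ _] := cb; have [p0 p1 p2] := par.
have [_ eP] := memL e0; have [_ eP'] := memL e0'.
have pu i : u i \in P (a i).2 by have [] := memL (uL i).
have pv i : v i \in P (- (a i).2) by have [] := memL (vL i).
have Z3 : 3 = 0 :> 'Z_3 by exact: val_inj.
have Z2 : -1 = 1 :> 'Z_2 by exact: val_inj.
apply: (main_grading_spans gP).
- rewrite -(perm_basis _ (_ : perm_eq [:: e; e'; u 1; u 2; u 3; v 1; v 2; v 3] _)) //.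
  apply/permP => p /=; do 2 congr (_ + _)%N.
  move: (p (u 1) : nat) (p (u 2) : nat) (p (u 3) : nat) => n1 n2 n3.
  move: (p (v 1) : nat) (p (v 2) : nat) (p (v 3) : nat) => n4 n5 n6; lia.
- move=> x; rewrite Z3 !inE => /or4P[] /eqP -> //; first by rewrite -p0.
  by have := pv 0; rewrite p0 oppr0.
- move=> x; rewrite !inE => /or4P[] /eqP ->.
  + by rewrite -p1.
  + by rewrite -p2.
  + by have := pv 1; rewrite p1 Z2.
  + by have := pv 2; rewrite p2 Z2.
Qed.

Lemma canonical_familyI : (a 0).1 + (a 1).1 + (a 2).1 = 0 ->
  degree_pattern (fun i => (a i).1) \in basic_patterns -> canonical_family.
Proof.
move=> s pat; have [P0E P1E] := canonical_main_spans.
exists u, v; split=> //; last exact: (canonical_typeP grad univ cb hom8).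
have [h1 h2 hu hv] := hom8.
move=> x; rewrite !inE.
by repeat (case/orP; [|]); move=> /eqP ->;
  [exists 0|exists 0|exists (a 1).1|exists (a 2).1|exists (a 3).1
  |exists (- (a 1).1)|exists (- (a 2).1)|exists (- (a 3).1)].
Qed.

End Basis.

Definition doubling_family : Prop :=
  (exists w v u : A, let K := (<[one]> + <[w]>)%VS in CD_doubling P w v u /\
     graded_as Gam (table (H := ('Z_2 * 'Z_2)%type)
       [:: ((0, 0), K); ((1, 0), mulvr K v);
           ((0, 1), mulvr K u); ((1, 1), mulvr K (v ** u))]))
  \/
  (exists w v u : A, let K := (<[one]> + <[w]>)%VS in CD_doubling P w v u /\
     graded_as Gam (table (H := 'Z_2)
       [:: (0, (K + mulvr K u)%VS); (1, (mulvr K v + mulvr K (v ** u))%VS)])).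

Lemma isotropic8 : graded_as Gam P \/ doubling_family \/ canonical_family.
Proof.
have big : (2 < \dim (P 0%R))%N by rewrite dimP0.
have [u [a [uL hu h1 sum [p0 p1 p2]]]] :=
  homogeneous_triple hA dimA0 gP hL he e0 P1_neq0 big.
have cb := canonical8 hA dimA0 he dimA hu h1.
set v := (fun i => u (i + 1) ** u (i + 2)) in cb.
have Z3 (j k : 'Z_3) : j = k :> nat -> j = k by exact: val_inj.
have Z2 : -1 = 1 :> 'Z_2 by exact: val_inj.
have a3 i : a (i + 1) + a (i + 2) = - a i.
  apply/eqP; rewrite -addr_eq0 addrC addrA; apply/eqP; move: i; apply: Z3P.
  - by rewrite !add0r.
  - by rewrite (Z3 (1 + 1) 2) // (Z3 (1 + 2) 0) // -[RHS]sum [LHS]addrC addrA.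
  - by rewrite (Z3 (2 + 1) 0) // (Z3 (2 + 2) 1) // -[RHS]sum -addrA addrC.
have [_ _ m _ n] := hL.
have vL i : v i \in L (- a i) by rewrite -a3; exact: m.
have uG i : u i \in Gam (a i).1 by have [] := memL (uL i).
have vG i : v i \in Gam (- (a i).1) by have [] := memL (vL i).
have s : (a 0).1 + (a 1).1 + (a 2).1 = 0 by rewrite -[RHS]/((0 : G * 'Z_2).1) -sum.
have par : [/\ (a 0).2 = 0, (a 1).2 = 1 & (a 2).2 = 1] by [].
have [P0E P1E] := canonical_main_spans cb uL vL par.
have huv i : b (u i) (v i) = 1.
  have v0 : b (u 0) (v 0) = 1 by rewrite -h1; congr (b _ (u _ ** u _)); exact: Z3.
  have c1 : b (u 1) (u 2 ** u 0) = 1.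
    by rewrite -(polar_cyclic hA dimA0 he (hu 0) (hu 1) (hu 2)).
  have c2 : b (u 2) (u 0 ** u 1) = 1.
    by rewrite -(polar_cyclic hA dimA0 he (hu 1) (hu 2) (hu 0)).
  by move: i; apply: Z3P => //; [rewrite -c1|rewrite -c2];
    congr (b _ (u _ ** u _)); exact: Z3.
have hv i : in_peirce e' (v i) by exact: (peirce_mulUU hA dimA0 he).
(* [u i + v i] has norm 1, and it is homogeneous when [a i] is killed by 2, as [v i] has the
   opposite degree; such sums serve as doubling elements. *)
have quv i : q (u i + v i) = 1.
  rewrite normD (peirce_norm hA he (hu i)) huv.
  by rewrite (peirce_norm hA (idempotent_compl hA dimA0 he) (hv i)) !add0r.
have opp i : (a i).1 + (a i).1 = 0 -> - (a i).1 = (a i).1.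
  by move/eqP; rewrite addr_eq0 => /eqP {2}->.
have uvL i : (a i).1 + (a i).1 = 0 -> u i + v i \in L (a i).
  move=> /opp e2; apply: memvD => //; rewrite (_ : a i = - a i) //.
  rewrite [a i]surjective_pairing -[RHS]/((- (a i).1, - (a i).2)) e2.
  by case: (Z2P (a i).2) => ->; rewrite ?oppr0 ?Z2.
(* If [a 0] and [a 1] are killed by 2, so is every degree. The grading is then the main one when
   [a 0] vanishes in [G], and a doubling with [w = e] otherwise. *)
have [/andP[/eqP t0 /eqP t1]|N] := boolP (((a 0).1 + (a 0).1 == 0) && ((a 1).1 + (a 1).1 == 0)).
  have [z0|z0] := eqVneq (a 0).1 0.
    have a2 : (a 2).1 = (a 1).1.
      apply/eqP; rewrite -(opp _ t1) -addr_eq0 addrC.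
      by rewrite -[_ + _]add0r addrA -{1}z0 s.
    left; apply: (graded_as_main gP P0_neq0 P1_neq0 grad univ nontriv (g := (a 1).1)) => //.
      have [eG _] := memL e0; have [eG' _] := memL e0'.
      rewrite P0E; apply/span_subvP => x; rewrite (Z3 3 0) // !inE.
      by case/or4P=> /eqP -> //; [have := uG 0|have := vG 0]; rewrite z0 ?oppr0.
    rewrite P1E; apply/span_subvP => x; rewrite !inE.
    case/or4P=> /eqP ->; [exact: uG|by rewrite -a2|by rewrite -(opp _ t1)|].
    by rewrite -(opp _ t1) -a2.
  right; left.
  have a0E : a 0 = ((a 0).1, 0) by rewrite -p0 -surjective_pairing.
  have a1E : a 1 = ((a 1).1, 1) by rewrite -p1 -surjective_pairing.
  apply: (doubling_cases hA char2 dimA gP dimP0 grad univ hL (w := e)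
    (v := u 0 + v 0) (u := u 1 + v 1) (h := (a 0).1) (g := (a 1).1)) => //.
  - by case: he => _ ->; exact: oner_neq0.
  - by rewrite -a0E; exact: uvL.
  - by rewrite quv oner_neq0.
  - by rewrite -a1E; exact: uvL.
  - by rewrite quv oner_neq0.
right; right.
have : degree_pattern (fun i => (a i).1) \in basic_patterns ++ swapped_patterns.
  by apply: degree_patternP => // h1' h2'; rewrite h1' h2' eqxx in N.
rewrite mem_cat => /orP[pat|pat]; first exact: (canonical_familyI cb uL vL par s pat).
(* Negation on ['Z_3] fixes 0 and exchanges 1 and 2, which turns a swapped pattern into a basic one
   and keeps the parities. *)
have [m0 m1 m2] : [/\ - 0 = 0 :> 'Z_3, - 1 = 2 :> 'Z_3 & - 2 = 1 :> 'Z_3].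
  by split; exact: Z3.
apply: (canonical_familyI (canonical_basis8_swap char2 cb)
  (fun i => uL (- i)) (fun i => vL (- i))).
- by rewrite m0 m1 m2.
- by rewrite m0 m1 m2 -[RHS]s -!addrA; congr (_ + _); rewrite addrC.
move: pat; rewrite /degree_pattern m0 m1 m2 ![(a 1).1 == _]eq_sym [(a 0).1 == (a 2).1]eq_sym.
by rewrite !inE => /or4P[] /eqP[-> -> -> -> -> -> -> -> ->].
Qed.

End Dim8.
Section Dim4.
Hypothesis dimA : \dim {:A} = 4%N.

Let dimA0 : \dim {:A} != 0%N. Proof. by rewrite dimA. Qed.

(** An odd homogeneous [u] in the Peirce space and a dual vector [v] have degrees [g] and [- g].
    Whether [g + g] vanishes separates the main grading from the one by the integers. *)
Lemma isotropic4 : graded_as Gam P \/ exists u v,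
  [/\ canonical_basis4 e e' u v,
      {in [:: e; e'; u; v], forall x, homogeneous Gam x},
      P 0 = <<[:: e; e']>>%VS, P 1 = <<[:: u; v]>>%VS
    & graded_as Gam (table (H := int)
        [:: (0, <<[:: e; e']>>%VS); (1, <[u]>%VS); (-1, <[v]>%VS)])].
Proof.
have [[g i] [u [uh /= i1 hu u0]]] := peirce_odd_ex hA dimA0 gP hL he e0 P1_neq0.
rewrite {}i1 in uh.
have [v [vh hv huv]] := peirce_dual_hom hA dimA0 hL he e0 uh hu u0.
have cb := canonical4 hA dimA0 he dimA hu hv huv.
have [bas [m11 m22 m12 m21] [m1 m2 m3 m4] [n1 n2 n3 n4] [uu vv uv vu]] := cb.
have [uG uP] := memL uh; have [vG vP] := memL vh; rewrite /= in uG uP vG vP.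
have [eG eP] := memL e0; have [eG' eP'] := memL e0'.
have [P0E P1E] : P 0 = <<[:: e; e']>>%VS /\ P 1 = <<[:: u; v]>>%VS.
  apply: (main_grading_spans gP) => // x; rewrite !inE => /orP[] /eqP -> //.
  by rewrite (_ : 1 = -1) //; exact: val_inj.
have [/eqP g2|g2] := boolP (g + g == 0).
  left; apply: (graded_as_main gP P0_neq0 P1_neq0 grad univ nontriv (g := g)) => //.
    by rewrite P0E; apply/span_subvP => x; rewrite !inE => /orP[] /eqP ->.
  rewrite P1E; apply/span_subvP => x; rewrite !inE => /orP[] /eqP -> //.
  by have /eqP := g2; rewrite addr_eq0 => /eqP ->.
right; exists u, v; split=> //.
  by move=> x; rewrite !inE => /or4P[] /eqP ->; [exists 0|exists 0|exists g|exists (- g)].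
pose psi : {additive int -> G} := int_map g.
set t := [:: _; _; _].
have sub p : p \in t -> (p.2 <= Gam (psi p.1))%VS.
  rewrite !inE => /or3P[] /eqP -> /=; rewrite -?memvE //.
  by apply/span_subvP => x; rewrite !inE => /orP[] /eqP ->.
have full : (\sum_(p <- t) p.2)%VS = fullv.
  by rewrite !big_cons big_nil addv0 /= -(span_basis bas) !span_cons span_nil !addv0 -!addvA.
have g0 : g != 0 by apply: contraNneq g2 => ->; rewrite addr0.
have v0 : v != 0.
  by apply: contraTneq (oner_neq0 F) => h; rewrite -huv h polar0r eqxx.
apply: (graded_as_iso grad (psi := psi)) => //.
apply: (universal_iso grad univ sub full).
- move=> p; rewrite !inE => /or3P[] /eqP -> /=; rewrite -?dimv_eq0 ?dim_vline ?u0 ?v0 //.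
  rewrite dimv_eq0; apply: contraNneq idem_neq0 => h.
  by rewrite -memv0 -h memv_span // inE eqxx.
- move=> f hf; apply: int_additive_id.
  by apply: (hf (1, <[u]>%VS)); rewrite !inE eqxx orbT.
(* The degrees 0, [g], [- g] are pairwise distinct. *)
- have k1 : g <> 0 by exact/eqP.
  have k2 : 0 <> g by move=> /esym.
  have k3 : - g <> 0 by move=> h; apply: k1; rewrite -[g]opprK h oppr0.
  have k4 : 0 <> - g by move=> /esym.
  have k5 : g <> - g by move=> /eqP; rewrite -addr_eq0 (negPf g2).
  have k6 : - g <> g by move=> /esym.
  move=> p p'; rewrite !inE => /or3P[] /eqP -> /or3P[] /eqP -> //= h;
    first [case: (k1 h) | case: (k2 h) | case: (k3 h) | case: (k4 h) | case: (k5 h)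
      | case: (k6 h)].
- move=> p p' x y; rewrite !inE => /or3P[] /eqP -> /or3P[] /eqP -> /=.
  all: try by move=> *; exists (0, <<[:: e; e']>>%VS); rewrite ?inE ?eqxx.
  all: try by move=> *; exists (1, <[u]>%VS); rewrite ?inE ?eqxx ?orbT.
  all: try by move=> *; exists (-1, <[v]>%VS); rewrite ?inE ?eqxx ?orbT.
  + by move=> /vlineP[c ->] /vlineP[d ->]; rewrite na_mulZl na_mulZr uu !scaler0 eqxx.
  + by move=> /vlineP[c ->] /vlineP[d ->]; rewrite na_mulZl na_mulZr vv !scaler0 eqxx.
Qed.

End Dim4.
End Isotropic.

(** * The classification *)

Theorem corollary19
  (F : fieldType) (char2 : 2%N \in [pchar F])
  (Q : quadAlg F) (hQ : hurwitz Q)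
  (dimQ : \dim {:Q} = 2%N \/ \dim {:Q} = 4%N)
  (alpha : F) (alpha_neq0 : alpha != 0)
  (G : zmodType) (Gam : G -> {vspace CD Q alpha})
  (grad_Gam : super_grading (CD_main Q alpha) Gam)
  (univ_Gam : universal_group Gam)
  (nontriv_Gam : ~ trivial_grading Gam) :
  let C := CD Q alpha in
  let C0 := CD_main Q alpha 0 in
  let C1 := CD_main Q alpha 1 in
  (\dim {:Q} = 2%N ->
     graded_as Gam (CD_main Q alpha)
     \/
     qa_split Q /\
     exists e1 e2 u1 v1 : C,
       [/\ canonical_basis4 e1 e2 u1 v1,
           {in [:: e1; e2; u1; v1], forall x, homogeneous Gam x},
           C0 = <<[:: e1; e2]>>%VS,
           C1 = <<[:: u1; v1]>>%VS
         & graded_as Gam (table (H := int)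
             [:: (0, <<[:: e1; e2]>>%VS); (1, <[u1]>%VS); (-1, <[v1]>%VS)])])
  /\
  (\dim {:Q} = 4%N ->
     exists Del : G -> {vspace C},
       [/\ super_grading (CD_main Q alpha) Del,
           universal_group Del,
           graded_equiv (CD_main Q alpha) (CD_main Q alpha) Gam Del
         &
  (* (i) *)
  (exists w v u : C,
     let K := (<[qa_one C]> + <[w]>)%VS in
     CD_doubling (CD_main Q alpha) w v u /\
     graded_as Del (table (H := ('Z_2 * 'Z_2)%type)
       [:: ((0, 0), K); ((1, 0), mulvr K v);
           ((0, 1), mulvr K u); ((1, 1), mulvr K (v ** u))]))
  \/
  (* (ii) *)
  (graded_as Del (CD_main Q alpha)
   \/
   exists w v u : C,
     let K := (<[qa_one C]> + <[w]>)%VS in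
     CD_doubling (CD_main Q alpha) w v u /\
     graded_as Del (table (H := 'Z_2)
       [:: (0, (K + mulvr K u)%VS);
           (1, (mulvr K v + mulvr K (v ** u))%VS)]))
  \/
  (* (iii) *)
  (qa_split Q /\
   exists (e1 e2 : C) (u v : 'Z_3 -> C),
     [/\ canonical_basis8 e1 e2 u v,
         {in [:: e1; e2; u 1; u 2; u 3; v 1; v 2; v 3],
            forall x, homogeneous Del x},
         C0 = <<[:: e1; e2; u 3; v 3]>>%VS,
         C1 = <<[:: u 1; u 2; v 1; v 2]>>%VS
       &
     (* (a) *)
     graded_as Del (table (H := (int * int)%type)
       [:: ((0, 0), <<[:: e1; e2]>>%VS);
           ((1, 1), <[v 3]>%VS); ((-1, -1), <[u 3]>%VS);
           ((1, 0), <[u 1]>%VS); ((-1, 0), <[v 1]>%VS);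
           ((0, 1), <[u 2]>%VS); ((0, -1), <[v 2]>%VS)])
     \/
     (* (b) *)
     (graded_as Del (table (H := int)
        [:: (0, <<[:: e1; e2; u 3; v 3]>>%VS);
            (1, <<[:: u 1; v 2]>>%VS); (-1, <<[:: u 2; v 1]>>%VS)])
      \/
      graded_as Del (table (H := int)
        [:: (0, <<[:: e1; e2; u 1; v 1]>>%VS);
            (1, <<[:: u 3; v 2]>>%VS); (-1, <<[:: u 2; v 3]>>%VS)]))
     \/
     (* (c) *)
     (graded_as Del (table (H := int)
        [:: (0, <<[:: e1; e2]>>%VS);
            (2, <[v 3]>%VS); (-2, <[u 3]>%VS);
            (1, <<[:: u 1; u 2]>>%VS); (-1, <<[:: v 1; v 2]>>%VS)])
      \/
      graded_as Del (table (H := int)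
        [:: (0, <<[:: e1; e2]>>%VS);
            (2, <[v 1]>%VS); (-2, <[u 1]>%VS);
            (1, <<[:: u 2; u 3]>>%VS); (-1, <<[:: v 2; v 3]>>%VS)]))
     \/
     (* (d) *)
     graded_as Del (table (H := 'Z_3)
       [:: (0, <<[:: e1; e2]>>%VS);
           (1, <<[:: u 1; u 2; u 3]>>%VS); (2, <<[:: v 1; v 2; v 3]>>%VS)])
     \/
     (* (e) *)
     (graded_as Del (table (H := 'Z_4)
        [:: (0, <<[:: e1; e2]>>%VS); (1, <<[:: u 1; u 2]>>%VS);
            (2, <<[:: u 3; v 3]>>%VS); (3, <<[:: v 1; v 2]>>%VS)])
      \/
      graded_as Del (table (H := 'Z_4)
        [:: (0, <<[:: e1; e2]>>%VS); (1, <<[:: u 2; u 3]>>%VS);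
            (2, <<[:: u 1; v 1]>>%VS); (3, <<[:: v 2; v 3]>>%VS)]))
     \/
     (* (f) *)
     (graded_as Del (table (H := (int * 'Z_2)%type)
        [:: ((0, 0), <<[:: e1; e2]>>%VS);
            ((1, 0), <[u 2]>%VS); ((-1, 0), <[v 2]>%VS);
            ((0, 1), <<[:: u 1; v 1]>>%VS);
            ((-1, 1), <[u 3]>%VS); ((1, 1), <[v 3]>%VS)])
      \/
      graded_as Del (table (H := (int * 'Z_2)%type)
        [:: ((0, 0), <<[:: e1; e2]>>%VS);
            ((1, 0), <[u 2]>%VS); ((-1, 0), <[v 2]>%VS);
            ((0, 1), <<[:: u 3; v 3]>>%VS);
            ((-1, 1), <[u 1]>%VS); ((1, 1), <[v 1]>%VS)]))])]).
Proof.
move=> C C0 C1.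
have dimQ0 : \dim {:Q} != 0%N by case: dimQ => ->.
have assocQ := hurwitz_assoc hQ char2 dimQ0 dimQ.
have hC : hurwitz C := hurwitz_CD hQ assocQ alpha_neq0 dimQ0.
have dimC : \dim {:C} = (2 * \dim {:Q})%N := dim_CD Q alpha.
have dimC0 : \dim {:C} != 0%N by rewrite dimC; case: dimQ => ->.
have gP := CD_main_grading Q alpha; have [grad _] := grad_Gam.
have hL := hurwitz_graded_refine (grading_hurwitz_graded hC dimC0 grad)
  (grading_hurwitz_graded hC dimC0 gP) grad_Gam.
have dimC0E := dim_CD_even Q alpha.
have C1_neq0 : C1 != 0%VS.
  apply/eqP => h; have : ((0, qa_one Q) : C) \in C1 by rewrite mem_CD_odd.
  rewrite h memv0 => /eqP[h1]; have := one_neq0 hQ dimQ0.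
  by rewrite h1 eqxx.
have split_or : (forall x, x \in refine Gam (CD_main Q alpha) 0 ->
    qa_norm C x = 0 -> x = 0) \/
    qa_split Q /\ exists2 e, e \in refine Gam (CD_main Q alpha) 0 & rank1_idempotent e.
  (* Whether a quadratic form over an arbitrary field is isotropic is not decidable, hence the
     excluded middle. *)
  have [[x [x0 [nx qx]]]|h] := Classical_Prop.classic (exists x, x \in refine Gam (CD_main Q alpha) 0 /\
    x != 0 /\ qa_norm C x = 0); [right|left].
    split; last exact: (homogeneous_idempotent hC dimC0 hL x0 nx qx).
    by have [_ xP] := memL x0; exact: CD_split_even xP nx qx.
  move=> x x0 qx; apply/eqP; apply/negP => /negP nx; apply: h.
  by exists x.
split=> dQ.
  case: split_or => [aniso|[sp [e e0 he]]]; last first.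
    have dC4 : \dim {:C} = 4%N by rewrite dimC dQ.
    have [|[u [v [h1 h2 h3 h4 h5]]]] :=
      isotropic4 hC gP C1_neq0 grad univ_Gam nontriv_Gam hL he e0 dC4; first by left.
    by right; split=> //; exists e, (qa_one C - e), u, v.
  left; apply: (anisotropic_main hC dimC0 gP C1_neq0 grad univ_Gam nontriv_Gam hL aniso).
  have [w w0 hw] := trace1_hom_ex hC dimC0 hL.
  have hw0 : qa_polar w (qa_one C) != 0 by rewrite hw oner_neq0.
  have [o _ _ _ _] := hL.
  have KL : (<[qa_one C]> + <[w]> <= refine Gam (CD_main Q alpha) 0%R)%VS.
    by rewrite subv_add -!memvE o w0.
  (* The plane spanned by 1 and an element of trace 1 in degree 0 has the dimension of the even
     part, so the even part lies in degree 0. *)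
  suff <- : (<[qa_one C]> + <[w]>)%VS = CD_main Q alpha 0%R by [].
  apply/eqP; rewrite eqEdim (subv_trans KL (capvSr _ _)) /=.
  by rewrite (dim_plane char2 hw0) dim_CD_even dQ.
have dC8 : \dim {:C} = 8%N by rewrite dimC dQ.
have dP4 : \dim (CD_main Q alpha 0%R) = 4%N by rewrite dim_CD_even dQ.
(* The bases and doubling elements are found in [C] itself, so [Gam] is its own representative,
   equivalent to itself by the identity. *)
exists Gam; split=> //.
  exists \1%VF; split.
    split; last by move=> i; rewrite lim1g.
      by exists \1%VF => x; rewrite !id_lfunE.
    by move=> x y; rewrite !id_lfunE.
  by move=> g _; exists g; rewrite lim1g.
case: split_or => [aniso|[sp [e e0 he]]]; last first.
  have [h|[h|[u [v [h1 h2 h3 h4 h5]]]]] :=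
    isotropic8 hC char2 gP C1_neq0 grad univ_Gam nontriv_Gam hL he e0 dC8 dP4.
  - by right; left; left.
  - by case: h => h; [left|right; left; right].
  - by right; right; split=> //; exists e, (qa_one C - e), u, v.
have [P0L|P0L] := boolP (CD_main Q alpha 0%R <= refine Gam (CD_main Q alpha) 0%R)%VS.
  right; left; left.
  exact: (anisotropic_main hC dimC0 gP C1_neq0 grad univ_Gam nontriv_Gam hL aniso).
have [h [v [vh h0 v0]]] := even_hom_ex gP hL P0L.
have [g [u [ug u0]]] := odd_hom_ex gP C1_neq0 hL.
have [w w0 hw] := trace1_hom_ex hC dimC0 hL.
have hw0 : qa_polar w (qa_one C) != 0 by rewrite hw oner_neq0.
have qv := anisotropic_norm hC dimC0 hL aniso vh v0.
have qu := anisotropic_norm hC dimC0 hL aniso ug u0.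
have [hh|hh] := doubling_cases hC char2 dC8 gP dP4 grad univ_Gam hL w0 hw0 vh h0 qv ug qu.
  by left.
by right; left; right.
Qed.
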